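(* Let $X=(X,d,\mu)$ be a metric measure space and let $f\in \mathrm{LIP}_{bs}(X)$. Then there exists a sequence $(f_j)\subset \mathrm{LIP}_{bs}(X)$ with $\mathrm{LIP}(f_j)\le \mathrm{LIP}(f)$ and $|f_j|\le |f|$ for each $j\in\mathbb{N}$, such that (1) $f_j\to f$ pointwise everywhere (and consequently uniformly on compact sets); (2) $\operatorname{Lip}_af_j\to |Df|_\ast$, $\operatorname{Lip} f_j\to |Df|_\ast$, and $|Df_j|_\ast\to |Df|_\ast$ pointwise $\mu$-a.e.
   Context: A metric measure space $X=(X,d,\mu)$ is a complete separable metric space $(X,d)$ with a Borel regular measure $\mu$ that is finite on bounded sets (a Radon measure). $\mathrm{LIP}(f)$ is the least global Lipschitz constant of $f$; $\mathrm{LIP}(X)$ is the set of Lipschitz functions $X\to\mathbb{R}$ and $\mathrm{LIP}_{bs}(X)$ the set of those with bounded support. Set $\operatorname{Lip}_af(x)=\lim_{r\to0}\mathrm{LIP}(f|_{B(x,r)})$ and $\operatorname{Lip} f(x)=\lim_{r\to0}\sup_{y\in B(x,r)\setminus\{x\}}\frac{|f(x)-f(y)|}{d(x,y)}$; both are $0$ at isolated points. Curve fragments. A curve fragment is a bi-Lipschitz map $\gamma:\mathrm{dom}(\gamma)\to X$ from a compact set $\mathrm{dom}(\gamma)\subset\mathbb{R}$; write $\gamma_t=\gamma(t)$; $\mathrm{Fr}(X)$ is the set of curve fragments. The metric speed $|\gamma_t'|=\lim_{\mathrm{dom}(\gamma)\ni s\to t}d(\gamma_t,\gamma_s)/|t-s|$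 exists for a.e. $t\in\mathrm{dom}(\gamma)$. Set $\int_\gamma\rho\,\mathrm{d}s=\int_{\mathrm{dom}(\gamma)}\rho(\gamma_t)|\gamma_t'|\,\mathrm{d}t$ for Borel $\rho:X\to[0,\infty]$. If $[a,b]$ is the smallest interval containing $\mathrm{dom}(\gamma)$ and $[a,b]\setminus\mathrm{dom}(\gamma)=\bigcup_i(a_i,b_i)$ (disjoint open intervals), set $\mathrm{gap}(\gamma)=\sum_i d(\gamma_{a_i},\gamma_{b_i})$. Set $\mathrm{osc}_\gamma f=\sup_{x,y\in\mathrm{im}(\gamma)}|f(x)-f(y)|$. Modulus and upper gradients. For $\Gamma\subset\mathrm{Fr}(X)$, $\mathrm{Mod}_\infty(\Gamma)=\inf\{\|\rho\|_{L^\infty(\mu)}:\rho:X\to[0,\infty]\text{ Borel},\ \int_\gamma\rho\,\mathrm{d}s\ge1\ \forall\gamma\in\Gamma\}$. A Borel function $g:X\to[0,\infty]$ is a $\ast$-upper gradient of $f\in\mathrm{LIP}(X)$ if $\mathrm{osc}_\gamma f\le\int_\gamma g\,\mathrm{d}s+\mathrm{LIP}(f)\,\mathrm{gap}(\gamma)$ for every $\gamma\in\mathrm{Fr}(X)$, and a weak $\ast$-upper gradient if this holds for all $\gamma$ outside a family of zero $\mathrm{Mod}_\infty$. The minimal $\ast$-upper gradient $|Df|_\ast$ is the ($\mu$-a.e. unique) $\ast$-upper gradient of $f$ with $|Df|_\ast\le\rho$ $\mu$-a.e. for every weak $\ast$-upper gradient $\rho\in L^\infty(\mu)$ of $f$ (it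 exists). *)

(* Defs.v *)
From HB Require Import structures.
From mathcomp Require Import all_boot all_order all_algebra.
From mathcomp Require Import all_classical all_reals all_analysis measurable_realfun.

Set Implicit Arguments.
Unset Strict Implicit.
Unset Printing Implicit Defensive.

Import Order.TTheory GRing.Theory Num.Theory.
Import numFieldNormedType.Exports.

Local Open Scope classical_set_scope.
Local Open Scope ring_scope.

#[short(type="completeMetricMeasurableType")]
HB.structure Definition CompleteMetricMeasurable (R : realType)
    (d : measure_display) :=
  { T of Metric R T & Complete T & Measurable d T }.

Section metric_measure_space.
Context (R : realType) (d : measure_display).
Variable X : completeMetricMeasurableType R d.

Definition separable := exists2 D : set X, countable D & dense D.

Definition borel_sigma_algebra := @measurable d X = <<s @open X >>.

Definition mbounded (A : set X) := exists x r, A `<=` ball x r.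

(* A Borel regular (outer) measure is determined by its restriction to the
   Borel sets, and its null sets are the subsets of Borel null sets, that is
   the sets that are negligible for the restriction. *)
Definition metric_measure_space (mu : {measure set X -> \bar R}) :=
  [/\ separable, borel_sigma_algebra
    & forall A, measurable A -> mbounded A -> (mu A < +oo)%E].

End metric_measure_space.

Section lipschitz.
Context (R : realType) (X : metricType R).
Implicit Types (f : X -> R) (A : set X) (x : X).

Definition lipschitz_with (L : R) A f :=
  0 <= L /\ forall x y, A x -> A y -> `|f x - f y| <= L * mdist x y.

(* The least Lipschitz constant of the restriction of f to A; it is +oo if the
   restriction is not Lipschitz. *)
Definition LIP A f : \bar R :=
  ereal_inf [set L%:E | L in [set L | lipschitz_with L A f]].

Definition lipschitz_fun f := exists L, lipschitz_with L setT f.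

Definition lipschitz_bs f :=
  lipschitz_fun f /\
  exists x r, closure [set y | f y != 0] `<=` ball x r.

Definition Lip_a f x : \bar R := lim (LIP (ball x r) f @[r --> 0^'+]).

Definition Lip f x : \bar R :=
  if `[< isolated [set: X] x >] then 0%E
  else lim (ereal_sup [set (`|f x - f y| / mdist x y)%:E
                      | y in ball x r `\ x] @[r --> 0^'+]).

End lipschitz.

Section curve_fragments.
Context (R : realType) (X : metricType R).

(* The values of frag_map outside frag_dom are irrelevant: every notion below
   only depends on the restriction of frag_map to frag_dom. *)
Record fragment := Fragment {
  frag_dom : set R ;
  frag_map :> R -> X ;
  frag_nonempty : frag_dom !=set0 ;
  frag_compact : compact frag_dom ;
  frag_bilip : exists2 L : R, 0 < L &
    forall s t, frag_dom s -> frag_dom t ->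
      L^-1 * `|s - t| <= mdist (frag_map s) (frag_map t) <= L * `|s - t| }.

Implicit Types (g : fragment) (f : X -> R) (rho : X -> \bar R).

(* The limit exists at almost every t in frag_dom g; the value of lim at the
   other points does not affect the integrals below. *)
Definition metric_speed g (t : R) : R :=
  lim ((mdist (g t) (g s) / `|t - s|) @[s --> within (frag_dom g) t^']).

Definition frag_integral g rho : \bar R :=
  (\int[@lebesgue_measure R]_(t in frag_dom g)
     (rho (g t) * (metric_speed g t)%:E))%E.

(* The pairs (a_i, b_i) of endpoints of the components of [a, b] \ dom. *)
Definition frag_gaps g : set (R * R) :=
  let hull : set R := `[inf (frag_dom g), sup (frag_dom g)]%classic in
  let U := hull `\` frag_dom g in
  [set p | exists2 t, U t & connected_component U t = `]p.1, p.2[%classic].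

Definition gap g : \bar R :=
  (\esum_(p in frag_gaps g) (mdist (g p.1) (g p.2))%:E)%E.

Definition osc g f : \bar R :=
  ereal_sup [set (`|f x - f y|)%:E | x in g @` frag_dom g
                                    & y in g @` frag_dom g].

End curve_fragments.

Section upper_gradients.
Context (R : realType) (d : measure_display).
Context (X : completeMetricMeasurableType R d).
Variable mu : {measure set X -> \bar R}.
Local Open Scope ereal_scope.
Implicit Types (f : X -> R) (g rho : X -> \bar R).

Definition borel_nonneg rho :=
  measurable_fun [set: X] rho /\ forall x, 0 <= rho x.

Definition Mod_infty (Gamma : set (fragment X)) : \bar R :=
  ereal_inf [set 'N[mu]_+oo[rho] | rho in
    [set rho | borel_nonneg rho /\
       forall c, Gamma c -> 1 <= frag_integral c rho]].

Definition upper_gradient_along f g (c : fragment X) :=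
  osc c f <= frag_integral c g + LIP setT f * gap c.

Definition star_upper_gradient f g :=
  borel_nonneg g /\ forall c, upper_gradient_along f g c.

Definition weak_star_upper_gradient f g :=
  borel_nonneg g /\
  exists2 Gamma : set (fragment X), Mod_infty Gamma = 0
    & forall c, ~ Gamma c -> upper_gradient_along f g c.

Definition is_minimal_star_upper_gradient f g :=
  star_upper_gradient f g /\
  forall rho, weak_star_upper_gradient f rho -> 'N[mu]_+oo[rho] < +oo ->
    {ae mu, forall x, g x <= rho x}.

(* A representative of the minimal *-upper gradient, which exists and is
   unique mu-a.e. for Lipschitz f; the default value cst 0 is then unused. *)
Definition minimal_star_upper_gradient f : X -> \bar R :=
  xget (cst 0) [set g | is_minimal_star_upper_gradient f g].

End upper_gradients.

(* Main.v *)
(** Write g for the minimal upper gradient of f and L for its Lipschitz constant.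

    On a compact set C where g oscillates slowly, let u_r(x) be the infimum of
    f(end) + cost over finite chains starting at x, where a jump costs L times
    its length, except that a jump between two points of the r-ball around some
    p in C only costs w(p) = g(p) + 1/n times its length.  Then u_r <= f is
    L-Lipschitz and has Lipschitz constant at most w(p) on the r-ball around p.
    If u_r(x) stayed below f(x) - e as r -> 0, the near-optimal chains,
    parametrized by cost, would converge along an ultrafilter to a curve
    fragment in C starting at x: the cheap steps give a part of dom(gamma) on
    which g |gamma'| <= 1, the expensive jumps give the gaps, and the upper
    gradient inequality along gamma contradicts the drop of f.  Truncating u_r
    and its counterpart from above at 0 yields L-Lipschitz functions F with
    |F| <= |f|, F close to f and asymptotic Lipschitz constant at most w on C.

    As the sets C exhaust the support of f up to a null set, such F give
    Lip_a F_n <= g + 1/n.  For the matching lower bound, the admissible F form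
    decreasing midpoint-convex classes, and near-minimizers F_n of the L^2 norm
    of the minimal upper gradient have, by the parallelogram identity, almost
    everywhere convergent gradients.  Since sup_(m >= n) |DF_m| is an upper
    gradient of f for every n, the limit is at least g. *)
Require Import Defs.
From HB Require Import structures.
From mathcomp Require Import all_boot all_order all_algebra.
From mathcomp Require Import all_classical all_reals all_analysis measurable_realfun.
From mathcomp Require Import lra ring.

Set Implicit Arguments.
Unset Strict Implicit.
Unset Printing Implicit Defensive.

Import Order.TTheory GRing.Theory Num.Theory.
Import numFieldNormedType.Exports.

Local Open Scope classical_set_scope.
Local Open Scope ring_scope.

(** * Lipschitz functions on the line *)

(** Along a fragment c, almost everywhere c has a speed m and f o c a slope h relative to the
    domain. A Borel rho >= 0 is an upper gradient of a Lipschitz f exactly when |h| <= rho(c) m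
    almost everywhere along every c. Countable infima and midpoints of upper gradients are pointwise
    statements in this form, whereas the integral inequality, in which LIP(f) multiplies the gap,
    does not combine directly. The term 1/n in w does two jobs. It absorbs the oscillation of g on
    C, and it puts a positive floor under the cost per unit length, which makes the limit of the
    chains Lipschitz in the cost parameter. The reverse bound comes from near-optimality: a stretch
    of chain cannot cost much more than the direct jump, L times the distance between its ends. The
    chains bound Lip_a from above only. For the opposite bound, passing to the limit gives an upper
    gradient of f only from suprema of whole tails, hence controls a limsup; the minimization is
    there to make this limsup a limit almost everywhere. *)

Section lipschitz_ftc.
Context {R : realType}.
Local Notation leb := (@lebesgue_measure R).

Definition strong_lebesgue_pt (w : R -> R) (t : R) :=
  forall e : R, 0 < e -> exists2 d : R, 0 < d & forall r : R, 0 < r -> r < d ->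
    (\int[leb]_(y in ball t r) `|w y - w t|%:E <= (e * r)%:E)%E.

(** The derivative of F at t relative to D. It is unique only at accumulation points of D; at an
    isolated point of D every l qualifies. *)
Definition has_slope (D : set R) (F : R -> R) (t l : R) :=
  forall e : R, 0 < e -> exists2 d : R, 0 < d & forall s, D s -> `|s - t| < d ->
    `|F s - F t - l * (s - t)| <= e * `|s - t|.

Lemma bounded_integrable (w : R -> R) (K : R) (A : set R) :
  measurable_fun [set: R] w -> (forall x, `|w x| <= K) -> measurable A ->
  (leb A < +oo)%E -> leb.-integrable A (EFin \o w).
Proof.
move=> mw wK mA Afin; apply: measurable_bounded_integrable => //.
- exact: measurable_funTS.
- exists K; split; first exact: num_real.
  by move=> M KM x _ /=; rewrite (le_trans (wK x))// ltW.
Qed.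

Lemma bounded_locally_integrable (w : R -> R) (K : R) :
  measurable_fun [set: R] w -> (forall x, `|w x| <= K) ->
  locally_integrable [set: R] w.
Proof.
move=> mw wK; split => //; first exact: openT.
move=> A _ cA; have mA : measurable A by exact: compact_measurable.
have /integrableP[_] := bounded_integrable mw wK mA (compact_finite_measure cA).
by [].
Qed.

Lemma ae_strong_lebesgue_pt (w : R -> R) : locally_integrable [set: R] w ->
  {ae leb, forall t, strong_lebesgue_pt w t}.
Proof.
move=> lw; apply: (@filterS _ _ (ae_filter_ringOfSetsType leb)) (lebesgue_differentiation lw) =>
  t wt e e0 {lw}.
have e20 : 0 < e / 2 by rewrite divr_gt0.
have nb : nbhs (0%E : \bar R) [set y | (y < (e / 2)%:E)%E].
  exact: (@nbhs_open_ereal_lt R 0 (fun=> e / 2)).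
have := wt _ nb.
rewrite /nbhs/= => -[d /= d0 dP]; exists d => // r r0 rd.
have := dP r; rewrite /= sub0r normrN gtr0_norm// => /(_ rd r0).
rewrite /davg /iavg lebesgue_measure_ball ?(ltW r0)//.
rewrite inver mulrn_eq0/= gt_eqF//= lte_pdivrMl ?mulrn_wgt0// => /ltW.
move=> /le_trans; apply.
by rewrite -EFinM lee_fin -mulr_natl; lra.
Qed.

(** Both measures are infima over the same covers by half-open intervals, and a cover of total
    length below [e / K] has total G-increment at most e. *)
Lemma stieltjes_null_dominates (G : cumulative R R) (K : R) : 0 < K ->
  (forall x y, x <= y -> G y - G x <= K * (y - x)) ->
  lebesgue_stieltjes_measure G `<< leb.
Proof.
move=> K0 GK N N0 A mA AN; have A0 : leb A = 0%E by exact: N0.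
apply/eqP; rewrite eq_le measure_ge0 andbT; apply/lee_addgt0Pr => e e0.
rewrite add0e.
have eK0 : (leb A < (e / K)%:E)%E by rewrite A0 lte_fin divr_gt0.
have [_ [F [mF AF] <-] Fe] := ereal_inf_lt eK0.
apply: (@le_trans _ _ (\sum_(0 <= k <oo) wlength G (F k))%E).
  by apply: ereal_inf_lbound; exists F.
apply: (@le_trans _ _ (\sum_(0 <= k <oo) (K%:E * wlength idfun (F k)))%E).
  apply: lee_nneseries => [k _ _|k _]; first exact: wlength_ge0.
  have [->|[[a b] /= ab ->]] := (ocitvP (F k)).1 (mF k).
    by rewrite !wlength0 mule0.
  have ab' := ltW ab; rewrite (wlength_itv_bnd G _ _ ab').
  by rewrite (wlength_itv_bnd idfun _ _ ab') -EFinM lee_fin GK.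
rewrite nneseriesZl => [|k _]; last exact: wlength_ge0.
by move: Fe => /ltW; rewrite [(e / K)%R]mulrC EFinM lee_pdivlMl.
Qed.

(** The remainder at s is the integral of [h - h t] between s and t. This interval lies in the open
    ball of radius [2 * |s - t|], and the factor 2 is compensated by using the Lebesgue point with
    [e / 2]. *)
Lemma slope_of_density (phi h : R -> R) (a b t : R) :
  measurable_fun [set: R] h -> leb.-integrable `[a, b] (EFin \o h) ->
  (forall x y, a <= x -> x <= y -> y <= b ->
     (phi y - phi x)%:E = (\int[leb]_(z in `[x, y]) (h z)%:E)%E) ->
  a < t < b -> strong_lebesgue_pt h t -> has_slope [set: R] phi t (h t).
Proof.
move=> mh ihab phiE /andP[at_ tb] ht e e0.
have [d d0 dP] := ht (e / 2) ltac:(lra).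
pose d' := Num.min (d / 2) (Num.min (t - a) (b - t)).
have d'0 : 0 < d' by rewrite !lt_min !subr_gt0 at_ tb divr_gt0.
exists d' => // s _; rewrite !lt_min => /and3P[sd sa sb].
have [->|st] := eqVneq s t.
  by rewrite !subrr mulr0 subrr normr0 mulr0.
have n0 : 0 < `|s - t| by rewrite normr_gt0 subr_eq0.
have as_ : a <= s by rewrite ltW//; move: sa; rewrite distrC ltr_norml; lra.
have sb_ : s <= b by rewrite ltW//; move: sb; rewrite ltr_norml; lra.
have sub_ball x y : (x = s /\ y = t) \/ (x = t /\ y = s) -> x <= y ->
    `[x, y] `<=` ball t (2 * `|s - t|).
  move=> xy xy' z/=; rewrite in_itv/= => /andP[xz zy].
  rewrite /ball/= ltr_norml.
  case: xy => -[? ?]; subst x y; [rewrite ler0_norm ?subr_le0 //|rewrite ger0_norm ?subr_ge0//];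
    by apply/andP; split; lra.
have bound x y : (x = s /\ y = t) \/ (x = t /\ y = s) -> x <= y ->
    `|phi y - phi x - h t * (y - x)| <= e * `|s - t|.
  move=> xy xy'.
  have ax : a <= x by case: xy => -[-> _] //; exact: ltW.
  have yb : y <= b by case: xy => -[_ ->] //; exact: ltW.
  have mxy : measurable (`[x, y]%classic : set R) by exact: measurable_itv.
  have lxy : leb `[x, y]%classic = (y - x)%:E.
    rewrite lebesgue_measure_itv/= lte_fin lt_neqAle xy' andbT.
    by case: eqVneq => [->|]/=; rewrite ?subrr// EFinB.
  have ih : leb.-integrable `[x, y] (EFin \o h).
    apply: integrableS ihab => //; apply: subset_itvScc => //.
  have ic : leb.-integrable `[x, y] (EFin \o cst (h t)).
    by apply: (@bounded_integrable _ `|h t|) => //; rewrite lxy ltry.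
  have -> : phi y - phi x - h t * (y - x) =
      fine (\int[leb]_(z in `[x, y]) (h z - h t)%:E)%E.
    under eq_integral do rewrite EFinB.
    rewrite (integralB _ ih ic)// -phiE//.
    have -> : (\int[leb]_(z in `[x, y]) (EFin \o cst (h t)) z)%E = (h t * (y - x))%:E.
      transitivity ((h t)%:E * leb `[x, y]%classic)%E; last by rewrite lxy -EFinM.
      exact: (@integral_cst _ _ _ leb `[x, y]%classic _ (h t)%:E).
    by rewrite -EFinB.
  have mht : measurable_fun [set: R] (fun z => h z - h t) by apply: measurable_funB.
  rewrite -lee_fin -abse_EFin fineK; last first.
    by apply: integrable_fin_num => //; exact: (integrableB _ ih ic).
  apply: (le_trans (le_abse_integral _ _ _)) => //.
    by apply/measurable_EFinP; exact: measurable_funTS.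
  have r0 : 0 < 2 * `|s - t| by rewrite mulr_gt0.
  have rd : 2 * `|s - t| < d by move: sd; rewrite ltr_pdivlMr// mulrC.
  apply: (@le_trans _ _ (\int[leb]_(z in ball t (2 * `|s - t|)%R) `|h z - h t|%:E)%E).
    apply: ge0_subset_integral => //; last exact: sub_ball.
      by apply: open_measurable; exact: ball_open.
    by apply/measurable_EFinP/measurable_funTS; exact: measurableT_comp.
  apply: (le_trans (dP _ r0 rd)); rewrite lee_fin; lra.
have [st'|ts'] := leP s t.
  have := bound s t (or_introl (conj erefl erefl)) st'.
  by rewrite -normrN; congr (`|_| <= _); ring.
by apply: bound (ltW ts'); right.
Qed.

Lemma lipschitz_density (phi : R -> R) (K a b : R) : a < b -> 0 < K ->
  (forall x y, `|phi x - phi y| <= K * `|x - y|) ->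
  exists h : R -> R, [/\ measurable_fun [set: R] h, forall x, `|h x| <= K,
    forall x y, a <= x -> x <= y -> y <= b ->
     (phi y - phi x)%:E = (\int[leb]_(z in `[x, y]) (h z)%:E)%E
    & {ae leb, forall t, a < t < b -> has_slope [set: R] phi t (h t)}].
Proof.
move=> ab K0 phiK.
(* Adding [K * x] makes phi nondecreasing with increments at most [2 * K * (y - x)]. The Stieltjes
   measure of G then has a Radon-Nikodym density, and subtracting K from it gives a density of
   phi. *)
pose G x := phi x + K * x.
have GE x y : x <= y -> 0 <= G y - G x <= 2 * K * (y - x).
  move=> xy; have := phiK y x; rewrite [`|y - x|]ger0_norm ?subr_ge0//.
  by rewrite ler_norml /G => /andP[? ?]; apply/andP; split; nra.
have Gnd : nondecreasing G.
  by move=> x y /GE/andP[+ _]; rewrite subr_ge0.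
have Grc : right_continuous G.
  apply: right_continuousW => x; apply: cvgD.
    apply/cvgrPdist_le => e e0; near=> y.
    apply: (le_trans (phiK _ _)); rewrite -ler_pdivlMl//.
    by near: y; apply: cvgr_dist_le => //; rewrite mulr_gt0 ?invr_gt0.
  by apply: cvgM; [exact: cvg_cst|exact: cvg_id].
pose G' : cumulative R R := HB.pack G (isCumulative.Build R _ R G Gnd Grc).
pose nu0 := lebesgue_stieltjes_measure G'.
have mI : measurable (`]a, b]%classic : set (measurableTypeR R)) by exact: measurable_itv.
have nuE x y : x <= y -> nu0 `]x, y]%classic = (G y - G x)%:E.
  move=> xy; rewrite /nu0 /lebesgue_stieltjes_measure /measure_extension/=.
  rewrite (@measurable_mu_extE _ _ _ (wlength G'))/=; last exact: is_ocitv.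
  by rewrite wlength_itv_bnd.
have nufin : (nu0 `]a, b]%classic < +oo)%E by rewrite nuE ?ltry// ltW.
pose nu := mfrestr mI nufin.
have dom : nu `<< leb.
  move=> N N0 A mA AN; rewrite /nu /mfrestr /mrestr.
  have K20 : 0 < 2 * K by rewrite mulr_gt0.
  have GK x y : x <= y -> G' y - G' x <= 2 * K * (y - x) by move=> /GE/andP[].
  have := @stieltjes_null_dominates G' (2 * K) K20 GK N N0 (A `&` `]a, b]%classic).
  apply => //.
  - exact: measurableI.
  - by move=> z [/AN].
have [f [f0 ffin fint fE]] := @radon_nikodym_sigma_finite _ _ _ leb nu dom.
have mf : measurable_fun [set: R] f by have := measurable_int _ fint; exact.
have nuf x y : a <= x -> x <= y -> y <= b ->
    (G y - G x)%:E = (\int[leb]_(z in `[x, y]) f z)%E.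
  move=> ax xy yb; rewrite -nuE//.
  have mxy : measurable (`]x, y]%classic : set (measurableTypeR R)) by exact: measurable_itv.
  have <- : nu `]x, y]%classic = nu0 `]x, y]%classic.
    rewrite /nu /mfrestr /mrestr setIidl// => z/=.
    by rewrite !in_itv/= => /andP[xz zy]; apply/andP; split; lra.
  transitivity (\int[leb]_(z in `]x, y]) f z)%E; first exact: fE.
  rewrite integral_itv_obnd_cbnd//.
  exact/measurable_funTS.
pose h0 (x : R) := fine (f x) - K.
have mh0 : measurable_fun [set: R] h0.
  apply: measurable_funB => //.
  exact: (measurableT_comp (fine_measurable _) mf).
have ffint : leb.-integrable [set: R] (EFin \o (fine \o f)).
  by have -> : EFin \o (fine \o f) = f by apply/funext => x /=; rewrite fineK.
have locf : locally_integrable [set: R] h0.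
  apply: locally_integrableB.
    by apply: open_integrable_locally => //; exact: openT.
  by apply: (@bounded_locally_integrable _ `|K|).
have ih0 : leb.-integrable `[a, b] (EFin \o h0).
  apply/integrableP; split; first exact/measurable_EFinP/measurable_funTS.
  by case: locf => _ _; apply => //; exact: segment_compact.
have phih0 x y : a <= x -> x <= y -> y <= b ->
    (phi y - phi x)%:E = (\int[leb]_(z in `[x, y]) (h0 z)%:E)%E.
  move=> ax xy yb.
  have mxy : measurable (`[x, y]%classic : set (measurableTypeR R)) by exact: measurable_itv.
  have lxy : leb `[x, y]%classic = (y - x)%:E.
    rewrite lebesgue_measure_itv/= lte_fin lt_neqAle xy andbT.
    by case: eqVneq => [->|]/=; rewrite ?subrr// EFinB.
  have if_ : leb.-integrable `[x, y] (EFin \o (fine \o f)).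
    exact: integrableS ffint.
  have ic : leb.-integrable `[x, y] (EFin \o cst K).
    by apply: (@bounded_integrable _ `|K|) => //; rewrite lxy ltry.
  under eq_integral do rewrite EFinB.
  rewrite (integralB _ if_ ic)//.
  have -> : (\int[leb]_(z in `[x, y]) (EFin \o cst K) z)%E = (K * (y - x))%:E.
    transitivity (K%:E * leb `[x, y]%classic)%E; last by rewrite lxy -EFinM.
    exact: (@integral_cst _ _ _ leb `[x, y]%classic _ K%:E).
  under eq_integral do rewrite /= fineK//.
  by rewrite -nuf// -EFinB; congr EFin; rewrite /G; ring.
have slopeK t l : has_slope [set: R] phi t l -> `|l| <= K.
  move=> tl; apply/ler_addgt0Pr => e e0.
  have [d d0 dP] := tl e e0.
  have := dP (t + d / 2) I; rewrite addrAC subrr add0r.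
  have d20 : 0 < d / 2 by rewrite divr_gt0.
  rewrite gtr0_norm// => /(_ ltac:(lra)) H.
  have := phiK (t + d / 2) t; rewrite addrAC subrr add0r (gtr0_norm d20) => H2.
  rewrite -(ler_pM2r d20) -{1}(gtr0_norm d20) -normrM.
  by rewrite mulrDl; move: H H2; rewrite !ler_norml => /andP[? ?] /andP[? ?]; lra.
(* The density is a slope, hence bounded by K, only almost everywhere; truncation makes the bound
   hold everywhere and changes h0 on a null set of the interval. *)
pose h x := if `|h0 x| <= K then h0 x else 0.
have mh : measurable_fun [set: R] h.
  apply: measurable_fun_ifT => //; apply: measurable_fun_ler => //.
  exact: measurableT_comp.
have h0h : {ae leb, forall t, a < t < b -> h t = h0 t /\ has_slope [set: R] phi t (h0 t)}.
  apply: (@filterS _ _ (ae_filter_ringOfSetsType leb)) (ae_strong_lebesgue_pt locf).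
  move=> t ht tab; have sl := slope_of_density mh0 ih0 phih0 tab ht.
  by split => //; rewrite /h (slopeK _ _ sl).
exists h; split => //.
- by move=> x; rewrite /h; case: ifP => // _; rewrite normr0; exact: ltW.
- move=> x y ax xy yb; rewrite phih0//.
  have mxy : measurable (`[x, y]%classic : set (measurableTypeR R)) by exact: measurable_itv.
  rewrite integral_itv_bndoo; last exact/measurable_EFinP/measurable_funTS.
  rewrite [RHS]integral_itv_bndoo; last exact/measurable_EFinP/measurable_funTS.
  apply: ae_eq_integral => //.
  - exact/measurable_EFinP/measurable_funTS.
  - exact/measurable_EFinP/measurable_funTS.
  apply: (@filterS _ _ (ae_filter_ringOfSetsType leb)) h0h => t ht.
  rewrite /= in_itv/= => /andP[xt ty]; rewrite (ht _).1//; apply/andP; split.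
  exact: le_lt_trans xt.
  exact: lt_le_trans yb.
- apply: (@filterS _ _ (ae_filter_ringOfSetsType leb)) h0h => t ht tab.
  by have [-> ?] := ht tab.
Unshelve. all: by end_near.
Qed.

End lipschitz_ftc.

(** * Compact subsets of the line *)

Section integral_without_measurability.
Local Open Scope ereal_scope.
Context d (T : measurableType d) (R : realType) (mu : {measure set T -> \bar R}).
Import HBNNSimple.

Let nnint (f : T -> \bar R) := ereal_sup [set sintegral mu h |
  h in [set h : {nnsfun T >-> R} | forall x, (h x)%:E <= f x]].

(** A simple function below f lies below g once it is multiplied by the indicator of the complement
    of the exceptional null set, which does not change its integral. *)
Let nnint_le (f g : T -> \bar R) : (forall x, 0 <= g x) ->
  {ae mu, forall x, f x <= g x} -> nnint f <= nnint g.
Proof.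
move=> g0 [N [mN N0 fgN]]; apply: ge_ereal_sup => _ [h hf <-].
pose h' := mul_nnsfun h (indic_nnsfun R (measurableC mN)).
apply: (@le_trans _ _ (sintegral mu h')); last first.
  apply: ereal_sup_ubound; exists h' => // x /=.
  rewrite mindicE; have [xN|xN] := boolP (x \in ~` N).
    rewrite mulr1; apply: (le_trans (hf x)); apply: contrapT => fg.
    by move: xN; rewrite inE /=; apply; apply: fgN.
  by rewrite mulr0.
rewrite -!integralT_nnsfun le_eqVlt; apply/orP; left; apply/eqP.
apply: ae_eq_integral => //; [exact/measurable_EFinP|exact/measurable_EFinP|].
exists N; split => // x /= /not_implyP[_]; apply: contra_notP => xN.
by rewrite mindicE mem_set//= mulr1.
Qed.

(* Unlike [ae_eq_integral] these two lemmas assume no measurability: the value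
   of [metric_speed] at exceptional points is arbitrary. *)
Lemma ae_eq_integral_any (D : set T) (f g : T -> \bar R) :
  {ae mu, forall x, D x -> f x = g x} ->
  \int[mu]_(x in D) f x = \int[mu]_(x in D) g x.
Proof.
move=> fg; rewrite /integral.
have E : {ae mu, forall x, (f \_ D) x = (g \_ D) x}.
  apply: (@filterS _ _ (ae_filter_ringOfSetsType mu)) fg => x fgx.
  by rewrite /patch; case: ifPn => // /set_mem /fgx.
congr (_ - _); apply/eqP; rewrite eq_le; apply/andP; split; apply: nnint_le => //;
  by apply: (@filterS _ _ (ae_filter_ringOfSetsType mu)) E => x E;
  rewrite ?funeposE ?funenegE E.
Qed.

Lemma ae_le_integral_any (D : set T) (f g : T -> \bar R) :
  (forall x, 0 <= f x) -> (forall x, 0 <= g x) ->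
  {ae mu, forall x, D x -> f x <= g x} ->
  \int[mu]_(x in D) f x <= \int[mu]_(x in D) g x.
Proof.
move=> f0 g0 fg; rewrite /integral.
have fD0 x : 0 <= (f \_ D) x by rewrite /patch; case: ifP.
have gD0 x : 0 <= (g \_ D) x by rewrite /patch; case: ifP.
apply: leeB; apply: nnint_le => //.
- apply: (@filterS _ _ (ae_filter_ringOfSetsType mu)) fg => x fgx.
  rewrite !funeposE !(max_idPl _)//.
  by rewrite /patch; case: ifPn => // /set_mem /fgx.
- apply: aeW => x; rewrite !funenegE.
  by rewrite !(max_idPr _) // leeNl oppe0.
Qed.

End integral_without_measurability.

Section gaps.
Context {R : realType}.
Implicit Types D : set R.
Local Notation leb := (@lebesgue_measure R).

Lemma leb_itv (x y : R) (b0 b1 : bool) : x <= y ->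
  leb [set` Interval (BSide b0 x) (BSide b1 y)] = (y - x)%:E.
Proof.
move=> xy; rewrite lebesgue_measure_itv/= lte_fin lt_neqAle xy andbT.
by case: eqVneq => [->|]/=; rewrite ?subrr// EFinB.
Qed.

Lemma compact_supP D : D !=set0 -> compact D -> D (sup D) /\ forall x, D x -> x <= sup D.
Proof.
move=> D0 cD; have [_ ub] := compact_has_sup D0 cD.
split; last by move=> x Dx; exact: ub_le_sup.
apply: (compact_closed (@Rhausdorff R) cD); exact: closure_sup.
Qed.

Lemma compact_infP D : D !=set0 -> compact D -> D (inf D) /\ forall x, D x -> inf D <= x.
Proof.
move=> D0 cD.
have cN : compact (-%R @` D).
  apply: continuous_compact => //; apply: continuous_subspaceT => x.
  exact: opp_continuous.
have [[x Dx] _] := (D0, cD).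
have N0 : -%R @` D !=set0 by exists (- x), x.
have [[y Dy yE] ub] := compact_supP N0 cN.
rewrite /inf -yE opprK; split => // z Dz.
by rewrite -lerN2 yE ub//; exists z.
Qed.

(** The expression of [frag_gaps] for a bare set, so that [frag_gaps c] is convertible to
    [gaps (frag_dom c)]. *)
Definition gaps D :=
  let hull : set R := `[inf D, sup D]%classic in
  let U := hull `\` D in
  [set p : R * R | exists2 t, U t & connected_component U t = `]p.1, p.2[%classic].

Lemma gapsP D p : D !=set0 -> compact D ->
  gaps D p <-> [/\ D p.1, D p.2, p.1 < p.2 & forall t, p.1 < t < p.2 -> ~ D t].
Proof.
move=> D0 cD; have [Di iD] := compact_infP D0 cD.
have [Ds sD] := compact_supP D0 cD.
split.
  move=> [t]; set U := `[inf D, sup D] `\` D => Ut Cp.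
  have Ct : connected_component U t t by exact: connected_component_refl.
  have CU : `]p.1, p.2[ `<=` U by rewrite -Cp; exact: connected_component_sub.
  move: Ct; rewrite Cp /= in_itv/= => /andP[pt tp].
  (* If an endpoint z belonged to U, the segment from t to z would be a connected part of U and z
     would lie in the component, which is open at z. *)
  have ends z : (z <= t \/ t <= z) -> U z -> (forall y, z < y < t -> p.1 < y < p.2) ->
      (forall y, t < y < z -> p.1 < y < p.2) -> p.1 < z < p.2.
    move=> zt Uz zy yz.
    have mem w : w \in `]p.1, p.2[ -> `]p.1, p.2[%classic w by [].
    suff : connected_component U t z by rewrite Cp /= in_itv.
    pose B : set R := [set y | (z <= y <= t) \/ (t <= y <= z)].
    have BU : B `<=` U.
      move=> y [/andP[]|/andP[]]; rewrite le_eqVlt => /predU1P[<-//|zy'];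
        rewrite le_eqVlt => /predU1P[->//|yt'].
        by apply: CU; rewrite /= in_itv/= zy// zy' yt'.
      by apply: CU; rewrite /= in_itv/= yz// zy' yt'.
    have Bt : B t by case: zt => zt; [left|right]; rewrite zt lexx.
    have Bz : B z by case: zt => zt; [left|right]; rewrite zt lexx.
    apply: (connected_component_max Bt BU _ Bz).
    apply/connected_intervalP => x y Bx By w /andP[xw wy].
    case: zt Bx By => zt [] /andP[x1 x2] [] /andP[y1 y2];
      first [left; apply/andP; split; lra | right; apply/andP; split; lra].
  have inhull z : p.1 <= z <= p.2 -> inf D <= z <= sup D.
    have [] := Ut; rewrite /= in_itv/= => /andP[it ts] _ /andP[pz zp].
    apply/andP; split; rewrite leNgt; apply/negP => zi.
      have [+ _] : U ((p.1 + inf D) / 2).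
        by apply: CU; rewrite /= in_itv/=; apply/andP; split; lra.
      by rewrite /= in_itv/= => /andP[+ _]; move: (inf D) zi => i; lra.
    have [+ _] : U ((p.2 + sup D) / 2).
      by apply: CU; rewrite /= in_itv/=; apply/andP; split; lra.
    by rewrite /= in_itv/= => /andP[_]; move: (sup D) zi => i; lra.
  split.
  - apply: contrapT => Dp.
    have := @ends p.1; rewrite ltxx/= => H; suff : false by []; apply: H.
    + by left; exact: ltW.
    + by split => //; apply: inhull; apply/andP; split; lra.
    + by move=> y /andP[? ?]; apply/andP; split; lra.
    + by move=> y /andP[? ?]; apply/andP; split; lra.
  - apply: contrapT => Dp.
    have := @ends p.2; rewrite ltxx andbF => H; suff : false by []; apply: H.
    + by right; exact: ltW.
    + by split => //; apply: inhull; apply/andP; split; lra.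
    + by move=> y /andP[? ?]; apply/andP; split; lra.
    + by move=> y /andP[? ?]; apply/andP; split; lra.
  - exact: lt_trans tp.
  - by move=> z zp Dz; have [_] : U z by apply: CU.
move=> [D1 D2 p12 pD].
have CU : `]p.1, p.2[ `<=` `[inf D, sup D] `\` D.
  move=> z /=; rewrite !in_itv/= => zp; split; last exact: pD.
  move: zp => /andP[pz zp].
  by rewrite (le_trans (iD _ D1) (ltW pz)) (le_trans (ltW zp) (sD _ D2)).
exists ((p.1 + p.2) / 2).
  by apply: CU; rewrite /= in_itv/=; apply/andP; split; lra.
apply/seteqP; split; last first.
  apply: connected_component_max => //; first by rewrite /= in_itv/=; apply/andP; split; lra.
  by apply/connected_intervalP; exact: interval_is_interval.
set C := connected_component _ _.
have iC : is_interval C by apply/connected_intervalP; exact: component_connected.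
have Cm : C ((p.1 + p.2) / 2).
  by apply: connected_component_refl; apply: CU; rewrite /= in_itv/=; apply/andP; split; lra.
have Csub : C `<=` ~` D by move=> z /connected_component_sub [].
move=> z Cz; rewrite /= in_itv/= !ltNge; apply/andP; split; apply/negP => zp.
- by apply: (Csub p.1) => //; apply: (iC z _ Cz Cm); apply/andP; split; lra.
- by apply: (Csub p.2) => //; apply: (iC _ z Cm Cz); apply/andP; split; lra.
Qed.

Lemma gaps_cover D t : D !=set0 -> compact D ->
  inf D <= t <= sup D -> ~ D t -> exists2 p, gaps D p & p.1 < t < p.2.
Proof.
move=> D0 cD /andP[it ts] Dt.
have [Di iD] := compact_infP D0 cD; have [Ds sD] := compact_supP D0 cD.
have closedD : closed D by apply: compact_closed cD; exact: Rhausdorff.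
pose A := D `&` [set x | x <= t]; pose B := D `&` [set x | t <= x].
have cA : compact A.
  apply: (subclosed_compact _ cD); last by move=> x [].
  by apply: closedI => //; exact: closed_le.
have cB : compact B.
  apply: (subclosed_compact _ cD); last by move=> x [].
  by apply: closedI => //; exact: closed_ge.
have A0 : A !=set0 by exists (inf D).
have B0 : B !=set0 by exists (sup D).
have [[DA At] Aub] := compact_supP A0 cA.
have [[DB Bt] Blb] := compact_infP B0 cB.
have sAt : sup A < t.
  by rewrite lt_neqAle At andbT; apply/eqP => E; apply: Dt; rewrite -E.
have tiB : t < inf B.
  by rewrite lt_neqAle Bt andbT; apply/eqP => E; apply: Dt; rewrite E.
exists (sup A, inf B); last by rewrite /= sAt tiB.
apply/gapsP => //; split => //=; first exact: lt_trans tiB.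
move=> z /andP[Az zB] Dz; have [zt|tz] := leP z t.
  by have := Aub z (conj Dz zt); rewrite leNgt Az.
by have := Blb z (conj Dz (ltW tz)); rewrite leNgt zB.
Qed.

Lemma gaps_inj D p q t : D !=set0 -> compact D -> gaps D p -> gaps D q ->
  p.1 < t < p.2 -> q.1 < t < q.2 -> p = q.
Proof.
move=> D0 cD /(gapsP _ D0 cD)[p1 p2 _ pD] /(gapsP _ D0 cD)[q1 q2 _ qD].
move=> /andP[tp1 tp2] /andP[tq1 tq2].
have ge1 : p.1 <= q.1.
  by rewrite leNgt; apply/negP => h; apply: (qD p.1) => //; rewrite h/=; lra.
have ge2 : q.1 <= p.1.
  by rewrite leNgt; apply/negP => h; apply: (pD q.1) => //; rewrite h/=; lra.
have ge3 : p.2 <= q.2.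
  by rewrite leNgt; apply/negP => h; apply: (pD q.2) => //; rewrite h/= andbT; lra.
have ge4 : q.2 <= p.2.
  by rewrite leNgt; apply/negP => h; apply: (qD p.2) => //; rewrite h/= andbT; lra.
rewrite [p]surjective_pairing [q]surjective_pairing; congr pair; lra.
Qed.

Lemma gaps_enum D : D !=set0 -> compact D -> exists e : nat -> R * R,
  [/\ forall n, gaps D (e n) \/ e n = (0, 0),
      trivIset [set: nat] (fun n => `](e n).1, (e n).2[%classic),
      \bigcup_n `](e n).1, (e n).2[%classic = `[inf D, sup D]%classic `\` D
    & forall w : R * R -> \bar R, (forall p, (0 <= w p)%E) -> w (0, 0) = 0%E ->
       (\esum_(p in gaps D) w p = \sum_(0 <= n <oo) w (e n))%E].
Proof.
move=> D0 cD.
pose f (p : R * R) := pickle (xget 0%Q [set q : rat | p.1 < ratr q < p.2]).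
have fP p : gaps D p -> exists2 q, p.1 < ratr q < p.2 & f p = pickle q.
  move=> /(gapsP _ D0 cD)[_ _ p12 _]; rewrite /f; case: xgetP => [q _ /= pq|nq].
    by exists q.
  by have [q] := rat_in_itvoo p12; rewrite in_itv/= => /nq.
have finj p q : gaps D p -> gaps D q -> f p = f q -> p = q.
  move=> gp gq; have [r rp ->] := fP p gp; have [s sq ->] := fP q gq.
  move=> /(pcan_inj pickleK) rs; apply: (gaps_inj D0 cD gp gq rp).
  by rewrite rs.
pose e n := xget (0, 0) [set p | gaps D p /\ f p = n].
have eP n : (gaps D (e n) /\ f (e n) = n) \/ e n = (0, 0) /\ forall p, gaps D p -> f p <> n.
  rewrite /e; case: xgetP => [p _ /= [gp fp]|np]; first by left.
  by right; split => // p gp fp; apply: (np p).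
have ef p : gaps D p -> e (f p) = p.
  move=> gp; have [[gE fE]|[_ /(_ p gp)//]] := eP (f p).
  exact: finj.
have n00 : ~ gaps D (0, 0) by move=> /(gapsP _ D0 cD)[_ _]; rewrite /= ltxx.
exists e; split.
- by move=> n; have [[]|[]] := eP n; [left|right].
- move=> i j _ _ [t []]; rewrite /= !in_itv/= => ti tj.
  have [[gi fi]|[ei _]] := eP i; last first.
    by move: ti; rewrite ei /= => /andP[/lt_trans h /h]; rewrite ltxx.
  have [[gj fj]|[ej _]] := eP j; last first.
    by move: tj; rewrite ej /= => /andP[/lt_trans h /h]; rewrite ltxx.
  by rewrite -fi -fj (gaps_inj D0 cD gi gj ti tj).
- apply/seteqP; split => [t [n _]|t []]; rewrite /= in_itv/=.
    move=> tn; have [[gn fn]|[en _]] := eP n; last first.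
      by move: tn; rewrite en /= => /andP[/lt_trans h /h]; rewrite ltxx.
    have [D1 D2 _ nD] := (gapsP _ D0 cD).1 gn; split; last exact: nD.
    have [_ iD] := compact_infP D0 cD; have [_ sD] := compact_supP D0 cD.
    move: tn => /andP[t1 t2]; rewrite in_itv/=.
    by rewrite (le_trans (iD _ D1) (ltW t1)) (le_trans (ltW t2) (sD _ D2)).
  move=> tt Dt; have [p gp pt] := gaps_cover D0 cD tt Dt.
  by exists (f p) => //=; rewrite ef // in_itv.
- move=> w w0 w00.
  rewrite (reindex_esum (f @` gaps D) (gaps D) e w); last first.
    split.
    + by move=> _ [p gp <-]; rewrite ef.
    + by move=> _ _ /set_mem[p gp <-] /set_mem[q gq <-]; rewrite !ef // => ->.
    + by move=> p gp; exists (f p); [exists p|rewrite ef].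
  rewrite esum_mkcond nneseries_esumT//; apply: eq_esum => n _.
  case: ifPn => // nf; have [[gn fn]|[-> _]] := eP n; last by rewrite w00.
  by exfalso; move/negP: nf; apply; apply/mem_set; exists (e n).
Qed.

Lemma esum_gaps_length D (K : R) : D !=set0 -> compact D -> 0 <= K ->
  (\esum_(p in gaps D) (K * (p.2 - p.1))%:E =
   K%:E * leb (`[inf D, sup D] `\` D))%E.
Proof.
move=> D0 cD K0; have [e [eg te Ue Ew]] := gaps_enum D0 cD.
(* The maximum with 0 changes nothing on gaps and provides the nonnegativity on all pairs that the
   enumeration asks for. *)
pose w (p : R * R) := (K * Num.max 0 (p.2 - p.1))%:E.
have E : (\esum_(p in gaps D) (K * (p.2 - p.1))%:E = \esum_(p in gaps D) w p)%E.
  apply: eq_esum => p /(gapsP _ D0 cD)[_ _ p12 _]; rewrite /w; congr (_ * _)%:E.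
  by rewrite (max_idPr _)//; lra.
rewrite E Ew; last 2 first.
- by move=> p; rewrite lee_fin mulr_ge0// le_max lexx.
- by rewrite /w/= subrr maxxx mulr0.
rewrite -Ue measure_bigcup//.
rewrite -nneseriesZl//.
rewrite [RHS](@eq_eseriesl _ _ xpredT) => [|i]; last by rewrite in_setT.
apply: eq_eseriesr => i _; rewrite /w.
have le12 : (e i).1 <= (e i).2.
  by have [/(gapsP _ D0 cD)[_ _ /ltW]//|->] := eg i.
rewrite EFinM (max_idPr _) ?subr_ge0//; congr (_ * _)%E.
exact/esym/leb_itv.
Qed.

End gaps.

Section lipschitz_on_compact.
Context {R : realType}.
Local Notation leb := (@lebesgue_measure R).
Implicit Types (D : set R) (F : R -> R).

(** McShane's extension: the infimum of the cones [F s + K * |x - s|]. *)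
Lemma lipschitz_extension D F (K : R) : D !=set0 -> 0 <= K ->
  (forall s t, D s -> D t -> `|F s - F t| <= K * `|s - t|) ->
  exists phi : R -> R, (forall s, D s -> phi s = F s) /\
    forall x y, `|phi x - phi y| <= K * `|x - y|.
Proof.
move=> [s0 Ds0] K0 FK.
pose A x := [set F s + K * `|x - s| | s in D].
have lbA x : lbound (A x) (F s0 - K * `|x - s0|).
  move=> _ [s Ds <-]; have := FK s0 s Ds0 Ds; rewrite ler_norml => /andP[_ h].
  have : K * `|s0 - s| <= K * (`|x - s0| + `|x - s|).
    by rewrite ler_wpM2l// [`|x - s0|]distrC; exact: ler_distD.
  by rewrite mulrDr; lra.
have A0 x : A x !=set0 by exists (F s0 + K * `|x - s0|), s0.
have hA x : has_inf (A x) by split => //; exists (F s0 - K * `|x - s0|).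
pose phi x := inf (A x).
have phile x s : D s -> phi x <= F s + K * `|x - s|.
  by move=> Ds; apply: ge_inf; [exact: (hA x).2|exists s].
have phi1 x y : phi x <= phi y + K * `|x - y|.
  rewrite -lerBlDr; apply: lb_le_inf => // _ [s Ds <-].
  rewrite lerBlDr (le_trans (phile x s Ds))// -addrA lerD2l -mulrDr ler_wpM2l//.
  by rewrite [leRHS]addrC; exact: ler_distD.
exists phi; split => [s Ds|x y].
  apply/eqP; rewrite eq_le; apply/andP; split.
    by have := phile s s Ds; rewrite subrr normr0 mulr0 addr0.
  apply: lb_le_inf => // _ [t Dt <-].
  by have := FK s t Ds Dt; rewrite ler_norml => /andP[_]; lra.
have h1 := phi1 x y; have h2 := phi1 y x; rewrite distrC in h2.
by rewrite ler_norml; apply/andP; split; lra.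
Qed.

Lemma lee_abs_eseries (u : nat -> \bar R) :
  (`|\sum_(0 <= n <oo) u n| <= \sum_(0 <= n <oo) `|u n|)%E.
Proof.
have [|sfin] := leP +oo%E (\sum_(0 <= n <oo) `|u n|)%E.
  by rewrite leye_eq => /eqP ->; rewrite leey.
rewrite summable_eseries; last by rewrite /summable -nneseries_esum.
apply: (le_trans (lee_abs_sub _ _)).
rewrite !gee0_abs; try exact: nneseries_ge0.
rewrite -nneseriesD// le_eqVlt; apply/orP; left; apply/eqP.
by apply: eq_eseriesr => i _; have /(congr1 (fun f => f i)) := fune_abse u.
Qed.

Lemma le_esum_subset (T : choiceType) (A B : set T) (w : T -> \bar R) :
  A `<=` B -> (\esum_(p in A) w p <= \esum_(p in B) w p)%E.
Proof.
move=> AB; apply: ge_ereal_sup => _ [F [finF FA] <-].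
by apply: ereal_sup_ubound; exists F => //; split => //; exact: subset_trans AB.
Qed.

Lemma lipschitz_on_density D F (K : R) : D !=set0 -> compact D -> 0 < K ->
  (forall s t, D s -> D t -> `|F s - F t| <= K * `|s - t|) ->
  exists h : R -> R, [/\ measurable_fun [set: R] h, forall x, `|h x| <= K,
    forall s t, D s -> D t -> s <= t ->
     (F t - F s)%:E = (\int[leb]_(z in `[s, t]) (h z)%:E)%E
    & {ae leb, forall t, D t -> has_slope D F t (h t)}].
Proof.
move=> D0 cD K0 FK.
have [phi [phiF phiK]] := lipschitz_extension D0 (ltW K0) FK.
have [Di iD] := compact_infP D0 cD; have [Ds sD] := compact_supP D0 cD.
(* The margin 1 puts D in the interior of the interval, where slopes are available, and covers a
   one-point D. *)
have ab : inf D - 1 < sup D + 1.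
  by apply: (@lt_le_trans _ _ (inf D)); [lra|apply: (le_trans (iD _ Ds)); lra].
have [h [mh hK hE hs]] := lipschitz_density ab K0 phiK.
exists h; split => //.
  move=> s t Ds' Dt st; rewrite -!phiF// hE//.
  - by apply: le_trans (iD _ Ds'); lra.
  - by apply: (le_trans (sD _ Dt)); lra.
apply: (@filterS _ _ (ae_filter_ringOfSetsType leb)) hs => t ht Dt e e0.
have tab : inf D - 1 < t < sup D + 1.
  apply/andP; split; first by apply: lt_le_trans (iD _ Dt); lra.
  by apply: (le_lt_trans (sD _ Dt)); lra.
have [d d0 dP] := ht tab e e0; exists d => // s Dsa std.
by rewrite -!phiF//; exact: dP.
Qed.

(** The interval between s and t splits into its part in D and the gaps of that part, which are gaps
    of D because s and t belong to D. Over a gap, h integrates to the increment of F. *)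
Lemma lipschitz_on_increment D F (K : R) (h : R -> R) : compact D -> 0 < K ->
  measurable_fun [set: R] h -> (forall x, `|h x| <= K) ->
  (forall s t, D s -> D t -> s <= t ->
     (F t - F s)%:E = (\int[leb]_(z in `[s, t]) (h z)%:E)%E) ->
  forall s t, D s -> D t ->
  (`|F t - F s|%:E <= \int[leb]_(z in D) `|h z|%:E +
     \esum_(p in gaps D) `|F p.2 - F p.1|%:E)%E.
Proof.
move=> cD K0 mh hK hE.
suff main s t : D s -> D t -> s <= t ->
  (`|F t - F s|%:E <= \int[leb]_(z in D) `|h z|%:E +
     \esum_(p in gaps D) `|F p.2 - F p.1|%:E)%E.
  move=> s t Ds Dt; have [st|/ltW ts] := leP s t; first exact: main.
  by rewrite distrC; exact: main.
move=> Ds Dt st.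
pose E := D `&` `[s, t]%classic.
have cE : compact E.
  apply: (subclosed_compact _ cD); last by move=> x [].
  apply: closedI; first by apply: compact_closed cD; exact: Rhausdorff.
  exact: interval_closed.
have E0 : E !=set0 by exists s; split => //; rewrite /= in_itv/= lexx.
have [[Di _] iE] := compact_infP E0 cE; have [[Dsu _] sE] := compact_supP E0 cE.
have Es : E s by split => //; rewrite /= in_itv/= lexx.
have Et : E t by split => //; rewrite /= in_itv/= lexx andbT.
have infE : inf E = s.
  apply/eqP; rewrite eq_le iE//=; apply: lb_le_inf => // z [_].
  by rewrite /= in_itv/= => /andP[].
have supE : sup E = t.
  apply/eqP; rewrite eq_le sE// andbT; apply: ge_sup => // z [_].
  by rewrite /= in_itv/= => /andP[].
have gapsE : gaps E `<=` gaps D.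
  have D0 : D !=set0 by exists s.
  move=> p /(gapsP _ E0 cE)[[D1 I1] [D2 I2] p12 pE]; apply/(gapsP _ D0 cD); split => //.
  move=> z zp Dz; apply: (pE z zp); split => //; move: zp I1 I2.
  rewrite /= !in_itv/= => /andP[? ?] /andP[? ?] /andP[? ?].
  by apply/andP; split; lra.
have [e [eg te Ue Ew]] := gaps_enum E0 cE.
have mE : measurable E by exact: compact_measurable.
have mD : measurable D by exact: compact_measurable.
have mst : measurable (`[s, t]%classic : set R) by exact: measurable_itv.
have mabs : measurable_fun [set: R] (fun z => `|h z|%:E).
  by apply/measurable_EFinP; exact: measurableT_comp.
have ih A : measurable A -> A `<=` `[s, t] -> leb.-integrable A (EFin \o h).
  move=> mA Ast; apply: (@integrableS _ _ _ leb `[s, t]%classic) => //.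
  by apply: bounded_integrable hK mst _ => //; rewrite leb_itv// ltry.
have step1 : (F t - F s)%:E = (\int[leb]_(z in E) (h z)%:E +
    \sum_(0 <= n <oo) (F (e n).2 - F (e n).1)%:E)%E.
  rewrite (hE _ _ Ds Dt st).
  have -> : `[s, t]%classic = E `|` (`[s, t] `\` E).
    by rewrite setDUK//; move=> z [].
  rewrite integral_setU//; last 3 first.
  - exact: measurableD.
  - exact/measurable_EFinP/measurable_funTS.
  - exact/disj_setPRL.
  congr (_ + _)%E; rewrite -{1}infE -{1}supE -Ue integral_bigcup//; last first.
    by rewrite Ue infE supE; apply: ih; [exact: measurableD|move=> z []].
  apply: eq_eseriesr => n _.
  have [/(gapsP _ E0 cE)[[D1 _] [D2 _] /ltW p12 _]|->] := eg n.
    by rewrite hE// integral_itv_bndoo//; exact/measurable_EFinP/measurable_funTS.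
  by rewrite /= subrr set_itvoo0// integral_set0.
rewrite -abse_EFin step1; apply: (le_trans (lee_abs_add _ _)); apply: leeD.
  apply: (le_trans (le_abse_integral _ _ _)) => //.
    exact/measurable_EFinP/measurable_funTS.
  by apply: ge0_subset_integral => //; [exact: measurable_funTS|move=> z []].
apply: (@le_trans _ _ (\esum_(p in gaps E) `|F p.2 - F p.1|%:E)%E); last first.
  exact: le_esum_subset.
rewrite Ew//; last by rewrite /= subrr normr0.
exact: lee_abs_eseries.
Qed.

End lipschitz_on_compact.

(** * Slopes along curve fragments *)

Section fragments.
Context {R : realType} {X : metricType R}.
Local Notation leb := (@lebesgue_measure R).
Implicit Types (c : fragment X) (f : X -> R) (m h : R -> R).

Local Notation aeS := (@filterS _ _ (ae_filter_ringOfSetsType leb)).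
Local Notation aeS2 := (@filterS2 _ _ (ae_filter_ringOfSetsType leb)).

(** A measurable and bounded representative of [metric_speed], which by itself is just a value of
    [lim] at each point. *)
Definition is_speed c m := [/\ measurable_fun [set: R] m, forall t, 0 <= m t,
  exists K, forall t, m t <= K
  & {ae leb, forall t, frag_dom c t -> forall e, 0 < e -> exists2 d, 0 < d &
      forall s, frag_dom c s -> `|s - t| < d ->
        `|mdist (c s) (c t) - m t * `|s - t| | <= e * `|s - t| }].

Lemma strong_lebesgue_pt_itv (w : R -> R) t : strong_lebesgue_pt w t ->
  measurable_fun [set: R] w ->
  forall e, 0 < e -> exists2 d, 0 < d & forall x y, x <= y ->
    (x = t \/ y = t) -> y - x < d ->
    (\int[leb]_(z in `[x, y]) `|w z - w t|%:E <= (e * (y - x))%:E)%E.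
Proof.
move=> wt mw e e0; have [d d0 dP] := wt (e / 2) ltac:(lra).
exists (d / 2); first by lra.
move=> x y; rewrite le_eqVlt => /predU1P[-> _ _|xy xyt yx].
  by rewrite set_itv1 integral_set1 subrr mulr0.
have r0 : 0 < 2 * (y - x) by lra.
have rd : 2 * (y - x) < d by lra.
have -> : e * (y - x) = e / 2 * (2 * (y - x)) by field.
apply: le_trans (dP _ r0 rd); apply: ge0_subset_integral => //.
- by apply: open_measurable; exact: ball_open.
- apply/measurable_EFinP/measurable_funTS; apply: measurableT_comp => //.
  exact: measurable_funB.
- move=> z /=; rewrite in_itv/= => /andP[xz zy]; rewrite /ball/= ltr_norml.
  by case: xyt => <-; apply/andP; split; lra.
Qed.

Lemma strong_lebesgue_pt_le (w : R -> R) t : strong_lebesgue_pt w t ->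
  measurable_fun [set: R] w -> (forall x, 0 <= w x) ->
  forall e, 0 < e -> exists2 d, 0 < d & forall x y, x <= y ->
    (x = t \/ y = t) -> y - x < d ->
    (\int[leb]_(z in `[x, y]) (w z)%:E <= ((w t + e) * (y - x))%:E)%E.
Proof.
move=> lt mw w0 e e0; have [d d0 dP] := strong_lebesgue_pt_itv lt mw e0.
exists d => // x y xy xyt yx.
have mxy : measurable (`[x, y]%classic : set R) by exact: measurable_itv.
apply: (@le_trans _ _ (\int[leb]_(z in `[x, y]) ((w t)%:E + `|w z - w t|%:E))%E).
  apply: ge0_le_integral => //.
  - by move=> z _; rewrite lee_fin.
  - exact/measurable_EFinP/measurable_funTS.
  - apply: emeasurable_funD => //; apply/measurable_EFinP/measurable_funTS.
    by apply: measurableT_comp => //; exact: measurable_funB.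
  - by move=> z _; rewrite -EFinD lee_fin -lerBlDl ler_norm.
rewrite ge0_integralD//; last 2 first.
- by move=> z _; rewrite lee_fin.
- apply/measurable_EFinP/measurable_funTS.
  by apply: measurableT_comp => //; exact: measurable_funB.
rewrite mulrDl EFinD; apply: leeD; last exact: dP.
have -> : (\int[leb]_(z in `[x, y]) (w t)%:E)%E = ((w t)%:E * leb `[x, y]%classic)%E.
  exact: (@integral_cst _ _ _ leb `[x, y]%classic _ (w t)%:E).
by rewrite leb_itv// -EFinM.
Qed.

(** At a Lebesgue point t of the indicator of D with t in D, an interval to the right of t free of D
    would contribute its full length to the mean deviation. *)
Lemma ae_right_accumulation (D : set R) : measurable D ->
  {ae leb, forall t, D t -> forall d, 0 < d -> exists2 s, D s & t < s < t + d}.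
Proof.
move=> mD; have m1 : measurable_fun [set: R] (\1_D : R -> R) by exact: measurable_indic.
have l1 : locally_integrable [set: R] (\1_D : R -> R).
  apply: (@bounded_locally_integrable _ _ 1) => // x.
  by rewrite indicE; case: (_ \in _); rewrite ?normr1 ?normr0.
apply: aeS (ae_strong_lebesgue_pt l1) => t lt Dt d d0; apply: contrapT => nex.
have [d' d'0 dP] := strong_lebesgue_pt_itv lt m1 (e := 2^-1) ltac:(lra).
pose r := Num.min d d' / 2.
have mind : 0 < Num.min d d' by rewrite lt_min d0.
have r0 : 0 < r by rewrite /r; lra.
have rd : r < d by apply: (@lt_le_trans _ _ (Num.min d d')); [rewrite /r; lra|rewrite ge_min lexx].
have rd' : r < d' by apply: (@lt_le_trans _ _ (Num.min d d')); [rewrite /r;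
  lra|rewrite ge_min lexx orbT].
have := dP t (t + r) ltac:(lra) (or_introl erefl) ltac:(lra).
rewrite leNgt => /negP; apply.
have tr : t + r - t = r by lra.
rewrite tr; apply: (@lt_le_trans _ _ r%:E); first by rewrite lte_fin; lra.
have := @leb_itv R t (t + r) false false ltac:(lra); rewrite tr => <-.
have mI : measurable (`]t, (t + r)]%classic : set R) by exact: measurable_itv.
apply: (@le_trans _ _ (\int[leb]_(z in `]t, (t + r)%R]) cst 1%E z)%E).
  by rewrite integral_cst// mul1e.
have E z : (`]t, (t + r)%R]%classic : set R) z -> `|\1_D z - \1_D t|%:E = 1%E :> \bar R.
  rewrite /= in_itv/= => /andP[tz zr]; rewrite !indicE (mem_set Dt).
  rewrite memNset ?sub0r ?normrN ?normr1// => Dz.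
  by apply: nex; exists z => //; rewrite tz/=; lra.
have -> : (\int[leb]_(z in `]t, (t + r)%R]) cst 1 z =
    \int[leb]_(z in `]t, (t + r)%R]) `|\1_D z - \1_D t|%:E)%E.
  by apply: eq_integral => z /set_mem /E.
apply: ge0_subset_integral => //.
  apply/measurable_EFinP/measurable_funTS; apply: measurableT_comp => //.
  exact: measurable_funB.
by move=> z /=; rewrite !in_itv/= => /andP[/ltW -> ->].
Qed.

Lemma frag_measurable_dom c : measurable (frag_dom c).
Proof. by apply: compact_measurable; exact: frag_compact. Qed.

Lemma metric_speed_ae c m : is_speed c m ->
  {ae leb, forall t, frag_dom c t -> metric_speed c t = m t}.
Proof.
move=> [_ _ _ H].
apply: aeS2 H (ae_right_accumulation (frag_measurable_dom c)) => t ht acc Dt.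
apply: cvg_lim => //.
  (* The limit is meaningful because t is an accumulation point: the punctured neighbourhoods of t
     within the domain then form a proper filter. *)
  apply: Build_ProperFilter_ex => A [d /= d0 dA].
  have [s Ds /andP[ts std]] := acc Dt d d0.
  exists s; apply: dA => //=; last by rewrite gt_eqF.
  by rewrite /ball/= ltr_norml; apply/andP; split; lra.
apply/cvgrPdist_le => e e0; have [d d0 dP] := ht Dt e e0.
exists d => //= s std st Ds; have := dP s Ds.
rewrite distrC => /(_ std).
have n0 : 0 < `|t - s| by rewrite normr_gt0 subr_eq0 eq_sym.
move=> H.
have -> : m t - mdist (c t) (c s) / `|t - s| =
    (m t * `|t - s| - mdist (c t) (c s)) / `|t - s|.
  by rewrite mulrBl mulfK// gt_eqF.
by rewrite normrM normfV [`| `|_| |]gtr0_norm// ler_pdivrMr// distrC metric_sym.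
Qed.

Lemma frag_integralE c m (rho : X -> \bar R) : is_speed c m ->
  frag_integral c rho = (\int[leb]_(t in frag_dom c) (rho (c t) * (m t)%:E))%E.
Proof.
move=> cm; apply: ae_eq_integral_any.
by apply: aeS (metric_speed_ae cm) => t mt Dt; rewrite mt.
Qed.

(** The speed is the supremum of the slopes of the distances to a dense sequence of points of the
    curve. Each such distance is 1-Lipschitz in the metric, which bounds the speed below; the upper
    bound holds at Lebesgue points of the supremum. *)
Lemma ex_speed c : exists m, is_speed c m.
Proof.
have [L L0 bil] := frag_bilip c.
have D0 := @frag_nonempty _ _ c; have cD := @frag_compact _ _ c.
set D := frag_dom c in D0 cD bil *.
have [t0 Dt0] := D0.
(* The index n codes a rational q and a precision k, and selects a point of D within 1/(k+1) of q,
   or t0 if there is none. *)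
pose tn (n : nat) := if @unpickle (rat * nat)%type n is Some qk then
  xget t0 [set t | D t /\ `|t - ratr qk.1| < qk.2.+1%:R^-1] else t0.
have Dtn n : D (tn n).
  by rewrite /tn; case: unpickle => // qk; case: xgetP => [t _ []|].
have dense_tn s (e : R) : D s -> 0 < e -> exists n, `|tn n - s| < e.
  move=> Ds e0; have e20 : 0 < e / 2 by lra.
  have [k _ kP] := @near_infty_natSinv_lt R (PosNum e20).
  have {}kP := kP k (leqnn k); rewrite /= in kP.
  have k0 : 0 < (k.+1%:R : R)^-1 by rewrite invr_gt0.
  have kk : s - k.+1%:R^-1 < s + k.+1%:R^-1 :> R.
    by move: (k.+1%:R^-1) k0 => r r0; lra.
  have [q] := @rat_in_itvoo R _ _ kk; rewrite in_itv/= => /andP[q1 q2].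
  exists (pickle (q, k)); rewrite /tn pickleK/=.
  have sq : `|s - ratr q| < k.+1%:R^-1.
    move: (k.+1%:R^-1) q1 q2 => r q1 q2.
    by rewrite ltr_norml; apply/andP; split; lra.
  case: xgetP => [t _ [Dt tq]|/(_ s)]; last by case.
  rewrite (le_lt_trans (ler_distD (ratr q) _ _))// [ltRHS](splitr e) ltrD//.
    exact: lt_trans kP.
  by rewrite distrC; exact: lt_trans kP.
pose F n t := mdist (c t) (c (tn n)).
have Fd n s t : `|F n s - F n t| <= mdist (c s) (c t).
  have h1 := metric_triangle (c t) (c s) (c (tn n)).
  have h2 := metric_triangle (c s) (c t) (c (tn n)).
  rewrite [mdist (c t) (c s)]metric_sym in h1.
  by rewrite /F ler_norml; apply/andP; split; lra.
have FL n s t : D s -> D t -> `|F n s - F n t| <= L * `|s - t|.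
  by move=> Ds Dt; apply: (le_trans (Fd n s t)); have /andP[] := bil s t Ds Dt.
have /choice[h hP] n := lipschitz_on_density D0 cD L0 (FL n).
pose m t := sups (fun n => `|h n t|) 0.
have hub t : has_ubound (range (fun n => `|h n t|)).
  by exists L => _ [n _ <-]; have [_ hL _ _] := hP n.
have hm n t : `|h n t| <= m t.
  by apply: ub_le_sup => //; [exact: has_ubound_sdrop|exists n].
have mlt t e : 0 < e -> exists n, m t - e < `|h n t|.
  move=> e0; have hs : has_sup (sdrop (fun n => `|h n t|) 0).
    by split; [exists `|h 0%N t|; exists 0%N|exact: has_ubound_sdrop].
  by have [_ [n _ <-] nlt] := sup_adherent e0 hs; exists n.
have mL t : m t <= L.
  rewrite /m /sups/=; apply: ge_sup; first by exists `|h 0%N t|; exists 0%N.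
  by move=> _ [n _ <-]; have [_ hL _ _] := hP n.
have m0 t : 0 <= m t by apply: le_trans (hm 0%N t).
have mm : measurable_fun [set: R] m.
  apply: measurable_fun_sups => // n; apply: measurableT_comp => //.
  by have [] := hP n.
exists m; split => //; first by exists L.
have hae : {ae leb, forall t n, D t -> has_slope D (F n) t (h n t)}.
  by apply/ae_foralln => n; have [] := hP n.
have lm : locally_integrable [set: R] m.
  by apply: (@bounded_locally_integrable _ _ L) => // t; rewrite ger0_norm.
apply: aeS2 (ae_strong_lebesgue_pt lm) hae => t lt ht Dt e e0.
have [d1 d10 d1P] := strong_lebesgue_pt_le lt mm m0 e0.
have [n nm] := mlt t (e / 2) ltac:(lra).
have [d2 d20 d2P] := ht n Dt (e / 2) ltac:(lra).
exists (Num.min d1 d2); first by rewrite lt_min d10.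
move=> s Ds; rewrite lt_min => /andP[s1 s2].
have lower : (m t - e) * `|s - t| <= mdist (c s) (c t).
  apply: le_trans (Fd n s t).
  have := d2P s Ds s2; set A := F n s - F n t => H.
  have : `|h n t * (s - t)| <= `|A| + e / 2 * `|s - t|.
    rewrite -[h n t * _](subKr A); apply: (le_trans (ler_normB _ _)).
    by rewrite lerD2l.
  rewrite normrM; have := normr_ge0 (s - t); nra.
(* If [tn k] is close to x, the increment of [F k] from x to y is almost the whole distance, and it
   is the integral of a density bounded by m. *)
have incr x y : D x -> D y -> x <= y ->
    ((mdist (c x) (c y))%:E <= \int[leb]_(z in `[x, y]) (m z)%:E)%E.
  move=> Dx Dy xy.
  have mxy : measurable (`[x, y]%classic : set R) by exact: measurable_itv.
  apply/lee_addgt0Pr => e' e'0.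
  have [k kx] := @dense_tn x (e' / (2 * L)) Dx ltac:(by rewrite divr_gt0// mulr_gt0).
  have : mdist (c x) (c (tn k)) <= e' / 2.
    have /andP[_] := bil x (tn k) Dx (Dtn k); rewrite distrC.
    move=> /le_trans; apply; rewrite (le_trans (ler_wpM2l (ltW L0) (ltW kx)))//.
    by rewrite le_eqVlt; apply/orP; left; apply/eqP; field; rewrite gt_eqF.
  move=> xk; have [mh hL hE _] := hP k.
  apply: (@le_trans _ _ (`|F k y - F k x|%:E + e'%:E)%E).
    have h1 := metric_triangle (c x) (c (tn k)) (c y).
    rewrite -EFinD lee_fin; have := ler_norm (F k y - F k x).
    rewrite /F; rewrite [mdist (c (tn k)) (c y)]metric_sym in h1; lra.
  apply: leeD => //; rewrite -abse_EFin hE//.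
  apply: (le_trans (le_abse_integral _ _ _)) => //.
    exact/measurable_EFinP/measurable_funTS.
  apply: ge0_le_integral => //.
  - by apply/measurable_EFinP/measurable_funTS; exact: measurableT_comp.
  - exact/measurable_EFinP/measurable_funTS.
  - by move=> z _; rewrite lee_fin.
have upper0 x y : D x -> D y -> (x = t \/ y = t) -> x <= y -> y - x < d1 ->
    mdist (c x) (c y) <= (m t + e) * (y - x).
  move=> Dx Dy xyt xy yx; rewrite -lee_fin.
  have mxy : measurable (`[x, y]%classic : set R) by exact: measurable_itv.
  apply: (le_trans (incr _ _ Dx Dy xy)).
  exact: d1P.
have upper : mdist (c s) (c t) <= (m t + e) * `|s - t|.
  have [st|ts] := leP s t.
    rewrite ler0_norm ?subr_le0// opprB; apply: upper0 => //; first by right.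
    by rewrite -[_ - _]opprB -ler0_norm ?subr_le0.
  rewrite metric_sym gtr0_norm ?subr_gt0//; apply: upper0 => //; first by left.
    exact: ltW.
  by rewrite -[_ - _]gtr0_norm ?subr_gt0.
by rewrite ler_norml; apply/andP; split; move: lower upper; lra.
Qed.

Lemma lipschitz_frag c f (L : R) : lipschitz_with L [set: X] f ->
  exists2 K, 0 < K & forall s t, frag_dom c s -> frag_dom c t ->
    `|f (c s) - f (c t)| <= K * `|s - t|.
Proof.
move=> [L0 fL]; have [K K0 bil] := frag_bilip c; exists (L * K + 1).
  by rewrite ltr_wpDl// mulr_ge0// ltW.
move=> s t Ds Dt; apply: (le_trans (fL _ _ I I)).
have /andP[_] := bil s t Ds Dt; have := normr_ge0 (s - t); nra.
Qed.

Lemma ex_slope c f (L : R) : lipschitz_with L [set: X] f -> exists h,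
  [/\ measurable_fun [set: R] h,
      {ae leb, forall t, frag_dom c t -> has_slope (frag_dom c) (f \o c) t (h t)}
    & (osc c f <= \int[leb]_(t in frag_dom c) `|h t|%:E + L%:E * gap c)%E].
Proof.
move=> fL; have [K K0 fK] := lipschitz_frag c fL.
have D0 := @frag_nonempty _ _ c; have cD := @frag_compact _ _ c.
have [h [mh hK hE hs]] := lipschitz_on_density D0 cD K0 fK.
exists h; split => //; apply: ge_ereal_sup => _ [_ [s Ds <-] [_ [t Dt <-] <-]].
apply: (le_trans (lipschitz_on_increment cD K0 mh hK hE Dt Ds)).
apply: leeD => //; have [L0 fL'] := fL.
rewrite /gap; change (frag_gaps c) with (gaps (frag_dom c)).
have [e [_ _ _ Ew]] := gaps_enum D0 cD.
rewrite Ew; [|by move=> p; rewrite lee_fin|by rewrite /= subrr normr0].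
rewrite Ew; [|by move=> p; rewrite lee_fin mdist_ge0|by rewrite /= mdistxx].
rewrite -nneseriesZl => [|n _]; last by rewrite lee_fin mdist_ge0.
apply: lee_nneseries => [n _ _|n _]; first by rewrite lee_fin normr_ge0.
by rewrite -EFinM lee_fin metric_sym; exact: fL'.
Qed.

Lemma ug_of_slope c f (L : R) m h (rho : X -> \bar R) : is_speed c m ->
  (forall x, 0 <= rho x)%E ->
  (osc c f <= \int[leb]_(t in frag_dom c) `|h t|%:E + L%:E * gap c)%E ->
  {ae leb, forall t, frag_dom c t -> (`|h t|%:E <= rho (c t) * (m t)%:E)%E} ->
  (osc c f <= frag_integral c rho + L%:E * gap c)%E.
Proof.
move=> cm rho0 /le_trans oscE hrho; apply: oscE; apply: leeD => //.
rewrite (frag_integralE _ cm); have [_ m0 _ _] := cm.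
by apply: ae_le_integral_any => // t; rewrite mule_ge0// lee_fin.
Qed.

Lemma gap_le_length c (K : R) : 0 <= K ->
  (forall s t, frag_dom c s -> frag_dom c t -> mdist (c s) (c t) <= K * `|s - t|) ->
  (gap c <= K%:E * leb (`[inf (frag_dom c), sup (frag_dom c)] `\` frag_dom c))%E.
Proof.
move=> K0 cK; have D0 := @frag_nonempty _ _ c; have cD := @frag_compact _ _ c.
rewrite -esum_gaps_length// /gap; change (frag_gaps c) with (gaps (frag_dom c)).
apply: le_esum => p /(gapsP _ D0 cD)[D1 D2 p12 _]; rewrite lee_fin.
by apply: (le_trans (cK _ _ D1 D2)); rewrite distrC gtr0_norm// subr_gt0.
Qed.

End fragments.

Lemma ae_and {d} {T : measurableType d} {R : realType} (mu : {measure set T -> \bar R})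
    (P Q : T -> Prop) : {ae mu, forall x, P x} -> {ae mu, forall x, Q x} ->
  {ae mu, forall x, P x /\ Q x}.
Proof. by apply: (@filterS2 _ _ (ae_filter_ringOfSetsType mu)). Qed.

(** By inner regularity, compact subsets missing measure less than 1/(n+1) exhaust E up to a null
    set. *)
Lemma ae_of_compacts {R : realType} (E : set R) (P : R -> Prop) : measurable E ->
  (@lebesgue_measure R E < +oo)%E ->
  (forall K, compact K -> K `<=` E -> K !=set0 ->
    {ae @lebesgue_measure R, forall t, K t -> P t}) ->
  {ae @lebesgue_measure R, forall t, E t -> P t}.
Proof.
move=> mE finE HK.
have /choice[K KP] (n : nat) := @lebesgue_regularity_inner R E (n.+1%:R^-1) mE finE ltac:(by
  rewrite invr_gt0).
have mK n : measurable (K n) by have [cK _ _] := KP n; exact: compact_measurable.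
have mEK n : measurable (E `\` K n) by exact: measurableD.
have ae1 : {ae @lebesgue_measure R, forall t n, K n t -> P t}.
  apply/ae_foralln => n; have [cK KE _] := KP n.
  have [K0|/set0P K0] := eqVneq (K n) set0.
    by apply: aeW => t; rewrite K0.
  exact: HK.
have mN : measurable (E `\` \bigcup_n K n).
  by apply: measurableD => //; exact: bigcupT_measurable.
have ae2 : {ae @lebesgue_measure R, forall t, ~ (E `\` \bigcup_n K n) t}.
  exists (E `\` \bigcup_n K n); split => //; last by move=> t /= /contrapT.
  apply/eqP; rewrite eq_le measure_ge0 andbT; apply/lee_addgt0Pr => e e0.
  rewrite add0e; have [k _ kP] := @near_infty_natSinv_lt R (PosNum e0).
  have [_ _ Kk] := KP k; apply: (@le_trans _ _ (k.+1%:R^-1)%:E); last first.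
    by rewrite lee_fin ltW// kP/=.
  apply: le_trans (ltW Kk); apply: le_measure; rewrite ?inE//.
    by have := mEK k.
  by move=> t [Et nK]; split => // Kt; apply: nK; exists k.
apply: (@filterS2 _ _ (ae_filter_ringOfSetsType _)) ae1 ae2 => t t1 t2 Et.
by apply: contrapT => nP; apply: t2; split => // -[n _ Kn]; apply: nP; exact: t1 Kn.
Qed.

(** * Upper gradients in terms of slopes along fragments *)

Section fragment_measurability.
Context {R : realType} {d : measure_display} {X : completeMetricMeasurableType R d}.
Hypothesis borelX : borel_sigma_algebra X.
Local Notation leb := (@lebesgue_measure R).
Implicit Types (c : fragment X) (f : X -> R) (m h : R -> R).
Local Notation aeS := (@filterS _ _ (ae_filter_ringOfSetsType leb)).
Local Notation aeS2 := (@filterS2 _ _ (ae_filter_ringOfSetsType leb)).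
Local Notation aeS3 := (@filterS3 _ _ (ae_filter_ringOfSetsType leb)).

Lemma open_measurable_borel (A : set X) : open A -> measurable A.
Proof. by move=> oA; rewrite borelX; exact: sub_sigma_algebra. Qed.

Lemma frag_measurable c : measurable_fun (frag_dom c) (c : R -> X).
Proof.
apply: (measurability (@open X) borelX) => _ [B oB <-].
have [L L0 bil] := frag_bilip c.
(* The upper Lipschitz bound of c makes the preimage of B the trace on the domain of an open set of
   parameters. *)
pose V := \bigcup_(t in frag_dom c `&` c @^-1` B)
  \bigcup_(e in [set e | 0 < e /\ ball (c t) (L * e) `<=` B]) ball t e.
have -> : frag_dom c `&` c @^-1` B = frag_dom c `&` V.
  apply/seteqP; split => t [Dt tB]; split => //.
    have [e /= e0 eB] : exists2 e, 0 < e & ball (c t) e `<=` B.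
      by have /nbhs_ballP[e e0 eB] := open_nbhs_nbhs (conj oB tB); exists e.
    exists t => //; exists (e / L); last by apply: ballxx; rewrite divr_gt0.
    by rewrite /= divr_gt0// mulrC mulfVK// gt_eqF.
  case: tB => s [Ds _] [e [e0 eB] st]; apply: eB.
  rewrite ballEmdist/=; have /andP[_ /le_lt_trans] := bil s t Ds Dt; apply.
  by rewrite ltr_pM2l.
apply: measurableI; first exact: frag_measurable_dom.
apply: open_measurable; apply: bigcup_open => t _; apply: bigcup_open => e _.
exact: ball_open.
Qed.

Lemma frag_comp_measurable c (rho : X -> \bar R) : measurable_fun [set: X] rho ->
  measurable_fun (frag_dom c) (rho \o c).
Proof.
by move=> mrho; apply: (measurable_comp (F := setT)) => //; exact: frag_measurable.
Qed.

(** Localization at a density point t of K: the upper gradient inequality is applied to c restricted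
    to K between t and a nearby s in K. The gap is o(s - t) by density, and the integral is close to
    [g (c t) * m t * (s - t)] at a Lebesgue point. The bound M makes the integrand locally
    integrable. *)
Lemma slope_of_ug_compact c f (L : R) g m h (M : R) (K : set R) :
  lipschitz_with L [set: X] f -> star_upper_gradient f g -> is_speed c m ->
  {ae leb, forall t, frag_dom c t -> has_slope (frag_dom c) (f \o c) t (h t)} ->
  compact K -> K !=set0 -> K `<=` frag_dom c ->
  (forall t, K t -> (g (c t) <= M%:E)%E) ->
  {ae leb, forall t, K t -> (`|h t|%:E <= g (c t) * (m t)%:E)%E}.
Proof.
move=> fL [[mg g0] ug] cm hs cK K0 KD gM.
have [mm m0 [Km mK] mspeed] := cm.
have mKs : measurable K by exact: compact_measurable.
have [A A0 bil] := frag_bilip c; have [L0 fL'] := fL.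
have gE t : K t -> g (c t) = (fine (g (c t)))%:E.
  move=> Kt; rewrite fineK// ge0_fin_numE//.
  by apply: (le_lt_trans (gM t Kt)); rewrite ltry.
have mgK : measurable_fun K (g \o c).
  have := frag_comp_measurable (c := c) mg; apply: measurable_funS => //.
  exact: frag_measurable_dom.
pose u := (fun t => fine (g (c t)) * m t) \_ K.
have mu_ : measurable_fun [set: R] u.
  apply/(measurable_restrictT _ mKs); apply: measurable_funM; last exact: measurable_funTS.
  apply: (measurableT_comp (fine_measurable _)) => //.
have u0 t : 0 <= u t by rewrite /u /patch; case: ifP => // _; rewrite mulr_ge0// fine_ge0.
have [t1 Kt1] := K0.
have M0 : 0 <= M by rewrite -lee_fin (le_trans (g0 (c t1)))// gM.
have uM t : `|u t| <= M * Km.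
  rewrite ger0_norm// /u /patch; case: ifPn => [/set_mem Kt|_].
    by rewrite ler_pM ?fine_ge0// -lee_fin -gE// gM.
  by rewrite mulr_ge0//; exact: le_trans (m0 0) (mK 0).
(* A Lebesgue point of w that lies in K is a density point of K, since w vanishes there. *)
pose w : R -> R := \1_(~` K).
have mKC : measurable (~` K) by exact: measurableC.
have mw : measurable_fun [set: R] w by exact: measurable_indic.
have w0 t : 0 <= w t by rewrite /w indicE.
have lu := ae_strong_lebesgue_pt (bounded_locally_integrable mu_ uM).
have lw : {ae leb, forall t, strong_lebesgue_pt w t}.
  apply: ae_strong_lebesgue_pt; apply: (@bounded_locally_integrable _ _ 1) => // t.
  by rewrite /w indicE; case: (_ \in _); rewrite ?normr1 ?normr0.
have acc := ae_right_accumulation mKs.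
apply: aeS (ae_and (ae_and lu lw) (ae_and acc hs)) => t [[ut wt] [acct ht]] Kt.
have Dt := KD _ Kt.
rewrite gE// -EFinM lee_fin.
have -> : fine (g (c t)) * m t = u t by rewrite /u /patch mem_set.
apply/ler_addgt0Pr => e0 e00.
(* The errors are e for the integral, e for the slope of f o c, and [L * A * e] for the gap. *)
pose C := 2 + L * A.
have C0 : 0 < C by rewrite /C ltr_wpDr// mulr_ge0// ltW.
pose e := e0 / C; have e_gt0 : 0 < e by rewrite divr_gt0.
have [d1 d10 d1P] := strong_lebesgue_pt_le ut mu_ u0 e_gt0.
have [d2 d20 d2P] := strong_lebesgue_pt_le wt mw w0 e_gt0.
have [d3 d30 d3P] := ht Dt e e_gt0.
have dmin : 0 < Num.min d1 (Num.min d2 d3) by rewrite !lt_min d10 d20.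
have [s Ks /andP[ts std]] := acct Kt _ dmin.
have {std} : s - t < Num.min d1 (Num.min d2 d3) by rewrite ltrBlDl.
rewrite !lt_min => /and3P[s1 s2 s3].
pose B := K `&` `[t, s]%classic.
have Bt : B t by split => //; rewrite /= in_itv/= lexx ltW.
have Bs : B s by split => //; rewrite /= in_itv/= lexx ltW.
have B0 : B !=set0 by exists t.
have cB : compact B.
  apply: (subclosed_compact _ cK); last by move=> x [].
  apply: closedI; last exact: interval_closed.
  by apply: compact_closed cK; exact: Rhausdorff.
have BD : B `<=` frag_dom c by move=> z [/KD].
have mB : measurable B by exact: compact_measurable.
have bilB : exists2 L : R, 0 < L & forall s t, B s -> B t ->
    L^-1 * `|s - t| <= mdist (c s) (c t) <= L * `|s - t|.
  by exists A => // x y /BD Dx /BD Dy; exact: bil.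
pose c' := Fragment B0 cB bilB.
have c'm : is_speed c' m.
  split => //; first by exists Km.
  apply: aeS mspeed => z zP Bz e' e'0; have [d' d'0 d'P] := zP (BD _ Bz) e' e'0.
  by exists d' => // y /BD; exact: d'P.
have infB : inf B = t.
  have [_ iB] := compact_infP B0 cB.
  apply/eqP; rewrite eq_le iB//=; apply: lb_le_inf => // z [_].
  by rewrite /= in_itv/= => /andP[].
have supB : sup B = s.
  have [_ sB] := compact_supP B0 cB.
  apply/eqP; rewrite eq_le sB// andbT; apply: ge_sup => // z [_].
  by rewrite /= in_itv/= => /andP[].
have mts : measurable (`[t, s]%classic : set R) by exact: measurable_itv.
have gapB : (gap c' <= (A * (e * (s - t)))%:E)%E.
  apply: (le_trans (@gap_le_length _ _ c' A (ltW A0) _)) => /=.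
    by move=> x y /BD Dx /BD Dy; have /andP[] := bil x y Dx Dy.
  rewrite EFinM infB supB; apply: lee_wpmul2l; first by rewrite lee_fin ltW.
  have wt0 : w t = 0 by rewrite /w indicE memNset.
  have := d2P t s (ltW ts) (or_introl erefl) s2.
  rewrite wt0 add0r; apply: le_trans.
  rewrite /w integral_indic// le_measure ?inE//.
  - by apply: measurableD => //; exact: compact_measurable.
  - exact: measurableI.
  - by move=> z [zts nB]; split => // Kz; apply: nB.
have intB : (frag_integral c' g <= ((u t + e) * (s - t))%:E)%E.
  rewrite (frag_integralE _ c'm)/=.
  apply: le_trans (d1P t s (ltW ts) (or_introl erefl) s1).
  apply: (@le_trans _ _ (\int[leb]_(z in B) (u z)%:E)%E).
    rewrite le_eqVlt; apply/orP; left; apply/eqP; apply: eq_integral => z /set_mem[Kz _].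
    by rewrite gE// -EFinM /u /patch mem_set.
  apply: ge0_subset_integral => //.
  - exact/measurable_EFinP/measurable_funTS.
  - by move=> z _; rewrite lee_fin.
  - by move=> z [].
have osc1 : (`|f (c s) - f (c t)|%:E <= osc c' f)%E.
  by apply: ereal_sup_ubound; exists (c s); [exists s|exists (c t) => //; exists t].
have LIPf : (LIP [set: X] f <= L%:E)%E by apply: ereal_inf_lbound; exists L.
have gap0 : (0 <= gap c')%E by apply: esum_ge0 => p _; rewrite lee_fin mdist_ge0.
have main : `|f (c s) - f (c t)| <= (u t + e + L * (A * e)) * (s - t).
  rewrite -lee_fin; apply: (le_trans osc1); apply: (le_trans (ug c')).
  rewrite [X in (_ <= X%:E)%E](_ : _ = (u t + e) * (s - t) + L * (A * (e * (s - t)))); last by ring.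
  rewrite EFinD; apply: leeD => //; rewrite EFinM.
  apply: (@le_trans _ _ (L%:E * gap c')%E); first exact: lee_wpmul2r.
  by apply: lee_wpmul2l => //; rewrite lee_fin.
have := d3P s (KD _ Ks); rewrite /= (gtr0_norm (_ : 0 < s - t)) ?subr_gt0// => /(_ s3).
set D := f (c s) - f (c t) in main *; move=> H.
have : `|h t| * (s - t) <= `|D| + e * (s - t).
  rewrite -[X in _ * X](gtr0_norm (_ : 0 < s - t)) ?subr_gt0// -normrM.
  rewrite -[h t * _](subKr D); apply: (le_trans (ler_normB _ _)).
  by rewrite lerD2l.
move=> /le_trans /(_ (lerD main (lexx _))).
rewrite -mulrDl ler_pM2r ?subr_gt0// => /le_trans; apply.
have : e0 = e * C by rewrite /e mulfVK// gt_eqF.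
by rewrite /C => ->; lra.
Qed.

Lemma speed_gt0 c m : is_speed c m -> {ae leb, forall t, frag_dom c t -> 0 < m t}.
Proof.
move=> [_ _ _ mspeed]; have [A A0 bil] := frag_bilip c.
apply: aeS (ae_and mspeed (ae_right_accumulation (frag_measurable_dom c))).
move=> t [mt acc] Dt; have A20 : 0 < A^-1 / 2 by rewrite divr_gt0// invr_gt0.
have [r r0 rP] := mt Dt _ A20; have [s Ds /andP[ts std]] := acc Dt r r0.
have st0 : 0 < s - t by rewrite subr_gt0.
have sr : s - t < r by rewrite ltrBlDl.
have := rP s Ds; rewrite (gtr0_norm st0) => /(_ sr).
have /andP[+ _] := bil s t Ds Dt; rewrite (gtr0_norm st0) => h1.
rewrite ler_norml => /andP[h2 h3].
have : A^-1 / 2 * (s - t) <= m t * (s - t) by lra.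
by rewrite ler_pM2r//; exact: lt_le_trans.
Qed.

(** Sublevel sets of [g o c] reduce this to compact sets where g is bounded. Where g is infinite the
    right-hand side is +oo, because the speed is positive almost everywhere. *)
Lemma slope_of_ug c f (L : R) g m h :
  lipschitz_with L [set: X] f -> star_upper_gradient f g -> is_speed c m ->
  {ae leb, forall t, frag_dom c t -> has_slope (frag_dom c) (f \o c) t (h t)} ->
  {ae leb, forall t, frag_dom c t -> (`|h t|%:E <= g (c t) * (m t)%:E)%E}.
Proof.
move=> fL fg cm hs; have [[mg g0] _] := fg.
pose E n := frag_dom c `&` (g \o c) @^-1` [set y | (y <= n%:R%:E)%E].
have mD := frag_measurable_dom c.
have mE n : measurable (E n).
  rewrite /E; have -> : [set y : \bar R | (y <= n%:R%:E)%E] = `]-oo, n%:R%:E]%classic.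
    by apply/seteqP; split => y; rewrite /= in_itv.
  by apply: (frag_comp_measurable (c := c) mg) => //; exact: emeasurable_itv.
have Dfin : (leb (frag_dom c) < +oo)%E.
  by apply: compact_finite_measure; exact: frag_compact.
have aeE : {ae leb, forall t n, E n t -> (`|h t|%:E <= g (c t) * (m t)%:E)%E}.
  apply/ae_foralln => n; apply: ae_of_compacts => //.
    apply: le_lt_trans Dfin; apply: le_measure; rewrite ?inE//.
    - by have := mE n.
    - by move=> t [].
  move=> K cK KE K0.
  by apply: (slope_of_ug_compact (M := n%:R) fL fg cm hs cK K0) => t /KE [].
apply: aeS (ae_and aeE (speed_gt0 cm)) => t [tE tm] Dt.
have [gfin|] := ltP (g (c t)) +oo%E; last first.
  by rewrite leye_eq => /eqP ->; rewrite gt0_mulye ?leey// lte_fin tm.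
have gE : g (c t) = (fine (g (c t)))%:E by rewrite fineK// ge0_fin_numE.
apply: (tE (Num.trunc (fine (g (c t)))).+1); split => //=.
by rewrite gE lee_fin ltW// truncnS_gt.
Qed.

Lemma LIP_attained f : lipschitz_fun f ->
  exists2 L, lipschitz_with L [set: X] f & LIP [set: X] f = L%:E.
Proof.
move=> [L1 [L10 fL1]].
pose A := [set L | lipschitz_with L [set: X] f].
have A1 : A L1 by [].
have lb : has_lbound A by exists 0 => L [].
have iA : has_inf A by split => //; exists L1.
have fA : lipschitz_with (inf A) [set: X] f.
  split; first by apply: lb_le_inf; [exists L1|move=> L []].
  move=> x y _ _; have [->|xy] := eqVneq x y; first by rewrite subrr normr0 mdistxx mulr0.
  have xy0 : 0 < mdist x y by rewrite mdist_gt0.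
  rewrite -ler_pdivrMr//; apply: lb_le_inf; first by exists L1.
  by move=> L [_ fL]; rewrite ler_pdivrMr//; exact: fL.
exists (inf A) => //; apply/eqP; rewrite eq_le; apply/andP; split.
  by apply: ereal_inf_lbound; exists (inf A).
by apply: le_ereal_inf_tmp => _ [L AL <-]; rewrite lee_fin; exact: ge_inf.
Qed.

(** Converse of [slope_of_ug]. The gap term gets the optimal constant of f itself, however the slope
    bound was obtained. *)
Lemma star_ug_of_slopes f (rho : X -> \bar R) : lipschitz_fun f -> borel_nonneg rho ->
  (forall c m h, is_speed c m ->
    {ae leb, forall t, frag_dom c t -> has_slope (frag_dom c) (f \o c) t (h t)} ->
    {ae leb, forall t, frag_dom c t -> (`|h t|%:E <= rho (c t) * (m t)%:E)%E}) ->
  star_upper_gradient f rho.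
Proof.
move=> lf rhoP H; split => // c; have [L fL LE] := LIP_attained lf.
have [m cm] := ex_speed c; have [h [_ hs oscE]] := ex_slope c fL.
rewrite /upper_gradient_along LE; apply: (ug_of_slope (h := h) (m := m)) => //; first exact: rhoP.2.
exact: H hs.
Qed.

(** The slope bounds hold for all n outside one null set of parameters, and the positive speed can
    be divided out before taking the infimum. *)
Lemma ug_einfs f (g : nat -> X -> \bar R) : lipschitz_fun f ->
  (forall n, star_upper_gradient f (g n)) ->
  star_upper_gradient f (fun x => einfs (g^~ x) 0).
Proof.
move=> lf fg; apply: star_ug_of_slopes => //.
  split; first by apply: measurable_fun_einfs => n; have [[]] := fg n.
  by move=> x; apply: le_ereal_inf_tmp => _ [n _ <-]; have [[]] := fg n.
move=> c m h cm hs; have [L fL _] := LIP_attained lf.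
have aeh : {ae leb, forall t n, frag_dom c t -> (`|h t|%:E <= g n (c t) * (m t)%:E)%E}.
  by apply/ae_foralln => n; exact: slope_of_ug fL (fg n) cm hs.
apply: aeS (ae_and aeh (speed_gt0 cm)) => t [th tm] Dt.
rewrite muleC -lee_pdivrMl ?tm//; apply: le_ereal_inf_tmp => _ [n _ <-].
by rewrite lee_pdivrMl ?tm// muleC; exact: th.
Qed.

End fragment_measurability.

(** * Pointwise Lipschitz constants and minimal upper gradients *)

Section pointwise_lipschitz.
Context {R : realType} {X : metricType R}.
Implicit Types (f : X -> R) (x : X).
Local Open Scope ereal_scope.

Lemma metric_ball_open x r : open (ball x r).
Proof.
rewrite openE => y; rewrite ballEmdist/= => xy; apply/nbhs_ballP.
exists (r - mdist x y)%R; first by rewrite /= subr_gt0.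
move=> z; rewrite !ballEmdist/= => yz.
by rewrite (le_lt_trans (metric_triangle x y z))// -ltrBrDl.
Qed.

Lemma cvg_right_inf (F : R -> \bar R) :
  (forall r s, (0 < r)%R -> (r <= s)%R -> F r <= F s) ->
  F r @[r --> 0^'+] --> ereal_inf [set F r | r in [set r | (0 < r)%R]].
Proof.
move=> ndF; have := @nondecreasing_at_right_cvge R F 0%R +oo%O.
rewrite set_itvoy; apply => // r s; rewrite !in_itv/= !andbT => r0 _ rs.
exact: ndF.
Qed.

Definition slope_sup f r x :=
  ereal_sup [set (`|f x - f y| / mdist x y)%:E | y in ball x r `\ x].

Lemma slope_sup_le f r s x : (r <= s)%R -> slope_sup f r x <= slope_sup f s x.
Proof.
move=> rs; apply: ereal_sup_le => _ [y [xy yx] <-] /=.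
exists y => //; split => //.
exact: le_ball xy.
Qed.

Lemma slope_sup_leP f r (e : R) x : slope_sup f r x <= e%:E <->
  forall y, ball x r y -> (`|f x - f y| <= e * mdist x y)%R.
Proof.
split=> [le_e y xy|H].
  have [->|yx] := eqVneq y x; first by rewrite subrr normr0 mdistxx mulr0.
  have xy0 : (0 < mdist x y)%R by rewrite mdist_gt0 eq_sym.
  rewrite -ler_pdivrMr// -lee_fin; apply: le_trans le_e.
  by apply: ereal_sup_ubound; exists y => //; split => //; exact/eqP.
apply: ge_ereal_sup => _ [y [xy yx] <-]; rewrite lee_fin ler_pdivrMr.
  exact: H.
by rewrite mdist_gt0; apply/eqP => E; exact: yx.
Qed.

(** The maximum with 0 accounts for the convention at isolated points, where the supremum over a
    small punctured ball is that of the empty set, -oo. *)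
Lemma LipE f x : Lip f x = ereal_inf [set maxe 0 (slope_sup f r x) | r in [set r | (0 < r)%R]].
Proof.
rewrite /Lip; case: asboolP => [[_ [V /nbhs_ballP[e /= e0 eV] VE]]|nis].
  apply/eqP; rewrite eq_le; apply/andP; split.
    by apply: le_ereal_inf_tmp => _ [r _ <-]; rewrite le_max lexx.
  apply: ereal_inf_lbound; exists e => //; rewrite /slope_sup (_ : _ @` _ = set0).
    by rewrite ereal_sup0; apply/max_idPl; rewrite leNye.
  apply/seteqP; split => // z [y [xy yx] _]; apply: yx => /=.
  have : (V `&` setT) y by split => //; exact: eV.
  by rewrite VE.
have sup0 r : (0 < r)%R -> 0 <= slope_sup f r x.
  move=> r0; rewrite leNgt; apply/negP => lt0; apply: nis; split; first exact/mem_set.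
  exists (ball x r); first exact: nbhsx_ballx.
  apply/seteqP; split => [y [xy _]/=|_ ->]; last by split => //; exact: ballxx.
  apply: contrapT => yx; move: lt0; rewrite ltNge => /negP; apply.
  apply: (@le_trans _ _ (`|f x - f y| / mdist x y)%:E).
    by rewrite lee_fin divr_ge0// mdist_ge0.
  by apply: ereal_sup_ubound; exists y.
rewrite (cvg_lim _ (cvg_right_inf _)); last 2 first.
- exact: ereal_hausdorff.
- by move=> r s _ rs; exact: slope_sup_le.
congr ereal_inf; apply/seteqP; split => _ [r r0 <-]; exists r => //.
  by rewrite max_r ?sup0.
by rewrite max_r ?sup0.
Qed.

Lemma Lip_ge0 f x : 0 <= Lip f x.
Proof. by rewrite LipE; apply: le_ereal_inf_tmp => _ [r _ <-]; rewrite le_max lexx. Qed.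

Lemma Lip_lt f x (e : R) : Lip f x < e%:E -> exists2 r, (0 < r)%R &
  forall y, ball x r y -> (`|f x - f y| <= e * mdist x y)%R.
Proof.
rewrite LipE => /ereal_inf_lt[_ [r r0 <-]]; rewrite gt_max => /andP[_ /ltW se].
by exists r => //; exact/slope_sup_leP.
Qed.

Lemma Lip_le f x (e r : R) : (0 <= e)%R -> (0 < r)%R ->
  (forall y, ball x r y -> (`|f x - f y| <= e * mdist x y)%R) -> Lip f x <= e%:E.
Proof.
move=> e0 r0 /slope_sup_leP H; rewrite LipE.
apply: (@le_trans _ _ (maxe 0 (slope_sup f r x))).
  by apply: ereal_inf_lbound; exists r.
by rewrite ge_max H lee_fin e0.
Qed.

Lemma LIP_subset f (A B : set X) : A `<=` B -> LIP A f <= LIP B f.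
Proof.
move=> AB; apply: ereal_inf_le_tmp => _ [L [L0 fL] <-].
by exists L => //; split => // x y /AB Bx /AB By; exact: fL.
Qed.

Lemma Lip_aE f x :
  Lip_a f x = ereal_inf [set LIP (ball x r) f | r in [set r | (0 < r)%R]].
Proof.
rewrite /Lip_a (cvg_lim _ (cvg_right_inf _))//.
by move=> r s _ rs; apply: LIP_subset; exact: le_ball.
Qed.

Lemma Lip_le_Lip_a f x : Lip f x <= Lip_a f x.
Proof.
rewrite Lip_aE; apply: le_ereal_inf_tmp => _ [r r0 <-].
apply: le_ereal_inf_tmp => _ [L [L0 fL] <-].
by apply: (Lip_le L0 r0) => y xy; apply: fL => //; exact: ballxx.
Qed.

Lemma Lip_a_le f x (e r : R) : (0 <= e)%R -> (0 < r)%R ->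
  (forall y z, ball x r y -> ball x r z -> (`|f y - f z| <= e * mdist y z)%R) ->
  Lip_a f x <= e%:E.
Proof.
move=> e0 r0 H; rewrite Lip_aE; apply: (@le_trans _ _ (LIP (ball x r) f)).
  by apply: ereal_inf_lbound; exists r.
by apply: ereal_inf_lbound; exists e.
Qed.

Lemma Lip_a_closed_support f x : ~ closure [set y | f y != 0%R] x -> Lip_a f x = 0.
Proof.
move=> nx; apply/eqP; rewrite eq_le (le_trans (Lip_ge0 f x) (Lip_le_Lip_a f x)) andbT.
have /nbhs_ballP[r /= r0 rP] : nbhs x (~` closure [set y | f y != 0%R]).
  by apply: open_nbhs_nbhs; split => //; apply: closed_openC; exact: closed_closure.
have f0 y : ball x r y -> f y = 0%R.
  by move=> /rP ny; apply/eqP; apply: contrapT => /negP fy; apply: ny; exact: subset_closure.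
by apply: (Lip_a_le (lexx 0%R) r0) => y z /f0 -> /f0 ->; rewrite subrr normr0 mul0r.
Qed.

(** Lower semicontinuity: a y whose quotient at x exceeds a remains in the open ball around every
    nearby z, with a quotient still above a. *)
Lemma slope_sup_open f r (a : \bar R) : continuous f -> open [set x | a < slope_sup f r x].
Proof.
move=> cf; rewrite openE => x /= ax.
have [_ [y [xy yx] <-] ay] := ereal_sup_gt ax.
have xy0 : (0 < mdist x y)%R by rewrite mdist_gt0; apply/eqP => E; exact: yx.
have cd : {for x, continuous (fun z => mdist z y)}.
  apply/cvgrPdist_lt => e e0; near=> z.
  have zx : (mdist x z < e)%R.
    by near: z; apply/nbhs_ballP; exists e => // z; rewrite ballEmdist.
  have h1 := metric_triangle x z y; have h2 := metric_triangle z x y.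
  rewrite [mdist z x]metric_sym in h2.
  by rewrite ltr_norml; apply/andP; split; lra.
have cq : {for x, continuous (fun z => `|f z - f y| / mdist z y)%R}.
  apply: cvgM; first by apply: cvg_norm; apply: cvgB; [exact: cf|exact: cvg_cst].
  by apply: cvgV => //; rewrite gt_eqF.
have {}ay : \forall z \near x, a < (`|f z - f y| / mdist z y)%:E.
  case: a ay {ax} => [a| |]; [rewrite lte_fin => ay|by []|by move=> _; near=> z; rewrite ltNyr].
  near=> z; rewrite lte_fin; near: z.
  exact: (cvgr_gt _ cq).
move: xy; rewrite ballEmdist /= => xy.
near=> z; apply: (@lt_le_trans _ _ (`|f z - f y| / mdist z y)%:E).
  by near: z.
apply: ereal_sup_ubound; exists y => //; split.
  by rewrite ballEmdist /=; near: z; apply: (cvgr_lt _ cd).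
move=> /= yz; have : (0 < mdist z y)%R by near: z; apply: (cvgr_gt _ cd).
by rewrite yz mdistxx ltxx.
Unshelve. all: by end_near.
Qed.

End pointwise_lipschitz.

Section minimal_ug.
Context {R : realType} {d : measure_display} {X : completeMetricMeasurableType R d}.
Hypothesis borelX : borel_sigma_algebra X.
Implicit Types (c : fragment X) (f : X -> R) (rho g : X -> \bar R).
Local Open Scope ereal_scope.
Local Notation leb := (@lebesgue_measure R).

Lemma lipschitz_continuous f : lipschitz_fun f -> continuous f.
Proof.
move=> [L [L0 fL]] x; apply/cvgrPdist_lt => e e0; apply/nbhs_ballP.
have L1 : (0 < L + 1)%R by lra.
exists (e / (L + 1))%R => /=; first by rewrite divr_gt0.
move=> y; rewrite ballEmdist/= => xy; apply: (le_lt_trans (fL _ _ I I)).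
apply: (@le_lt_trans _ _ ((L + 1) * mdist x y)%R).
  by rewrite ler_wpM2r ?mdist_ge0//; lra.
by rewrite mulrC -ltr_pdivlMr.
Qed.

Lemma slope_sup_measurable f r : continuous f -> measurable_fun [set: X] (slope_sup f r).
Proof.
move=> cf; apply: (measurability (@ErealGenOInfty.G R)).
  exact: ErealGenOInfty.measurableE.
move=> _ [_ [a ->] <-]; rewrite setTI.
apply: open_measurable_borel => //.
have -> : slope_sup f r @^-1` `]a%:E, +oo[ = [set x | a%:E < slope_sup f r x].
  by apply/seteqP; split => x; rewrite /= in_itv/= andbT.
exact: slope_sup_open.
Qed.

Lemma Lip_measurable f : continuous f -> measurable_fun [set: X] (Lip f).
Proof.
move=> cf.
have -> : Lip f = fun x => einfs (fun n => maxe 0 (slope_sup f n.+1%:R^-1 x)) 0%N.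
  apply/funext => x; rewrite LipE; apply/eqP; rewrite eq_le; apply/andP; split.
    apply: ereal_inf_le_tmp => _ [n _ <-]; exists (n.+1%:R^-1)%R => //=.
  apply: le_ereal_inf_tmp => _ [r /= r0 <-].
  have [k _ kP] := @near_infty_natSinv_lt R (PosNum r0).
  apply: (@le_trans _ _ (maxe 0 (slope_sup f k.+1%:R^-1 x))).
    by apply: ereal_inf_lbound; exists k.
  rewrite ge_max !le_max lexx/= slope_sup_le ?orbT//.
  exact/ltW/(kP k (leqnn k)).
apply: measurable_fun_einfs => n; apply: measurable_maxe => //.
exact: slope_sup_measurable.
Qed.

Lemma Lip_ug f : lipschitz_fun f -> star_upper_gradient f (Lip f).
Proof.
move=> lf; apply: star_ug_of_slopes => //.
  split; last exact: Lip_ge0.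
  by apply: Lip_measurable; exact: lipschitz_continuous.
move=> c m h cm hs; have [_ m0 _ mspeed] := cm.
apply: (@filterS _ _ (ae_filter_ringOfSetsType leb)) (ae_and (ae_and mspeed hs)
  (ae_and (speed_gt0 cm) (ae_right_accumulation (frag_measurable_dom c)))) =>
    t [[mt ht] [tm acc]] Dt.
have {}tm := tm Dt.
have [Lfin|] := ltP (Lip f (c t)) +oo; last first.
  by rewrite leye_eq => /eqP ->; rewrite gt0_mulye ?leey// lte_fin tm.
have LE : Lip f (c t) = (fine (Lip f (c t)))%:E by rewrite fineK// ge0_fin_numE// Lip_ge0.
have L0 : (0 <= fine (Lip f (c t)))%R by rewrite fine_ge0// Lip_ge0.
rewrite LE -EFinM lee_fin; set L := fine _ in LE L0 *.
apply/ler_addgt0Pr => e0 e00.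
have [A A0 bil] := frag_bilip c.
have C0 : (0 < L + m t + 2)%R by have := m0 t; lra.
(* The estimate below yields [(L + e) * (m t + e) + e], where L is the value of [Lip f] at [c t].
   Since e <= 1, the excess over [L * m t] is at most [e * (L + m t + 2)]. *)
pose e := Num.min 1%R (e0 / (L + m t + 2))%R.
have e_gt0 : (0 < e)%R by rewrite lt_min ltr01 divr_gt0.
have e1 : (e <= 1)%R by rewrite ge_min lexx.
have eC : (e * (L + m t + 2) <= e0)%R by rewrite -ler_pdivlMr// ge_min lexx orbT.
have [r r0 rP] : exists2 r, (0 < r)%R &
    forall y, ball (c t) r y -> (`|f (c t) - f y| <= (L + e) * mdist (c t) y)%R.
  by apply: Lip_lt; rewrite LE lte_fin; lra.
have [d1 d10 d1P] := mt Dt e e_gt0.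
have [d2 d20 d2P] := ht Dt e e_gt0.
have dm : (0 < Num.min (r / A) (Num.min d1 d2))%R by rewrite !lt_min d10 d20 divr_gt0.
have [s Ds /andP[ts std]] := acc Dt _ dm.
have st0 : (0 < s - t)%R by rewrite subr_gt0.
have {std} : (s - t < Num.min (r / A) (Num.min d1 d2))%R by rewrite ltrBlDl.
rewrite !lt_min => /and3P[s3 s1 s2].
have := d1P s Ds; rewrite (gtr0_norm st0) => /(_ s1).
have := d2P s Ds; rewrite /= (gtr0_norm st0) => /(_ s2).
have : ball (c t) r (c s).
  rewrite ballEmdist/=; have /andP[_ /le_lt_trans] := bil t s Dt Ds; apply.
  by rewrite distrC (gtr0_norm st0) mulrC -ltr_pdivlMr.
move=> /rP; rewrite metric_sym distrC.
set D := (f (c s) - f (c t))%R; set dd := mdist _ _ => HD Hh Hd.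
have : (`|h t| * (s - t) <= `|D| + e * (s - t))%R.
  rewrite -[X in (_ * X)%R](gtr0_norm st0) -normrM.
  rewrite -[(h t * _)%R](subKr D); apply: (le_trans (ler_normB _ _)).
  by rewrite lerD2l.
have {Hd} Hd : (dd <= (m t + e) * (s - t))%R by move: Hd; rewrite ler_norml => /andP[_]; lra.
have {Hd} Hd : ((L + e) * dd <= (L + e) * (m t + e) * (s - t))%R.
  by rewrite -mulrA ler_wpM2l//; lra.
move=> H.
have : (`|h t| * (s - t) <= ((L + e) * (m t + e) + e) * (s - t))%R by lra.
rewrite ler_pM2r// => /le_trans; apply.
have ee : (e * e <= e)%R by rewrite ger_pMl.
by rewrite mulrDl mulrDr mulrDr; move: eC; rewrite !mulrDr; lra.
Qed.

(* A weak upper gradient only fails on curves that spend positive time in a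
   null set, so it becomes an upper gradient once set to +oo there. *)
Lemma weak_ug_strengthen (mu : {measure set X -> \bar R}) f rho :
  weak_star_upper_gradient mu f rho ->
  exists2 rho', star_upper_gradient f rho' & {ae mu, forall x, rho' x = rho x}.
Proof.
move=> [[mrho rho0] [Gamma MG H]].
have /choice[r rP] (n : nat) : exists r : X -> \bar R, borel_nonneg r /\
    (forall c, Gamma c -> 1 <= frag_integral c r) /\ 'N[mu]_+oo[r] < (n.+1%:R^-1)%:E.
  have : Mod_infty mu Gamma < (n.+1%:R^-1)%:E by rewrite MG lte_fin invr_gt0.
  by move=> /ereal_inf_lt[_ [r [br rG] <-] rn]; exists r.
(* N collects the points where some [r n] exceeds the bound 1/(n+1) on its essential supremum. *)
pose N := \bigcup_n [set x | (n.+1%:R^-1)%:E < r n x].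
have mNn n : measurable [set x | (n.+1%:R^-1)%:E < r n x].
  have [[mr _] _] := rP n.
  have := mr measurableT _ (emeasurable_itv `](n.+1%:R^-1)%:E, +oo[).
  by rewrite setTI preimage_itvoy.
have mN : measurable N by exact: bigcupT_measurable.
have muN : mu N = 0.
  (* The norm is an essential supremum only when the whole space has positive measure; otherwise
     every measurable set is null. *)
  have [muT|] := ltP 0 (mu setT); last first.
    by move=> h; apply/eqP; rewrite eq_le measure_ge0 andbT (le_trans _ h)// le_measure ?inE.
  apply/negligibleP => //; apply: negligible_bigcup => n.
  have [[mr r0] [_]] := rP n; rewrite unlock muT => rn.
  have : {ae mu, forall x, ~ ((n.+1%:R^-1)%:E < r n x)}.
    apply: (@filterS _ _ (ae_filter_ringOfSetsType mu)) (ess_sup_inf.ess_sup_ge mu (abse \o r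
      n)) => x /=.
    by rewrite gee0_abs// => rx; apply/negP; rewrite -leNgt (le_trans rx)// ltW.
  by apply: negligibleS => x /= rx; apply.
pose rho' x := if x \in N then +oo else rho x.
have rho'0 x : 0 <= rho' x by rewrite /rho'; case: ifP.
have mrho' : measurable_fun [set: X] rho'.
  apply: measurable_fun_ifT => //.
  by apply: (measurable_fun_bool true); rewrite setTI preimage_mem_true.
exists rho'; last first.
  exists N; split => // x /= xN; apply: contrapT => nx; apply: xN.
  by rewrite /rho' memNset.
split => // c.
have [m cm] := ex_speed c; have [_ m0 [K mK] _] := cm.
have gap0 : 0 <= LIP [set: X] f * gap c.
  apply: mule_ge0; last by apply: esum_ge0 => p _; rewrite lee_fin mdist_ge0.
  by apply: le_ereal_inf_tmp => _ [L [L0 _] <-]; rewrite lee_fin.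
have mD := frag_measurable_dom c.
have [Gc|/H] := pselect (Gamma c); last first.
  move=> /le_trans; apply; apply: leeD => //.
  rewrite !(frag_integralE _ cm); apply: ae_le_integral_any => [t|t|].
  - by rewrite mule_ge0// lee_fin.
  - by rewrite mule_ge0// lee_fin.
  - apply: aeW => t Dt; apply: lee_wpmul2r; first by rewrite lee_fin.
    by rewrite /rho'; case: ifP => // _; rewrite leey.
suff E : frag_integral c rho' = +oo.
  rewrite /upper_gradient_along E addye ?leey//.
  by rewrite gt_eqF// (lt_le_trans _ gap0)// ltNy0.
pose T := frag_dom c `&` c @^-1` N.
have mT : measurable T by exact: frag_measurable.
(* If c met N in zero time only, the integral of [r k] along c would be at most [K' / (k+1)], which
   is below 1 for large k, against the admissibility of [r k]. *)
have T0 : leb T != 0.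
  apply/eqP => T0.
  pose K' := (Num.max K 0 * fine (leb (frag_dom c)))%R.
  have K'0 : (0 <= K')%R by rewrite mulr_ge0 ?fine_ge0 ?measure_ge0// le_max lexx orbT.
  have e0 : (0 < (K' + 1)^-1)%R by rewrite invr_gt0; lra.
  have [k _ kP] := @near_infty_natSinv_lt R (PosNum e0).
  have {}kP := kP k (leqnn k); rewrite /= in kP.
  have [[mr r0] [rG _]] := rP k.
  have : frag_integral c (r k) <= (k.+1%:R^-1 * K')%:E.
    rewrite (frag_integralE _ cm).
    have -> : (k.+1%:R^-1 * K')%:E =
        \int[leb]_(t in frag_dom c) cst (k.+1%:R^-1 * Num.max K 0)%:E t.
      rewrite integral_cst//= /K' mulrA [in LHS]EFinM fineK// ge0_fin_numE ?measure_ge0//.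
      by apply: compact_finite_measure; exact: frag_compact.
    apply: ae_le_integral_any => [t|t|].
    - by rewrite mule_ge0// lee_fin.
    - by rewrite lee_fin mulr_ge0// ?invr_ge0// le_max lexx orbT.
    - have aeT : {ae leb, forall t, ~ T t}.
        by exists T; split => //; move=> t /contrapT.
      apply: (@filterS _ _ (ae_filter_ringOfSetsType leb)) aeT => t nT Dt.
      rewrite /cst/= EFinM; apply: lee_pmul => //; first by rewrite lee_fin.
        rewrite leNgt; apply/negP => rk; apply: nT; split => //; exists k => //.
      by rewrite lee_fin le_max mK.
  move=> /(le_trans (rG c Gc)); rewrite lee_fin leNgt => /negP; apply.
  apply: (@le_lt_trans _ _ ((K' + 1)^-1 * K')%R); first by rewrite ler_wpM2r// ltW.
  by rewrite mulrC ltr_pdivrMr; lra.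
rewrite (frag_integralE _ cm); apply/eqP; rewrite -leye_eq.
have -> : +oo = \int[leb]_(t in T) cst +oo t.
  by rewrite integral_cst// gt0_mulye// lt0e T0 measure_ge0.
apply: (@le_trans _ _ (\int[leb]_(t in T) (rho' (c t) * (m t)%:E))).
  apply: ae_le_integral_any => [t|t|]; [by rewrite leey|by rewrite mule_ge0// lee_fin|].
  apply: (@filterS _ _ (ae_filter_ringOfSetsType leb)) (speed_gt0 cm) => t mt [Dt tN].
  by rewrite /rho' mem_set// gt0_mulye// lte_fin mt.
apply: ge0_subset_integral => //.
- apply: emeasurable_funM; first exact: frag_comp_measurable.
  by apply/measurable_EFinP/measurable_funTS; have [] := cm.
- by move=> t _; rewrite mule_ge0// lee_fin.
- by move=> t [].
Qed.

Lemma Lip_le_LIP f (L : R) x : lipschitz_with L [set: X] f -> Lip f x <= L%:E.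
Proof. by move=> [L0 fL]; apply: (Lip_le L0 ltr01) => y _; exact: fL. Qed.

Lemma ug_min f g rho : lipschitz_fun f ->
  star_upper_gradient f g -> star_upper_gradient f rho ->
  star_upper_gradient f (fun x => mine (g x) (rho x)).
Proof.
move=> lf fg frho.
have := @ug_einfs _ _ _ borelX f (fun n => if n is 0%N then g else rho) lf _.
have -> : (fun x => einfs (fun n : nat => (if n is 0%N then g else rho) x) 0%N) =
    (fun x => mine (g x) (rho x)).
  apply/funext => x; apply/eqP; rewrite eq_le; apply/andP; split.
    rewrite le_min; apply/andP; split; apply: ereal_inf_lbound.
      by exists 0%N.
    by exists 1%N.
  apply: le_ereal_inf_tmp => _ [[|n] _ <-]; first by rewrite ge_min lexx.
  by rewrite ge_min lexx orbT.
by apply; case.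
Qed.

Lemma ae_eq_of_integral_le (mu : {measure set X -> \bar R}) g1 g2 :
  measurable_fun [set: X] g1 -> measurable_fun [set: X] g2 ->
  (forall x, 0 <= g1 x) -> (forall x, g1 x <= g2 x) ->
  \int[mu]_x g2 x < +oo -> \int[mu]_x g2 x <= \int[mu]_x g1 x ->
  {ae mu, forall x, g2 x <= g1 x}.
Proof.
move=> m1 m2 g10 g12 fin2 le21.
have g20 x : 0 <= g2 x by exact: le_trans (g12 x).
have i2 : mu.-integrable [set: X] g2.
  apply/integrableP; split => //; under eq_integral => x _ do rewrite gee0_abs//.
  by [].
have i1 : mu.-integrable [set: X] g1.
  apply: (le_integrable _ _ _ i2) => // x _.
  by rewrite !gee0_abs// g12.
have i21 := integrableB measurableT i2 i1.
have int0 : \int[mu]_x (g2 x - g1 x) = 0.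
  rewrite (integralB measurableT i2 i1); apply/eqP; rewrite eq_le; apply/andP; split.
    by rewrite leeBlDr ?integrable_fin_num// add0e.
  rewrite leeBrDr ?integrable_fin_num// add0e; exact: ge0_le_integral.
have fin2' : {ae mu, forall x, g2 x \is a fin_num}.
  apply: (@filterS _ _ (ae_filter_ringOfSetsType mu)) (integrable_ae measurableT i2) => x; exact.
have nn x : g2 x \is a fin_num -> 0 <= g2 x - g1 x.
  move=> g2f; rewrite sube_ge0 ?g12// g2f ?orbT//.
have abs0 : \int[mu]_x `|g2 x - g1 x| = 0.
  rewrite -int0; apply: ae_eq_integral_any.
  by apply: (@filterS _ _ (ae_filter_ringOfSetsType mu)) fin2' => x g2f _; rewrite gee0_abs// nn.
have := (ae_eq_integral_abs mu measurableT (measurable_int mu i21)).1 abs0.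
apply: (@filterS2 _ _ (ae_filter_ringOfSetsType mu)) fin2' => x g2f /(_ I) /= E.
by rewrite -sube_le0 E.
Qed.

(** A minimizer of the integral exists, as the infimum of a minimizing sequence of upper gradients
    is an upper gradient. Its minimum with any competitor is again one, so it cannot have a smaller
    integral and agrees with the minimizer almost everywhere. *)
Lemma ex_minimal_ug (mu : {measure set X -> \bar R}) f :
  metric_measure_space mu -> lipschitz_bs f ->
  exists g, is_minimal_star_upper_gradient mu f g.
Proof.
move=> [_ _ mufin] [lf [x0 [r0 supp]]].
have [L [L0 fL]] := lf; have fLw : lipschitz_with L [set: X] f by [].
pose J g := \int[mu]_x g x.
pose S := [set g | star_upper_gradient f g].
have SL : S (Lip f) by exact: Lip_ug.
(* Finiteness comes from the bounded support: [Lip f] is at most L and vanishes off a ball of finite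
   measure. *)
have JL : J (Lip f) < +oo.
  have mB : measurable (ball x0 r0) by apply: open_measurable_borel => //; exact: metric_ball_open.
  apply: (@le_lt_trans _ _ (\int[mu]_x (L%:E * (\1_(ball x0 r0) x)%:E))).
    apply: ge0_le_integral => //.
    - by move=> x _; exact: Lip_ge0.
    - by apply: Lip_measurable; exact: lipschitz_continuous.
    - apply: emeasurable_funM => //; apply/measurable_EFinP; exact: measurable_indic.
    - move=> x _; have [xB|xB] := pselect (ball x0 r0 x).
        by rewrite indicE mem_set// mule1; exact: Lip_le_LIP.
      rewrite indicE memNset// mule0.
      have /Lip_a_closed_support <- : ~ closure [set y | f y != 0%R] x by move=> /supp.
      exact: Lip_le_Lip_a.
  have m1 : measurable_fun [set: X] (fun x => (\1_(ball x0 r0) x : R)%:E).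
    by apply/measurable_EFinP; exact: measurable_indic.
  rewrite ge0_integralZl// integral_indic// setIT lte_mul_pinfty ?lee_fin//.
  by apply: mufin => //; exists x0, r0.
pose I := ereal_inf (J @` S).
have I0 : 0 <= I.
  apply: le_ereal_inf_tmp => _ [g Sg <-]; apply: integral_ge0 => x _.
  by have [[_ ->]] := Sg.
have Ifin : I \is a fin_num.
  by rewrite ge0_fin_numE//; apply: le_lt_trans JL; apply: ereal_inf_lbound; exists (Lip f).
have /choice[g gP] (n : nat) : exists g, S g /\ J g < I + (n.+1%:R^-1)%:E.
  have : I < I + (n.+1%:R^-1)%:E by rewrite lteDl// lte_fin invr_gt0.
  by move=> /ereal_inf_lt[_ [g Sg <-] gI]; exists g.
pose gm x := einfs (g^~ x) 0%N.
have Sgm : S gm by apply: ug_einfs => // n; have [] := gP n.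
have [[mgm gm0] _] := Sgm.
have JI : J gm <= I.
  apply/lee_addgt0Pr => e e0; have [k _ kP] := @near_infty_natSinv_lt R (PosNum e0).
  have [Sgk /ltW gk] := gP k; have [[mgk gk0] _] := Sgk.
  apply: (@le_trans _ _ (J (g k))).
    by apply: ge0_le_integral => // x _; apply: ereal_inf_lbound; exists k.
  apply: (le_trans gk); apply: leeD => //; rewrite lee_fin ltW//.
  exact: (kP k (leqnn k)).
exists gm; split => // rho wrho _.
have [rho' Srho' rho'E] := weak_ug_strengthen wrho.
have [[mrho' rho'0] _] := Srho'.
have Smin : S (fun x => mine (gm x) (rho' x)) by exact: ug_min.
have : {ae mu, forall x, gm x <= mine (gm x) (rho' x)}.
  apply: ae_eq_of_integral_le => //.
  - by have [[]] := Smin.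
  - by move=> x; rewrite le_min gm0 rho'0.
  - by move=> x; rewrite ge_min lexx.
  - by rewrite (le_lt_trans JI)// ltey_eq Ifin.
  - by apply: (le_trans JI); apply: ereal_inf_lbound; exists (fun x => mine (gm x) (rho' x)).
apply: (@filterS2 _ _ (ae_filter_ringOfSetsType mu)) rho'E => x <-.
by rewrite le_min => /andP[].
Qed.

Lemma minimal_ugP (mu : {measure set X -> \bar R}) f :
  metric_measure_space mu -> lipschitz_bs f ->
  is_minimal_star_upper_gradient mu f (minimal_star_upper_gradient mu f).
Proof.
move=> hX hf; rewrite /minimal_star_upper_gradient; case: xgetP => // nex.
by have [g gP] := ex_minimal_ug hX hf; have := nex g.
Qed.

Lemma star_ug_weak (mu : {measure set X -> \bar R}) f g :
  star_upper_gradient f g -> weak_star_upper_gradient mu f g.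
Proof.
move=> [bg fg]; split => //; exists set0 => //.
apply/eqP; rewrite eq_le; apply/andP; split.
  apply: ereal_inf_lbound; exists (cst 0).
    by split; [split => //; exact: measurable_cst|move=> c []].
  rewrite unlock; case: ifPn => // muT; rewrite (_ : _ \o _ = cst 0).
    exact: ess_sup_inf.ess_sup_cst.
  by apply/funext => x /=; rewrite normr0.
by apply: le_ereal_inf_tmp => _ [rho _ <-]; exact: Lnorm_ge0.
Qed.

(** The bound by M supplies the finite essential norm that minimality asks of its competitors. *)
Lemma minimal_ug_le (mu : {measure set X -> \bar R}) f rho (M : R) :
  metric_measure_space mu -> lipschitz_bs f ->
  star_upper_gradient f rho -> (forall x, rho x <= M%:E) ->
  {ae mu, forall x, minimal_star_upper_gradient mu f x <= rho x}.
Proof.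
move=> hX hf frho rhoM; have [_] := minimal_ugP hX hf; apply.
  exact: star_ug_weak.
have [[_ rho0] _] := frho.
rewrite unlock; case: ifPn => // _; apply: (@le_lt_trans _ _ M%:E); last exact: ltry.
by apply/ess_sup_inf.ess_supP; apply: aeW => x /=; rewrite gee0_abs.
Qed.

Lemma minimal_ug_le_Lip (mu : {measure set X -> \bar R}) f :
  metric_measure_space mu -> lipschitz_bs f ->
  {ae mu, forall x, minimal_star_upper_gradient mu f x <= Lip f x}.
Proof.
move=> hX hf; have [L fL] := hf.1.
by apply: (minimal_ug_le (M := L) hX hf (Lip_ug hf.1)) => x; exact: Lip_le_LIP.
Qed.

End minimal_ug.

(** * Regularity of the measure *)

Section regularity.
Context {R : realType} {dd : measure_display} {X : completeMetricMeasurableType R dd}.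
Variable mu : {measure set X -> \bar R}.
Hypotheses (borelX : borel_sigma_algebra X) (sepX : separable X).
Variable S : set X.
Hypotheses (mS : measurable S) (muS : (mu S < +oo)%E).
Implicit Types (A B F U K : set X) (e : R).
Local Notation d := mdist.

Let open_meas U : open U -> measurable U. Proof. exact: open_measurable_borel. Qed.

Let closed_meas F : closed F -> measurable F.
Proof.
by move=> cF; rewrite -[F]setCK; apply: measurableC; apply: open_meas; exact: closed_openC.
Qed.

Lemma measure_le_eps_series A (B_ : nat -> set X) e : 0 <= e -> measurable A ->
  (forall n, measurable (B_ n)) -> A `<=` \bigcup_n B_ n ->
  (forall n, (mu (B_ n) <= (e / (2 ^ n.+1)%:R)%:E)%E) -> (mu A <= e%:E)%E.
Proof.
move=> e0 mA mB AB Be; apply: (le_trans (measure_sigma_subadditive mu mB mA AB)).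
apply: (le_trans _ (epsilon_trick0 xpredT e0)).
by apply: lee_nneseries => // n _; exact: Be.
Qed.

Lemma measure_tail_le (A_ : nat -> set X) e : (forall n, measurable (A_ n)) -> 0 < e ->
  exists N, (mu (S `&` (\bigcup_i A_ i `\` \bigcup_(i < N) A_ i)) <= e%:E)%E.
Proof.
move=> mA e0; pose F N := S `&` (\bigcup_i A_ i `\` \bigcup_(i < N) A_ i).
have mF N : measurable (F N).
  by apply: measurableI => //; apply: measurableD; exact: bigcup_measurable.
have F0 : \bigcap_N F N = set0.
  apply/seteqP; split => // x H; have [_ [[i _ Aix] _]] := H 0%N I.
  by have [_ [_]] := H i.+1 I; apply; exists i => /=.
have cvF : (mu \o F) x @[x --> \oo] --> mu (\bigcap_n F n).
  apply: nonincreasing_cvg_mu => //.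
  - by apply: (le_lt_trans _ muS); apply: le_measure; rewrite ?inE// => x [].
  - by rewrite F0.
  - move=> n m nm; apply/subsetPset => x [Sx [Ux nx]]; split => //; split => //.
    by move=> [i /= im Aix]; apply: nx; exists i => //=; exact: leq_trans nm.
rewrite F0 measure0 in cvF.
have : nbhs (0%E : \bar R) [set y | (y < e%:E)%E].
  by apply: open_nbhs_nbhs; split; [exact: open_ereal_lt_ereal|rewrite /= lte_fin].
by move=> /cvF[N _ HN]; exists N; apply: ltW; exact: (HN N (leqnn _)).
Qed.

(** The sets with this property for every e form a sigma-algebra. It contains an open U, which is
    the increasing union of the closed sets of points whose ball of radius 1/(n+1) stays in U. *)
Lemma closed_open_regular A e : measurable A -> 0 < e -> exists F U,
  [/\ closed F, open U, F `<=` A, A `<=` U & (mu (S `&` (U `\` F)) <= e%:E)%E].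
Proof.
move=> mA; move: e; pose G A := forall e, 0 < e -> exists F U,
  [/\ closed F, open U, F `<=` A, A `<=` U & (mu (S `&` (U `\` F)) <= e%:E)%E].
suff H : <<s @open X >> `<=` G by apply: H; rewrite -borelX.
apply: smallest_sub; last first.
  move=> U oU e e0; pose F_ n := [set x | ball x n.+1%:R^-1 `<=` U].
  have cF n : closed (F_ n).
    move=> x clx y xy; have d0 : 0 < n.+1%:R^-1 - d x y.
      by rewrite subr_gt0; move: xy; rewrite ballEmdist.
    have [z [zF xz]] := clx _ (nbhsx_ballx x _ d0); apply: zF.
    move: xz; rewrite !ballEmdist/= => xz; rewrite (le_lt_trans (metric_triangle z x y))//.
    by rewrite metric_sym -ltrBrDr.
  have F_U : \bigcup_n F_ n = U.
    apply/seteqP; split => x; first by move=> [n _]; apply; exact: ballxx.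
    move=> Ux; have /nbhs_ballP[r /= r0 rU] : nbhs x U by exact: open_nbhs_nbhs.
    have [k _ kP] := @near_infty_natSinv_lt R (PosNum r0).
    exists k => // y xy; apply: rU; apply: le_ball xy; apply: ltW.
    exact: (kP k (leqnn _)).
  have [N HN] := measure_tail_le (fun n => closed_meas (cF n)) e0.
  exists (\bigcup_(i < N) F_ i), U; split => //.
  - by apply: closed_bigcup => //; exact: finite_II.
  - by rewrite -F_U; apply: bigcup_subset.
  - by rewrite -{1}F_U.
split.
- move=> e e0; exists set0, set0; split => //; [exact: closed0|exact: open0|].
  by rewrite setD0 setI0 measure0 lee_fin ltW.
- move=> A' GA e /GA[F [U [cF oU FA AU H]]]; exists (~` U), (~` F); split.
  + exact: open_closedC.
  + exact: closed_openC.
  + by move=> x nU; split => // /AU.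
  + by move=> x [_ nA] /FA.
  + by rewrite setDE setCK setIC [~` F `&` U]setIC setIC.
- move=> A_ GA e e0; have e2 : 0 < e / 2 by rewrite divr_gt0.
  have /choice[FU HFU] (n : nat) : exists FU : set X * set X,
      [/\ closed FU.1, open FU.2, FU.1 `<=` A_ n, A_ n `<=` FU.2
        & (mu (S `&` (FU.2 `\` FU.1)) <= (e / 2 / (2 ^ n.+1)%:R)%:E)%E].
    have [|F [U H]] := GA n (e / 2 / (2 ^ n.+1)%:R); last by exists (F, U).
    by rewrite divr_gt0// ltr0n expn_gt0.
  have mF n : measurable (FU n).1 by apply: closed_meas; case: (HFU n).
  have mU n : measurable (FU n).2 by apply: open_meas; case: (HFU n).
  (* Only finite unions of the closed sets are closed. One half of e pays for the discarded tail,
     the other half for the errors of the individual sets. *)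
  have [N HN] := measure_tail_le mF e2.
  exists (\bigcup_(i < N) (FU i).1), (\bigcup_i (FU i).2); split => //.
  + by apply: closed_bigcup => [|i _]; [exact: finite_II|case: (HFU i)].
  + by apply: bigcup_open => i _; case: (HFU i).
  + by move=> x [i _ Fx]; exists i => //; have [_ _ h _ _] := HFU i; exact: h.
  + by move=> x [i _ Fx]; exists i => //; have [_ _ _ h _] := HFU i; exact: h.
  rewrite [e]splitr EFinD.
  pose B1 := S `&` (\bigcup_i (FU i).2 `\` \bigcup_i (FU i).1).
  pose B2 := S `&` (\bigcup_i (FU i).1 `\` \bigcup_(i < N) (FU i).1).
  have mB1 : measurable B1 by apply: measurableI => //; apply: measurableD;
    exact: bigcup_measurable.
  have mB2 : measurable B2 by apply: measurableI => //; apply: measurableD;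
    exact: bigcup_measurable.
  apply: (@le_trans _ _ (mu (B1 `|` B2))).
    apply: le_measure; rewrite ?inE; [|exact: measurableU|].
      by apply: measurableI => //; apply: measurableD; exact: bigcup_measurable.
    move=> x [Sx [Ux nF]]; have [h|h] := pselect ((\bigcup_i (FU i).1) x); first by right.
    by left.
  apply: (le_trans (measureU2 _ _ _)) => //; apply: leeD => //.
  apply: (@measure_le_eps_series _ (fun n => S `&` ((FU n).2 `\` (FU n).1))) => //.
  + exact: ltW.
  + by move=> n; apply: measurableI => //; exact: measurableD.
  + move=> x [Sx [[i _ Uix] nF]]; exists i => //; split => //; split => // Fix_.
    by apply: nF; exists i.
  + by move=> n; case: (HFU n).
Qed.

Lemma ex_dense_seq : exists xs : nat -> X, forall x r, 0 < r -> exists i, d (xs i) x < r.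
Proof.
have [D cD dD] := sepX; have [D0|[f]] := pfcard_geP cD.
  have [|x []] := dD [set: X] _ openT; first by exists point.
  by rewrite D0.
exists f => x r r0; have [|y [xy Dy]] := dD (ball x r) _ (metric_ball_open _ _).
  by exists x; exact: ballxx.
have [i _ fi] := 'surj_f Dy; exists i.
by rewrite fi metric_sym; move: xy; rewrite ballEmdist.
Qed.

Lemma ultra_bigcup (T : Type) (F : set_system T) (A_ : nat -> set T) N : UltraFilter F ->
  F (\bigcup_(i < N) A_ i) -> exists i, F (A_ i).
Proof.
move=> UF; elim: N => [|N IH].
  by rewrite bigcup_mkord big_ord0 => /filter_ex[].
rewrite bigcup_mkord big_ord_recr/= -bigcup_mkord => FA.
have [h|h] := in_ultra_setVsetC (A_ N) UF; first by exists N.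
by apply: IH; apply: filterS (filterI FA h) => x [[]].
Qed.

(* Ulam's theorem: [mu] is tight on [S]. *)
Lemma compact_tight e : 0 < e -> exists2 K, compact K & (mu (S `\` K) <= e%:E)%E.
Proof.
move=> e0; have [xs xsP] := ex_dense_seq.
pose B_ n i := ball (xs i) n.+1%:R^-1.
have mB n i : measurable (B_ n i) by apply: open_meas; exact: metric_ball_open.
have BT n : \bigcup_i B_ n i = [set: X].
  apply/seteqP; split => // x _; have [|i xi] := xsP x n.+1%:R^-1; first by rewrite invr_gt0.
  by exists i => //; rewrite /B_ ballEmdist.
have /choice[N HN] (n : nat) : exists N,
    (mu (S `\` \bigcup_(i < N) B_ n i) <= (e / (2 ^ n.+1)%:R)%:E)%E.
  have e'0 : 0 < e / (2 ^ n.+1)%:R by rewrite divr_gt0// ltr0n expn_gt0.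
  have [N H] := measure_tail_le (mB n) e'0; exists N.
  by move: H; rewrite BT setTD setDE.
pose K0 := \bigcap_n \bigcup_(i < N n) B_ n i.
have mK0 : measurable K0.
  by apply: bigcap_measurable => [|n _]; [exists 0%N|exact: bigcup_measurable].
have cK : closed (closure K0) by exact: closed_closure.
exists (closure K0); last first.
  apply: (@measure_le_eps_series _ (fun n => S `\` \bigcup_(i < N n) B_ n i)) => //.
  - exact: ltW.
  - by apply: measurableD => //; exact: closed_meas.
  - by move=> n; apply: measurableD => //; exact: bigcup_measurable.
  - move=> x [Sx nK]; apply: contrapT => nU; apply: nK; apply: subset_closure => n _.
    by apply: contrapT => nB; apply: nU; exists n.
(* For each radius finitely many balls cover the closure of K0, so an ultrafilter on it selects one
   of them. It is therefore Cauchy, and completeness applies. *)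
rewrite compact_ultra => F UF FK.
have PF : ProperFilter F by exact: ultra_proper.
have cF : cauchy F.
  apply/cauchy_exP => r /= r0; have r2 : 0 < r / 2 by rewrite divr_gt0.
  have [n _ nP] := @near_infty_natSinv_lt R (PosNum r2).
  have nr : n.+1%:R^-1 < r / 2 by exact: (nP n (leqnn _)).
  have [|i Fi] := @ultra_bigcup _ F (fun i => ball (xs i) r) (N n) UF; last by exists (xs i).
  apply: filterS FK => y /(_ _ (nbhsx_ballx y _ r2))[z [zK yz]].
  have [i iN zi] := zK n I; exists i => //; move: yz zi; rewrite /B_ !ballEmdist/= => yz zi.
  rewrite (le_lt_trans (metric_triangle _ z _))// [d z y]metric_sym.
  by rewrite [r]splitr ltrD// (lt_trans zi).
have Fp := @cauchy_cvg X F PF cF; exists (lim F); split => //.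
apply: cK => B nB; apply: filter_ex (filterI FK _); exact: Fp.
Qed.

Lemma compact_inner_regular A e : measurable A -> 0 < e ->
  exists K, [/\ compact K, K `<=` A & (mu (S `&` A `\` K) <= e%:E)%E].
Proof.
move=> mA e0; have e2 : 0 < e / 2 by rewrite divr_gt0.
have [F [U [cF oU FA AU H]]] := closed_open_regular mA e2.
have [K cK HK] := compact_tight e2.
have mK : measurable K by apply: closed_meas; apply: compact_closed cK; exact: metric_hausdorff.
have mF := closed_meas cF; have mU := open_meas oU.
exists (F `&` K); split; [by rewrite setIC; exact: compact_closedI|by move=> x [/FA]|].
rewrite [e]splitr EFinD.
apply: (@le_trans _ _ (mu ((S `&` (U `\` F)) `|` (S `\` K)))).
  apply: le_measure; rewrite ?inE.
  - by apply: measurableD; exact: measurableI.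
  - by apply: measurableU; [apply: measurableI => //|]; exact: measurableD.
  - move=> x [[Sx Ax] nFK]; have [h|h] := pselect (F x).
      by right; split => // Kx; exact: nFK.
    by left; split => //; split => //; exact: AU.
apply: (le_trans (measureU2 _ _ _)); last exact: leeD.
  by apply: measurableI => //; exact: measurableD.
exact: measurableD.
Qed.

(* Compact pieces of the level sets [k eta <= g < (k + 1) eta] are at a positive
   distance from each other. *)
Lemma compact_slow_drop (g : X -> \bar R) A (eta e : R) N :
  measurable_fun [set: X] g -> (forall x, 0 <= g x)%E -> measurable A ->
  0 < eta -> 0 < e ->
  exists K, [/\ compact K, K `<=` A `&` [set x | (g x < (N%:R * eta)%:E)%E],
    (mu (S `&` (A `&` [set x | (g x < (N%:R * eta)%:E)%E]) `\` K) <= e%:E)%E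
    & forall p, K p -> exists2 r, 0 < r &
        forall q, K q -> d p q < r -> (g p <= g q + eta%:E)%E].
Proof.
move=> mg g0 mA eta0; have mlt (r : R) : measurable [set x | (g x < r%:E)%E].
  rewrite -[X in measurable X]setTI (_ : [set x | _] = g @^-1` `]-oo, r%:E[%classic).
    by apply: mg => //; exact: emeasurable_itv.
  by apply/seteqP; split => x; rewrite /= in_itv.
have farP (K K' : set X) p : compact K' -> K p -> K `&` K' = set0 ->
    exists2 r, 0 < r & forall q, d p q < r -> ~ K' q.
  move=> cK' Kp KK'; have /nbhs_ballP[r /= r0 rP] : nbhs p (~` K').
    apply: open_nbhs_nbhs; split; first by apply: closed_openC; apply: compact_closed cK';
      exact: metric_hausdorff.
    by move=> K'p; have : (K `&` K') p by []; rewrite KK'.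
  by exists r => // q pq; apply: rP; rewrite ballEmdist.
(* Induction on the number of levels; half of the tolerance is spent on the new top level. *)
elim: N e => [|N IH] e e0.
  exists set0; split => //; [exact: compact0|].
  rewrite mul0r (_ : [set x | _] = set0) ?setI0 ?set0D ?measure0 ?lee_fin ?ltW//.
  by apply/seteqP; split => // x /=; rewrite ltNge g0.
have e2 : 0 < e / 2 by rewrite divr_gt0.
have [K [cK KA muK KP]] := IH _ e2.
pose E := A `&` ([set x | (g x < (N.+1%:R * eta)%:E)%E] `\` [set x | (g x < (N%:R * eta)%:E)%E]).
have mE : measurable E by apply: measurableI => //; exact: measurableD.
have [K' [cK' K'E muK']] := compact_inner_regular mE e2.
have KK' : K `&` K' = set0.
  by apply/seteqP; split => // x [/KA[_ h] /K'E[_ [_]]].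
have hK : closed K by apply: compact_closed cK; exact: metric_hausdorff.
have hK' : closed K' by apply: compact_closed cK'; exact: metric_hausdorff.
exists (K `|` K'); split.
- exact: compactU.
- move=> x [/KA[Ax h]|/K'E[Ax [h _]]]; split => //; apply: (lt_le_trans h).
  by rewrite lee_fin ler_pM2r// ler_nat.
- rewrite [e]splitr EFinD.
  apply: (@le_trans _ _ (mu ((S `&` (A `&` [set x | (g x < (N%:R * eta)%:E)%E]) `\` K) `|`
      (S `&` E `\` K')))).
    have mK := closed_meas hK; have mK' := closed_meas hK'.
    apply: le_measure; rewrite ?inE.
    + apply: measurableD; last exact: measurableU.
      by apply: measurableI => //; exact: measurableI.
    + by apply: measurableU; apply: measurableD => //;
        do ?[exact: measurableI|apply: measurableI => //].
    + move=> x [[Sx [Ax h]] nKK]; have [h'|/negP h'] := boolP (g x < (N%:R * eta)%:E)%E.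
        by left; split => // Kx; apply: nKK; left.
      by right; split => // Kx; apply: nKK; right.
  have mK := closed_meas hK; have mK' := closed_meas hK'.
  apply: (le_trans (measureU2 _ _ _)); last exact: leeD.
    by apply: measurableD => //; apply: measurableI => //; exact: measurableI.
  by apply: measurableD => //; apply: measurableI.
- move=> p [Kp|K'p].
    have [r1 r10 r1P] := KP p Kp; have [r2 r20 r2P] := farP _ _ p cK' Kp KK'.
    exists (Num.min r1 r2); first by rewrite lt_min r10.
    by move=> q [Kq|K'q]; rewrite lt_min => /andP[h1 h2]; [exact: r1P|case: (r2P q h2)].
  rewrite setIC in KK'; have [r2 r20 r2P] := farP _ _ p cK K'p KK'.
  exists r2 => // q [Kq h|K'q _]; first by case: (r2P q h).
  have [_ [/ltW h _]] := K'E p K'p; have [_ [_ /negP]] := K'E q K'q.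
  rewrite -leNgt => h'; apply: (le_trans h); apply: (@le_trans _ _ ((N%:R * eta)%:E + eta%:E)%E).
    by rewrite -EFinD lee_fin -addn1 natrD mulrDl mul1r.
  exact: leeD.
Qed.

End regularity.

(** * Approximation by chains *)

Section chains.
Context {R : realType} {X : metricType R}.
Variables (L : R) (w : X -> R) (C : set X) (e0 : R).
Hypotheses (e00 : 0 < e0) (e0L : e0 <= L) (w_ge : forall p, C p -> e0 <= w p).
Implicit Types (x y p q : X) (r t m : R) (s : seq (X * option X)).

Local Notation d := mdist.

(* A step (y, None) from x is a jump, of cost L d(x, y); a step (y, Some p) goes
   from x to y in the ball of radius r around p in C, at the cost w(p) d(x, y). *)
Definition step_ok r x (st : X * option X) :=
  if st.2 is Some p then [/\ C p, d x p < r & d p st.1 < r] else True.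

Definition step_cost x (st : X * option X) :=
  if st.2 is Some p then w p * d x st.1 else L * d x st.1.

Fixpoint chain_ok r x s :=
  if s is st :: s' then step_ok r x st /\ chain_ok r st.1 s' else True.

Fixpoint chain_cost x s :=
  if s is st :: s' then step_cost x st + chain_cost st.1 s' else 0.

Fixpoint chain_end x s := if s is st :: s' then chain_end st.1 s' else x.

(* The mark (t, p) records the cost t spent by the chain before a step through
   the ball around p. *)
Fixpoint marks t x s : seq (R * X) :=
  if s is st :: s' then
    let rest := marks (t + step_cost x st) st.1 s' in
    if st.2 is Some p then (t, p) :: rest else rest
  else [::].

Let L0 : 0 < L. Proof. exact: lt_le_trans e0L. Qed.

Lemma step_cost_ge r x st : step_ok r x st -> 0 <= step_cost x st.
Proof.
case: st => y [p|]; rewrite /step_ok /step_cost/=.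
  by move=> [Cp _ _]; rewrite mulr_ge0 ?mdist_ge0// (le_trans (ltW e00))// w_ge.
by move=> _; rewrite mulr_ge0 ?mdist_ge0// ltW.
Qed.

Lemma chain_cost_ge0 r x s : chain_ok r x s -> 0 <= chain_cost x s.
Proof.
elim: s x => //= st s IH x [so co].
by rewrite addr_ge0 ?IH//; exact: step_cost_ge so.
Qed.

Lemma marks_time r t x s a : chain_ok r x s -> a \in marks t x s ->
  [/\ t <= a.1, a.1 <= t + chain_cost x s & C a.2].
Proof.
elim: s t x => //= st s IH t x [so co].
have c0 := step_cost_ge so; have cc0 := chain_cost_ge0 co.
have tail : a \in marks (t + step_cost x st) st.1 s ->
    [/\ t <= a.1, a.1 <= t + (step_cost x st + chain_cost st.1 s) & C a.2].
  by move=> /(IH _ _ co)[h1 h2 h3]; split => //; lra.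
case: st so tail c0 co cc0 => y [p|] //= so tail c0 co cc0.
rewrite inE => /orP[/eqP ->/=|//].
by have [Cp _ _] := so; split => //; lra.
Qed.

(** Up to the mark a every step costs at least m per unit length, jumps included since m <= L. The
    term [m * r] pays for the passage from the chain to the centre of the ball. *)
Lemma mark_reach r t x s a m : chain_ok r x s -> a \in marks t x s ->
  0 <= m -> m <= L ->
  (forall b, b \in marks t x s -> b.1 <= a.1 -> m <= w b.2) ->
  m * d x a.2 <= a.1 - t + m * r.
Proof.
move=> + + m0 mL; elim: s t x => //= st s IH t x [so co].
have tri := ler_wpM2l m0 (metric_triangle x st.1 a.2).
have d0 := mdist_ge0 x st.1.
case: st so co tri d0 => y [p|] //= so co tri d0; last first.
  move=> ain H; have := IH _ _ co ain H.
  rewrite mulrDr in tri; have : m * d x y <= L * d x y by rewrite ler_wpM2r.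
  by rewrite /step_cost/=; lra.
have [Cp xp py] := so; rewrite inE => /orP[/eqP ->/= _|ain H].
  by rewrite subrr add0r ler_wpM2l// ltW.
have [ta _ _] := marks_time co ain.
have mp : m <= w p.
  apply: (H (t, p)); rewrite ?inE ?eqxx//=; apply: le_trans ta.
  by rewrite lerDl; exact: step_cost_ge so.
have := IH _ _ co ain (fun b bin => H b (mem_behead (s := (t, p) :: _) bin)).
rewrite mulrDr in tri; have : m * d x y <= w p * d x y by rewrite ler_wpM2r.
by rewrite /step_cost/=; lra.
Qed.

(** The chain is cut just before the marked step; u is the starting point of that step, and
    [a.1 - t] the cost spent to reach it. *)
Lemma mark_split r t x s a : chain_ok r x s -> a \in marks t x s ->
  exists u s', [/\ chain_ok r u s', chain_end u s' = chain_end x s,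
    chain_cost x s = a.1 - t + chain_cost u s' & d u a.2 < r].
Proof.
elim: s t x => //= st s IH t x [so co].
have tail : a \in marks (t + step_cost x st) st.1 s ->
    exists u s', [/\ chain_ok r u s', chain_end u s' = chain_end st.1 s,
    step_cost x st + chain_cost st.1 s = a.1 - t + chain_cost u s' & d u a.2 < r].
  move=> /(IH _ _ co)[u [s' [h1 h2 h3 h4]]]; exists u, s'; split => //; lra.
case: st so co tail => y [p|] //= so co tail.
rewrite inE => /orP[/eqP ->/=|//].
exists x, ((y, Some p) :: s); split => //; first by rewrite subrr add0r.
by have [] := so.
Qed.

(** After the last mark only jumps follow, and these cost L per unit length. In the induction, a is
    the most recent mark met so far. *)
Lemma mark_last r t x s a : chain_ok r x s -> L * d a.2 x <= t - a.1 + L * r ->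
  exists2 b, b \in a :: marks t x s &
    L * d b.2 (chain_end x s) <= t + chain_cost x s - b.1 + L * r.
Proof.
elim: s t x a => /= [|st s IH] t x a.
  by move=> _ H; exists a; rewrite ?inE ?eqxx// addr0.
move=> [so co] H; case: st so co => y [p|] /= so co.
  have [Cp xp py] := so; have c0 := step_cost_ge so.
  have := IH (t + step_cost x (y, Some p)) y (t, p) co; case.
    rewrite /=; have : L * d p y <= L * r by rewrite ler_pM2l// ltW.
    lra.
  by move=> b bin bP; exists b; [rewrite inE bin orbT|rewrite addrA].
have := IH (t + step_cost x (y, None)) y a co; case.
  have := metric_triangle a.2 x y; rewrite -(ler_pM2l L0) mulrDr /step_cost/=; lra.
by move=> b bin bP; exists b => //; rewrite addrA.
Qed.

(* The marks a1 and a2 are consecutive, so only jumps separate them. *)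
Lemma jump_gap r t x s a mid : chain_ok r x s ->
  L * d a.2 x <= t - a.1 + L * r -> a.1 <= t -> a.1 <= mid ->
  (exists2 b, b \in marks t x s & mid < b.1) ->
  exists a1 a2, [/\ a1 \in a :: marks t x s, a2 \in marks t x s, a1.1 <= mid < a2.1,
    L * d a1.2 a2.2 <= a2.1 - a1.1 + 2 * (L * r)
    & forall b, b \in a :: marks t x s -> b.1 <= a1.1 \/ a2.1 <= b.1].
Proof.
elim: s t x a => /= [|st s IH] t x a; first by move=> _ _ _ _ [].
move=> [so co] H at_ amid; case: st so co => y [p|] /= so co.
  have [Cp xp py] := so; have c0 := step_cost_ge so.
  have Lxp : L * d x p <= L * r by rewrite ler_pM2l// ltW.
  have Lpy : L * d p y <= L * r by rewrite ler_pM2l// ltW.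
  have [tm|mt] := leP t mid; last first.
    move=> _; exists a, (t, p); split => //=; rewrite ?inE ?eqxx ?amid//.
      have := metric_triangle a.2 x p; rewrite -(ler_pM2l L0) mulrDr; lra.
    move=> b; rewrite inE => /orP[/eqP ->|]; first by left.
    rewrite inE => /orP[/eqP ->|bin]; first by right.
    by right; have [] := marks_time co bin; rewrite /=; lra.
  move=> [b]; rewrite inE => /orP[/eqP ->/=|bin mb]; first by rewrite ltNge tm.
  have := IH (t + step_cost x (y, Some p)) y (t, p) co; rewrite /=.
  case=> //; [lra|lra|by exists b|].
  move=> a1 [a2 [i1 i2 a12 La aP]]; exists a1, a2; split => //.
  - by rewrite inE i1 orbT.
  - by rewrite inE i2 orbT.
  - move=> b'; rewrite inE => /orP[/eqP ->|]; last exact: aP.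
    left; have [h|h] := aP (t, p) (mem_head _ _); first exact: le_trans at_ h.
    by move: a12 h => /andP[_ h1] /= h2; lra.
have := IH (t + step_cost x (y, None)) y a co.
have := metric_triangle a.2 x y; rewrite -(ler_pM2l L0) mulrDr.
have := mulr_ge0 (ltW L0) (mdist_ge0 x y); rewrite /step_cost/= => h1 h2 h3 h4.
by apply: h3 => //; lra.
Qed.

Variables (f : X -> R) (b0 : R).
Hypotheses (fL : forall x y, `|f x - f y| <= L * d x y) (fb : forall x, b0 <= f x).

Definition chain_value x s := f (chain_end x s) + chain_cost x s.

Definition chain_inf r x := inf [set chain_value x s | s in chain_ok r x].

Lemma chain_value_ge r x s : chain_ok r x s -> b0 <= chain_value x s.
Proof. by move=> co; rewrite /chain_value -[b0]addr0 lerD// (chain_cost_ge0 co). Qed.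

Lemma has_inf_chain r x : has_inf [set chain_value x s | s in chain_ok r x].
Proof.
split; first by exists (chain_value x [::]), [::].
by exists b0 => _ [s so <-]; exact: chain_value_ge so.
Qed.

Lemma chain_inf_le r x s : chain_ok r x s -> chain_inf r x <= chain_value x s.
Proof. by move=> so; apply: ge_inf; [exact: (has_inf_chain r x).2|exists s]. Qed.

Lemma chain_inf_le_fun r x : chain_inf r x <= f x.
Proof. by have := @chain_inf_le r x [::] I; rewrite /chain_value/= addr0. Qed.

Lemma chain_inf_step r x st : step_ok r x st ->
  chain_inf r x <= chain_inf r st.1 + step_cost x st.
Proof.
move=> so; rewrite -lerBlDr; apply: lb_le_inf.
  by have [] := has_inf_chain r st.1.
move=> _ [s sok <-]; rewrite lerBlDr.
have := @chain_inf_le r x (st :: s) (conj so sok).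
by rewrite /chain_value/= addrCA addrC.
Qed.

Lemma chain_inf_mono r r' x : r <= r' -> chain_inf r' x <= chain_inf r x.
Proof.
move=> rr'; apply: lb_le_inf; first by have [] := has_inf_chain r x.
move=> _ [s so <-]; apply: chain_inf_le.
elim: s x so => //= st s IH x [so co]; split; last exact: IH.
move: so; rewrite /step_ok; case: st.2 => // p [Cp xp py]; split => //.
  exact: lt_le_trans rr'.
exact: lt_le_trans rr'.
Qed.

Definition near_min r (eta : R) x s :=
  forall s', chain_ok r x s' -> chain_value x s <= chain_value x s' + eta.

Lemma near_min_tail r eta x st s : step_ok r x st ->
  near_min r eta x (st :: s) -> near_min r eta st.1 s.
Proof.
move=> so H s' co; have := H (st :: s') (conj so co).
by rewrite /chain_value/=; lra.
Qed.

(** Near-optimality against the chain that jumps directly from x to the point where the marked step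
    starts. *)
Lemma mark_reach_upper r eta t x s a : chain_ok r x s -> near_min r eta x s ->
  a \in marks t x s -> a.1 - t <= L * d x a.2 + L * r + eta.
Proof.
move=> co nm ain; have [u [s' [co' eu ec ua]]] := mark_split co ain.
have := nm ((u, None) :: s') (conj I co'); rewrite /chain_value/= eu ec /step_cost/=.
have := metric_triangle x a.2 u; rewrite -(ler_pM2l L0) mulrDr.
have : L * d a.2 u <= L * r by rewrite ler_pM2l// metric_sym ltW.
lra.
Qed.

(** The estimate of [mark_reach] between two marks; both ends now deviate from the chain by r, hence
    [2 * (m * r)]. *)
Lemma marks_lower r t x s a b m : 0 < r -> chain_ok r x s ->
  a \in marks t x s -> b \in marks t x s -> a.1 <= b.1 -> 0 <= m -> m <= L ->
  (forall v, v \in marks t x s -> a.1 <= v.1 <= b.1 -> m <= w v.2) ->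
  m * d a.2 b.2 <= b.1 - a.1 + 2 * (m * r).
Proof.
move=> r0 + + + ab m0 mL; elim: s t x => //= st s IH t x co0; have [so co] := co0.
case: st so co co0 => y [p|] /= so co co0; last exact: IH.
have [Cp xp py] := so.
have mxp : m * d x p <= m * r by rewrite ler_wpM2l// ltW.
have head_case c : c \in (t, p) :: marks (t + step_cost x (y, Some p)) y s ->
    (forall v, v \in (t, p) :: marks (t + step_cost x (y, Some p)) y s ->
      t <= v.1 <= c.1 -> m <= w v.2) ->
    m * d p c.2 <= c.1 - t + 2 * (m * r).
  move=> cin H; have := @mark_reach r t x ((y, Some p) :: s) c m co0 cin m0 mL.
  have := metric_triangle p x c.2; rewrite [d p x]metric_sym => tri.
  have := ler_wpM2l m0 tri; rewrite mulrDr => h1 h2.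
  have : m * d x c.2 <= c.1 - t + m * r.
    apply: h2 => v vin vc; apply: H => //; rewrite vc andbT.
    by have [] := @marks_time r t x ((y, Some p) :: s) v co0 vin.
  lra.
move=> ain bin H; have [ta _ _] := @marks_time r t x ((y, Some p) :: s) a co0 ain.
move: (ain) (bin); rewrite inE => /orP[/eqP aE _|ain'].
  by rewrite aE/= in H *; exact: head_case.
rewrite inE => /orP[/eqP bE|bin']; last first.
  by apply: IH co ain' bin' _ => v vin; apply: H; rewrite inE vin orbT.
(* Steps of zero cost can give several marks the same time. If b precedes a in the chain, the two
   times coincide and a and b exchange roles. *)
have at_ : a.1 = t by apply/eqP; rewrite eq_le ta andbT; move: ab; rewrite bE.
rewrite bE/= in H *; rewrite metric_sym at_; have := head_case a ain.
rewrite at_ subrr; apply => v vin vt; apply: H => //; rewrite at_.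
by [].
Qed.

(** Tails of a near-optimal chain are near-optimal, so the comparison with a direct jump applies
    from the first of the two marks on. *)
Lemma marks_upper r eta t x s a b : 0 < r -> 0 <= eta -> chain_ok r x s ->
  near_min r eta x s ->
  a \in marks t x s -> b \in marks t x s -> a.1 <= b.1 ->
  b.1 - a.1 <= L * d a.2 b.2 + 2 * (L * r) + eta.
Proof.
move=> r0 eta0 + + + + ab; elim: s t x => //= st s IH t x co0 nm; have [so co] := co0.
have nm' := near_min_tail so nm.
case: st so co co0 nm nm' => y [p|] /= so co co0 nm nm'; last exact: IH.
have [Cp xp py] := so.
have Lxp : L * d x p <= L * r by rewrite ler_pM2l// ltW.
have Lr : 0 < L * r by rewrite mulr_gt0.
have Ld : 0 <= L * d a.2 b.2 by rewrite mulr_ge0 ?mdist_ge0// ltW.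
move=> ain bin; have [ta _ _] := @marks_time r t x ((y, Some p) :: s) a co0 ain.
move: (ain) (bin); rewrite inE => /orP[/eqP aE _|ain'].
  have := @mark_reach_upper r eta t x ((y, Some p) :: s) b co0 nm bin.
  rewrite aE/=; have := metric_triangle x p b.2; rewrite -(ler_pM2l L0) mulrDr; lra.
rewrite inE => /orP[/eqP bE|bin']; last exact: (IH _ _ co nm' ain' bin').
have bt : b.1 = t by rewrite bE.
lra.
Qed.

Lemma seq_argmin (T : eqType) (phi : T -> R) (s : seq T) : s != [::] ->
  exists2 a, a \in s & forall b, b \in s -> phi a <= phi b.
Proof.
elim: s => // a s IH _; have [->|/IH[b bs bmin]] := eqVneq s [::].
  by exists a; rewrite ?inE// => b; rewrite inE => /eqP ->.
have [ab|ba] := leP (phi a) (phi b).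
  exists a; rewrite ?inE ?eqxx// => c; rewrite inE => /orP[/eqP -> //|/bmin].
  exact: le_trans.
by exists b; rewrite ?inE ?bs ?orbT// => c; rewrite inE => /orP[/eqP ->|/bmin//]; exact: ltW.
Qed.

End chains.

(** * Limits of near-optimal chains *)

Section chain_limit.
Context {R : realType} {dd : measure_display} {X : completeMetricMeasurableType R dd}.
Variables (L : R) (w : X -> R) (C : set X) (e0 : R).
Hypotheses (e00 : 0 < e0) (e0L : e0 <= L) (w_ge : forall p, C p -> e0 <= w p).
Variables (f : X -> R) (b0 : R) (g : X -> \bar R).
Hypotheses (fL : lipschitz_with L [set: X] f) (fb : forall x, b0 <= f x).
Hypotheses (fg : star_upper_gradient f g) (cC : compact C).
Hypothesis gL : forall p, C p -> (g p <= L%:E)%E.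
Hypothesis gw : forall p, C p -> exists2 r, 0 < r &
  forall q, C q -> mdist p q < r -> (g p <= (w q)%:E)%E.
Variables (x : X) (e : R).
Hypothesis e_gt0 : 0 < e.
Local Notation d := mdist.
Local Notation leb := (@lebesgue_measure R).

Let L0 : 0 < L. Proof. exact: lt_le_trans e0L. Qed.
Let fL' y z : `|f y - f z| <= L * d y z. Proof. exact: fL.2. Qed.
Let r_ (k : nat) : R := k.+1%:R^-1.
Let r0 k : 0 < r_ k. Proof. by rewrite /r_ invr_gt0. Qed.

Variable s_ : nat -> seq (X * option X).
Hypothesis s_ok : forall k, chain_ok C (r_ k) x (s_ k).
Hypothesis s_min : forall k, near_min L w C f (r_ k) (r_ k) x (s_ k).
Hypothesis s_lt : forall k, chain_value L w f x (s_ k) < f x - e.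

(** The starting point counts as a mark at time 0, although x need not belong to C. *)
Let S k := (0, x) :: marks L w 0 x (s_ k).

Let S_lower k a b m : a \in S k -> b \in S k -> a.1 <= b.1 -> 0 <= m -> m <= L ->
  (forall v, v \in marks L w 0 x (s_ k) -> a.1 <= v.1 <= b.1 -> m <= w v.2) ->
  m * d a.2 b.2 <= b.1 - a.1 + 2 * (m * r_ k).
Proof.
move=> ain bin ab m0 mL H; have mr : 0 <= m * r_ k by rewrite mulr_ge0// ltW.
have time v (vin : v \in marks L w 0 x (s_ k)) := marks_time e00 e0L w_ge (s_ok k) vin.
have reach v : v \in marks L w 0 x (s_ k) -> a.1 <= 0 -> v.1 <= b.1 ->
    m * d x v.2 <= v.1 - 0 + m * r_ k.
  move=> vin a0 vb; apply: (mark_reach e00 e0L w_ge (s_ok k) vin m0 mL) => v' v'in v'v.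
  apply: H => //; apply/andP; split; last exact: le_trans vb.
  by apply: (le_trans a0); have [] := time _ v'in.
move: (ain) (bin); rewrite /S !inE => /orP[/eqP aE|ain'] /orP[/eqP bE|bin'].
- by rewrite aE bE/= mdistxx mulr0; lra.
- by have := reach b bin'; rewrite aE/= => /(_ (lexx _) (lexx _)); lra.
- have a1 : a.1 = 0.
    by have [h _ _] := time _ ain'; apply/eqP; rewrite eq_le h andbT; move: ab; rewrite bE.
  have := reach a ain'; rewrite a1 bE/= lexx => /(_ isT isT).
  by rewrite metric_sym; lra.
- exact: (marks_lower e00 e0L w_ge (r0 k) (s_ok k) ain' bin' ab m0 mL H).
Qed.

Let S_upper k a b : a \in S k -> b \in S k -> a.1 <= b.1 ->
  b.1 - a.1 <= L * d a.2 b.2 + 2 * (L * r_ k) + r_ k.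
Proof.
move=> ain bin ab; have Lr : 0 <= L * r_ k by rewrite mulr_ge0// ltW.
have rk := r0 k; have Ld : 0 <= L * d a.2 b.2 by rewrite mulr_ge0 ?mdist_ge0// ltW.
have time v (vin : v \in marks L w 0 x (s_ k)) := marks_time e00 e0L w_ge (s_ok k) vin.
move: (ain) (bin); rewrite /S !inE => /orP[/eqP aE|ain'] /orP[/eqP bE|bin'].
- have ba : b.1 = a.1 by rewrite aE bE.
  lra.
- have := mark_reach_upper e00 e0L (s_ok k) (@s_min k) bin'.
  by rewrite aE/=; lra.
- have [h _ _] := time _ ain'; have b1 : b.1 = 0 by rewrite bE.
  lra.
- by have := marks_upper e00 e0L w_ge (r0 k) (ltW (r0 k)) (s_ok k) (@s_min k) ain' bin' ab.
Qed.

Variable U : set_system nat.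
Hypotheses (UU : UltraFilter U) (Uoo : \oo `<=` U).

Let PU : ProperFilter U. Proof. exact: ultra_proper. Qed.
#[local] Existing Instance PU.

(* The limits of the marks along U form the graph of a curve fragment. *)
Let LimS t z := forall e', 0 < e' ->
  U [set k | exists b, [/\ b \in S k, `|b.1 - t| < e' & d b.2 z < e']].

Let U_r e' : 0 < e' -> U [set k | r_ k < e'].
Proof. by move=> e'0; apply: Uoo; exact: (near_infty_natSinv_lt (PosNum e'0)). Qed.

Let S_time k b : b \in S k -> 0 <= b.1 <= f x - e - b0.
Proof.
have c0 := chain_cost_ge0 e00 e0L w_ge (s_ok k).
have := s_lt k; rewrite /chain_value => h; have := fb (chain_end x (s_ k)) => h'.
rewrite inE => /orP[/eqP ->/=|bin]; first by apply/andP; split; lra.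
by have [] := marks_time e00 e0L w_ge (s_ok k) bin; rewrite add0r => h1 h2 _; apply/andP; split;
  lra.
Qed.

(** True marks lie in the compact product of a bounded time interval and C, so every selection of
    marks converges along U. Otherwise the selection is the starting mark for U-almost every k. *)
Let sel_lim (sg : nat -> R * X) : U [set k | sg k \in S k] ->
  exists t z, [/\ 0 <= t, C z \/ t = 0 /\ z = x &
    forall e', 0 < e' -> U [set k | `|(sg k).1 - t| < e' /\ d (sg k).2 z < e']].
Proof.
move=> sgS; pose T := f x - e - b0.
have [M|nM] := in_ultra_setVsetC [set k | sg k \in marks L w 0 x (s_ k)] UU; last first.
  exists 0, x; split; [by []|by right|move=> e' e'0].
  apply: filterS (filterI sgS nM) => k [/=]; rewrite inE => /orP[/eqP -> _|->//].
  by rewrite /= subrr normr0 mdistxx.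
have FA : U [set k | (`[0, T]%classic `*` C) (sg k)].
  apply: filterS (filterI sgS M) => k [/S_time kT kM]; split => /=; first by rewrite in_itv/=;
    exact: kT.
  by have [] := marks_time e00 e0L w_ge (s_ok k) kM.
have [[t z] [[/= tT Cz] cl]] := compact_setX (@segment_compact R 0 T) cC (fmap_proper_filter sg
  PU) FA.
exists t, z; split; [by move: tT; rewrite in_itv/= => /andP[]|by left|move=> e' e'0].
have [//|H] := in_ultra_setVsetC [set k | `|(sg k).1 - t| < e' /\ d (sg k).2 z < e'] UU.
pose B := [set p : R * X | `|p.1 - t| < e' /\ d p.2 z < e'].
have nB : nbhs (t, z) B.
  exists (ball t e', ball z e'); first by split; exact: nbhsx_ballx.
  move=> [p q] [/= tp zq]; split => /=; first by rewrite distrC.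
  by move: zq; rewrite ballEmdist/= metric_sym.
by have [p [pB /pB]] := cl (~` B) B H nB.
Qed.

Let LimS_sel (sg : nat -> R * X) t z : U [set k | sg k \in S k] ->
  (forall e', 0 < e' -> U [set k | `|(sg k).1 - t| < e' /\ d (sg k).2 z < e']) ->
  LimS t z.
Proof.
move=> sgS H e' e'0; apply: filterS (filterI sgS (H e' e'0)) => k [kS [k1 k2]].
by exists (sg k).
Qed.

(** The time window is widened by eta because the approximating marks may fall slightly outside the
    interval between t and t'. *)
Let LimS_lower t z t' z' m eta : LimS t z -> LimS t' z' -> 0 <= m -> m <= L -> 0 < eta ->
  U [set k | forall v, v \in marks L w 0 x (s_ k) ->
    Num.min t t' - eta <= v.1 <= Num.max t t' + eta -> m <= w v.2] ->
  m * d z z' <= `|t - t'|.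
Proof.
move=> tz tz' m0 mL eta0 H; apply/ler_addgt0Pr => eps eps0.
(* Two errors [L * dl] in space, [2 * L * dl] from the radius of the balls and [2 * dl] in time. *)
pose A := 4 * L + 2; have A0 : 0 < A by rewrite /A; have := L0; lra.
pose dl := Num.min eta (eps / A).
have dl0 : 0 < dl by rewrite lt_min eta0 divr_gt0.
have dle : dl <= eta by rewrite ge_min lexx.
have dlA : A * dl <= eps by rewrite mulrC -ler_pdivlMr// ge_min lexx orbT.
have [k [[[[a [aS a1 a2]] [b [bS b1 b2]]] Hk] rk]] :=
  filter_ex (filterI (filterI (filterI (tz _ dl0) (tz' _ dl0)) H) (U_r dl0)).
have E : m * d a.2 b.2 <= `|a.1 - b.1| + 2 * (m * r_ k).
  have [ab|/ltW ba] := leP a.1 b.1.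
    rewrite distrC ger0_norm ?subr_ge0//; apply: S_lower => // v vin /andP[v1 v2].
    by apply: Hk => //; rewrite minEle maxEle; case: ifP => tt'; apply/andP; split; move: a1 b1;
      rewrite !ltr_norml => /andP[? ?] /andP[? ?]; lra.
  rewrite metric_sym ger0_norm ?subr_ge0//; apply: S_lower => // v vin /andP[v1 v2].
  by apply: Hk => //; rewrite minEle maxEle; case: ifP => tt'; apply/andP; split; move: a1 b1;
    rewrite !ltr_norml => /andP[? ?] /andP[? ?]; lra.
have tri : m * d z z' <= m * d a.2 z + m * d a.2 b.2 + m * d b.2 z'.
  rewrite -!mulrDr ler_wpM2l//; apply: (le_trans (metric_triangle z a.2 z')).
  by rewrite [d z _]metric_sym -addrA lerD2l metric_triangle.
have h1 : m * d a.2 z <= L * dl by apply: ler_pM => //; [exact: mdist_ge0|exact: ltW].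
have h2 : m * d b.2 z' <= L * dl by apply: ler_pM => //; [exact: mdist_ge0|exact: ltW].
have h3 : m * r_ k <= L * dl by apply: ler_pM => //; exact: ltW.
have h4 : `|a.1 - b.1| <= `|t - t'| + 2 * dl.
  have -> : a.1 - b.1 = (t - t') + ((a.1 - t) - (b.1 - t')) by ring.
  apply: (le_trans (ler_normD _ _)); rewrite lerD2l.
  by apply: (le_trans (ler_normB _ _)); move: a1 b1; move: (`|_|) (`|_|) => ? ?; lra.
move: dlA; rewrite /A => dlA; lra.
Qed.

Let LimS_upper t z t' z' : LimS t z -> LimS t' z' -> `|t - t'| <= L * d z z'.
Proof.
move=> tz tz'; apply/ler_addgt0Pr => eps eps0.
(* The same errors as in the lower estimate, plus one dl for the near-minimality defect [r_ k]. *)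
pose A := 4 * L + 3; have A0 : 0 < A by rewrite /A; have := L0; lra.
pose dl := eps / A; have dl0 : 0 < dl by rewrite divr_gt0.
have dlA : A * dl <= eps by rewrite /dl mulrC divfK// gt_eqF.
have [k [[[a [aS a1 a2]] [b [bS b1 b2]]] rk]] :=
  filter_ex (filterI (filterI (tz _ dl0) (tz' _ dl0)) (U_r dl0)).
have E : `|a.1 - b.1| <= L * d a.2 b.2 + 2 * (L * r_ k) + r_ k.
  have [ab|/ltW ba] := leP a.1 b.1; first by rewrite distrC ger0_norm ?subr_ge0//; exact: S_upper.
  by rewrite ger0_norm ?subr_ge0// metric_sym; exact: S_upper.
have tri : L * d a.2 b.2 <= L * d a.2 z + L * d z z' + L * d b.2 z'.
  rewrite -!mulrDr ler_pM2l//; apply: (le_trans (metric_triangle a.2 z b.2)).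
  by rewrite [d b.2 _]metric_sym -addrA lerD2l metric_triangle.
have h1 : L * d a.2 z <= L * dl by rewrite ler_pM2l// ltW.
have h2 : L * d b.2 z' <= L * dl by rewrite ler_pM2l// ltW.
have h3 : L * r_ k <= L * dl by rewrite ler_pM2l// ltW.
have h4 : `|t - t'| <= `|a.1 - b.1| + 2 * dl.
  have -> : t - t' = (a.1 - b.1) - ((a.1 - t) - (b.1 - t')) by ring.
  apply: (le_trans (ler_normB _ _)); rewrite lerD2l.
  by apply: (le_trans (ler_normB _ _)); move: a1 b1; move: (`|_|) (`|_|) => ? ?; lra.
have rk' : r_ k < dl by [].
move: dlA; rewrite /A => dlA; lra.
Qed.

(** With the floor e0 on the weights this holds at every scale: the limit is single-valued and
    Lipschitz in the time variable. *)
Let LimS_bound t z t' z' : LimS t z -> LimS t' z' -> e0 * d z z' <= `|t - t'|.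
Proof.
move=> tz tz'; apply: (LimS_lower tz tz' (ltW e00) e0L ltr01).
apply: filterE => k v vin _; apply: w_ge.
by have [] := marks_time e00 e0L w_ge (s_ok k) vin.
Qed.

Let LimS_uniq t z z' : LimS t z -> LimS t z' -> z = z'.
Proof.
move=> tz tz'; have := LimS_bound tz tz'; rewrite subrr normr0 pmulr_rle0// => h.
by apply/eqP; apply: contraTT h => zz'; rewrite -ltNge mdist_gt0.
Qed.

Let T_ t := forall e', 0 < e' -> U [set k | exists2 b, b \in S k & `|b.1 - t| < e'].

Let LimS_T t z : LimS t z -> T_ t.
Proof. by move=> tz e' /tz; apply: filterS => k [b [bS b1 _]]; exists b. Qed.

(** For each k, the mark closest in time to t is selected; its limit has time exactly t. *)
Let T_LimS t : T_ t -> exists2 z, LimS t z & 0 < t -> C z.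
Proof.
move=> tT.
have argmin k : {a | a \in S k /\ forall b, b \in S k -> `|a.1 - t| <= `|b.1 - t|}.
  apply: cid; have [a aS amin] := @seq_argmin R (R * X)%type (fun b => `|b.1 - t|) (S k) isT.
  by exists a.
pose sg k := sval (argmin k).
have sgS k : sg k \in S k by rewrite /sg; case: (argmin k) => ? [].
have sgmin k b : b \in S k -> `|(sg k).1 - t| <= `|b.1 - t|.
  exact: (svalP (argmin k)).2.
have UsgS : U [set k | sg k \in S k] by exact: filterE.
have [t' [z [t'0 Cz zlim]]] := sel_lim UsgS.
have tt' : t' = t.
  apply/eqP; rewrite -subr_eq0 -normr_le0; apply/ler_addgt0Pr => eps eps0; rewrite add0r.
  have e2 : 0 < eps / 2 by rewrite divr_gt0.
  have [k [[b bS bt] [kt _]]] := filter_ex (filterI (tT _ e2) (zlim _ e2)).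
  have := sgmin k b bS; rewrite distrC in kt.
  have -> : t' - t = (t' - (sg k).1) + ((sg k).1 - t) by ring.
  move=> h; apply: (le_trans (ler_normD _ _)); move: bt kt h;
    move: (`|_|) (`|_|) (`|_|) => ? ? ?; lra.
exists z; first by apply: (LimS_sel UsgS); rewrite -tt'.
by move=> tp; case: Cz => // -[t'0' _]; move: tp; rewrite -tt' t'0' ltxx.
Qed.

Let T0 : LimS 0 x.
Proof.
move=> e' e'0; apply: filterE => k; exists (0, x); rewrite /= subrr normr0 mdistxx.
by rewrite /S inE eqxx.
Qed.

(** The last marks converge. What a chain spends after its last mark dominates the change of f from
    there to its end, so the strict drop of the chain values survives in the limit. *)
Let T_last : exists t z, [/\ 0 <= t, LimS t z & f z + t <= f x - e].
Proof.
have last k : {b | b \in S k /\ f b.2 + b.1 <= f x - e + L * r_ k}.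
  apply: cid; have [|b bS bP] := @mark_last R X L w C e0 e00 e0L w_ge (r_ k) 0 x (s_ k) (0,
    x) (s_ok k).
    by rewrite /= mdistxx mulr0 subrr add0r mulr_ge0// ltW.
  exists b; split => //; have := fL' b.2 (chain_end x (s_ k)); rewrite ler_norml => /andP[_ h].
  by have := s_lt k; rewrite /chain_value; lra.
pose sg k := sval (last k).
have sgS k : sg k \in S k by rewrite /sg; case: (last k) => ? [].
have sgP k : f (sg k).2 + (sg k).1 <= f x - e + L * r_ k.
  by rewrite /sg; case: (last k) => ? [].
have UsgS : U [set k | sg k \in S k] by exact: filterE.
have [t [z [t0 _ zlim]]] := sel_lim UsgS.
exists t, z; split => //; first exact: (LimS_sel UsgS).
apply/ler_addgt0Pr => eps eps0.
pose A := 2 * L + 1; have A0 : 0 < A by rewrite /A; have := L0; lra.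
pose dl := eps / A; have dl0 : 0 < dl by rewrite divr_gt0.
have dlA : A * dl <= eps by rewrite /dl mulrC divfK// gt_eqF.
have [k [[k1 k2] rk]] := filter_ex (filterI (zlim _ dl0) (U_r dl0)).
have h1 : L * d (sg k).2 z <= L * dl by rewrite ler_pM2l// ltW.
have h3 : L * r_ k <= L * dl by rewrite ler_pM2l// ltW.
have := sgP k; have := fL' (sg k).2 z; rewrite ler_norml => /andP[h2 _].
move: k1; rewrite ltr_norml => /andP[h4 _].
move: dlA; rewrite /A => dlA; lra.
Qed.

(** The floor e0 on the cost per unit length turns closeness in time into closeness in space, up to
    [2 * r_ k]. *)
Let near_marks t z rho : LimS t z -> 0 < rho -> exists2 eta, 0 < eta &
  U [set k | forall v, v \in marks L w 0 x (s_ k) -> `|v.1 - t| < eta -> d z v.2 < rho].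
Proof.
move=> tz rho0; pose A := 1 + 4 / e0; have A0 : 0 < A by rewrite /A ltr_wpDr// ltW// divr_gt0.
pose eta := Num.min (rho / 4) (e0 * rho / 8).
have eta0 : 0 < eta by rewrite lt_min !divr_gt0// mulr_gt0.
have etae : e0 * (rho / 4) >= 2 * eta.
  have : eta <= e0 * rho / 8 by rewrite ge_min lexx orbT.
  by rewrite mulrA; move: (e0 * rho) => ? ?; lra.
have etar : eta <= rho / 4 by rewrite ge_min lexx.
have rho4 : 0 < rho / 8 by rewrite divr_gt0.
exists eta => //; apply: filterS (filterI (tz _ eta0) (U_r rho4)) => k [[b [bS b1 b2]] rk] v vin vt.
have vS : v \in S k by rewrite /S inE vin orbT.
have w_ v' : v' \in marks L w 0 x (s_ k) -> e0 <= w v'.2.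
  by move=> v'in; apply: w_ge; have [] := marks_time e00 e0L w_ge (s_ok k) v'in.
have E : e0 * d b.2 v.2 <= `|b.1 - v.1| + 2 * (e0 * r_ k).
  have [bv|/ltW vb] := leP b.1 v.1.
    by rewrite distrC ger0_norm ?subr_ge0//; apply: S_lower => //; [exact: ltW|move=> ? /w_].
  rewrite metric_sym ger0_norm ?subr_ge0//.
  by apply: S_lower => //; [exact: ltW|move=> ? /w_].
have bv : `|b.1 - v.1| < 2 * eta.
  have -> : b.1 - v.1 = (b.1 - t) - (v.1 - t) by ring.
  by apply: (le_lt_trans (ler_normB _ _)); move: b1 vt; move: (`|_|) (`|_|) => ? ?; lra.
have h3 : e0 * r_ k <= e0 * (rho / 8) by rewrite ler_pM2l// ltW.
have : e0 * d b.2 v.2 < e0 * (rho / 2).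
  apply: (le_lt_trans E).
  have -> : rho / 2 = rho / 4 + 2 * (rho / 8) by field.
  by move: etae bv h3; rewrite mulrDr; move: (`|_|) (e0 * r_ k) (e0 * (rho / 4)) => ? ? ? ;
    rewrite [e0 * (2 * _)]mulrCA; move: (e0 * (rho/8)) => ?; lra.
rewrite ltr_pM2l// => h; have := metric_triangle z b.2 v.2.
by have := lt_le_trans b2 etar; rewrite [d b.2 z]metric_sym; lra.
Qed.

(** Consecutive marks around the middle time are selected for each k. Their limit times lie between
    p1 and p2, on either side of the middle, and so must be p1 and p2 themselves. *)
Let T_jump p1 p2 z1 z2 : LimS p1 z1 -> LimS p2 z2 -> 0 <= p1 -> p1 < p2 ->
  (forall t, p1 < t < p2 -> ~ T_ t) -> L * d z1 z2 <= p2 - p1.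
Proof.
move=> L1 L2 p10 p12 noT; pose mid := (p1 + p2) / 2.
have hg : 0 < (p2 - p1) / 2 by rewrite divr_gt0// subr_gt0.
have jump k : {a | (exists2 b, b \in S k & `|b.1 - p2| < (p2 - p1) / 2) ->
    [/\ a.1 \in S k, a.2 \in S k, a.1.1 <= mid < a.2.1,
      L * d a.1.2 a.2.2 <= a.2.1 - a.1.1 + 2 * (L * r_ k)
    & forall b, b \in S k -> b.1 <= a.1.1 \/ a.2.1 <= b.1]}.
  apply: cid.
  have [[b bS bp]|] := pselect (exists2 b, b \in S k & `|b.1 - p2| < (p2 - p1) / 2); last first.
    by exists ((0, x), (0, x)).
  have mb : mid < b.1.
    by move: bp; rewrite ltr_norml => /andP[h _]; rewrite /mid; lra.
  have [||||] := @jump_gap R X L w C e0 e00 e0L w_ge (r_ k) 0 x (s_ k) (0, x) mid (s_ok k).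
  - by rewrite /= mdistxx mulr0 subrr add0r mulr_ge0// ltW.
  - by [].
  - by rewrite /mid/= divr_ge0// addr_ge0// ltW// (le_lt_trans p10).
  - exists b => //; move: bS; rewrite /S inE => /orP[/eqP bE|//].
    by move: mb; rewrite bE/= ltNge /mid divr_ge0// addr_ge0// ltW// (le_lt_trans p10).
  move=> a1 [a2 [i1 i2 a12 La aP]]; exists (a1, a2) => _; split => //.
  by rewrite /S inE i2 orbT.
pose s1 k := (sval (jump k)).1; pose s2 k := (sval (jump k)).2.
have near2 := LimS_T L2 hg.
have sP : U [set k | [/\ s1 k \in S k, s2 k \in S k, (s1 k).1 <= mid < (s2 k).1,
      L * d (s1 k).2 (s2 k).2 <= (s2 k).1 - (s1 k).1 + 2 * (L * r_ k)
    & forall b, b \in S k -> b.1 <= (s1 k).1 \/ (s2 k).1 <= b.1]].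
  by apply: filterS near2 => k kP; exact: (svalP (jump k) kP).
have s1S : U [set k | s1 k \in S k] by apply: filterS sP => k [].
have s2S : U [set k | s2 k \in S k] by apply: filterS sP => k [].
have [t1 [y1 [_ _ l1]]] := sel_lim s1S; have [t2 [y2 [_ _ l2]]] := sel_lim s2S.
have L1' := LimS_sel s1S l1; have L2' := LimS_sel s2S l2.
have mid1 : t1 <= mid.
  apply/ler_addgt0Pr => eps eps0;
    have [k [[_ _ /andP[h _] _ _] [k1 _]]] := filter_ex (filterI sP (l1 _ eps0)).
  by move: k1; rewrite ltr_norml => /andP[? ?]; lra.
have mid2 : mid <= t2.
  apply/ler_addgt0Pr => eps eps0;
    have [k [[_ _ /andP[_ h] _ _] [k1 _]]] := filter_ex (filterI sP (l2 _ eps0)).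
  by move: k1; rewrite ltr_norml => /andP[? ?]; lra.
(* A mark close to p1 lies before the middle and not strictly between the two selected marks, hence
   not after the first of them. *)
have pt1 : p1 <= t1.
  apply/ler_addgt0Pr => eps eps0; pose et := Num.min (eps / 2) ((p2 - p1) / 2).
  have et0 : 0 < et by rewrite lt_min hg divr_gt0.
  have et1 : et <= eps / 2 by rewrite ge_min lexx.
  have et2 : et <= (p2 - p1) / 2 by rewrite ge_min lexx orbT.
  have [k [[[_ _ /andP[_ h2] _ H] [k1 _]] [b bS b1]]] :=
    filter_ex (filterI (filterI sP (l1 _ et0)) (LimS_T L1 et0)).
  move: k1 b1; rewrite !ltr_norml => /andP[? ?] /andP[? ?].
  by case: (H b bS) => h; move: h2; rewrite /mid => h2; lra.
have pt2 : t2 <= p2.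
  apply/ler_addgt0Pr => eps eps0; pose et := Num.min (eps / 2) ((p2 - p1) / 2).
  have et0 : 0 < et by rewrite lt_min hg divr_gt0.
  have et1 : et <= eps / 2 by rewrite ge_min lexx.
  have et2 : et <= (p2 - p1) / 2 by rewrite ge_min lexx orbT.
  have [k [[[_ _ /andP[h2 _] _ H] [k1 _]] [b bS b1]]] :=
    filter_ex (filterI (filterI sP (l2 _ et0)) (LimS_T L2 et0)).
  move: k1 b1; rewrite !ltr_norml => /andP[? ?] /andP[? ?].
  by case: (H b bS) => h; move: h2; rewrite /mid => h2; lra.
have t1E : t1 = p1.
  apply/eqP; rewrite eq_le pt1 andbT leNgt; apply/negP => h.
  by apply: (noT t1); [rewrite h/=; move: mid1; rewrite /mid; lra|exact: LimS_T L1'].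
have t2E : t2 = p2.
  apply/eqP; rewrite eq_le pt2/= leNgt; apply/negP => h.
  by apply: (noT t2); [rewrite h andbT; move: mid2; rewrite /mid; lra|exact: LimS_T L2'].
rewrite t1E in L1' l1; rewrite t2E in L2' l2.
rewrite (LimS_uniq L1 L1') (LimS_uniq L2 L2'); apply/ler_addgt0Pr => eps eps0.
pose A := 4 * L + 2; have A0 : 0 < A by rewrite /A; have := L0; lra.
pose dl := eps / A; have dl0 : 0 < dl by rewrite divr_gt0.
have dlA : A * dl <= eps by rewrite /dl mulrC divfK// gt_eqF.
have [k [[[[_ _ _ E _] [k1 k1']] [k2 k2']] rk]] :=
  filter_ex (filterI (filterI (filterI sP (l1 _ dl0)) (l2 _ dl0)) (U_r dl0)).
have tri : L * d y1 y2 <= L * d (s1 k).2 y1 + L * d (s1 k).2 (s2 k).2 + L * d (s2 k).2 y2.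
  rewrite -!mulrDr ler_pM2l//; apply: (le_trans (metric_triangle y1 (s1 k).2 y2)).
  by rewrite [d y1 _]metric_sym -addrA lerD2l metric_triangle.
have h1 : L * d (s1 k).2 y1 <= L * dl by rewrite ler_pM2l// ltW.
have h2 : L * d (s2 k).2 y2 <= L * dl by rewrite ler_pM2l// ltW.
have h3 : L * r_ k <= L * dl by rewrite ler_pM2l// ltW.
move: k1 k2; rewrite !ltr_norml => /andP[? ?] /andP[? ?].
move: dlA; rewrite /A => dlA; lra.
Qed.

Let aeS := (@filterS _ _ (ae_filter_ringOfSetsType leb)).

(** Marks near z in time have centres q near z, where [w q] is at least [g z]. The lower estimate
    with m = [g z] then says that g times the speed is at most 1. *)
Let slow t z : LimS t z -> C z -> exists2 r, 0 < r & forall s y, LimS s y -> `|s - t| < r ->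
  fine (g z) * d y z <= `|s - t|.
Proof.
move=> tz Cz; have [rho rho0 rhoP] := gw Cz.
have [eta eta0 H] := near_marks tz rho0; have g0 : (0 <= g z)%E := fg.1.2 z.
have gz : (fine (g z))%:E = g z.
  by rewrite fineK// ge0_fin_numE// (le_lt_trans (gL Cz))// ltry.
have eta2 : 0 < eta / 2 by rewrite divr_gt0.
exists (eta / 2) => // s y sy st.
apply: (LimS_lower sy tz _ _ eta2).
- exact: fine_ge0.
- by rewrite -lee_fin gz; exact: gL.
apply: filterS H => k H v vin /andP[v1 v2]; have Cv : C v.2.
  by have [] := marks_time e00 e0L w_ge (s_ok k) vin.
rewrite -lee_fin gz; apply: rhoP => //; apply: H => //.
move: v1 v2 st; rewrite minEle maxEle !ltr_norml.
by case: ifP => _ h1 h2 /andP[? ?]; apply/andP; split; lra.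
Qed.

Lemma chain_limit_absurd : False.
Proof.
have [b [zb [b_ge0 Lb fzb]]] := T_last.
(* The times are cut at b, the limit time of the last marks; limits of times of marks are again such
   limits, so D is closed. *)
pose D : set R := T_ `&` `[0, b]%classic.
have cD : compact D.
  rewrite /D setIC; apply: compact_closedI; first exact: segment_compact.
  move=> t clt e' e'0; have e2 : 0 < e' / 2 by rewrite divr_gt0.
  have [t' [/(_ _ e2) + tt']] := clt (ball t (e' / 2)) (nbhsx_ballx _ _ e2).
  apply: filterS => k [v vS vt]; exists v => //.
  have -> : v.1 - t = (v.1 - t') - (t - t') by ring.
  apply: (le_lt_trans (ler_normB _ _)); move: tt' vt; rewrite /ball/=.
  by move: (`|_|) (`|_|) => ? ?; lra.
have D0 : D 0 by split; [exact: LimS_T T0|rewrite /= in_itv/= lexx].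
have Db : D b by split; [exact: LimS_T Lb|rewrite /= in_itv/= lexx b_ge0].
have Dne : D !=set0 by exists 0.
have exgam t : exists z, T_ t -> LimS t z /\ (0 < t -> C z).
  have [/T_LimS[z ? ?]|nT] := pselect (T_ t); first by exists z.
  by exists x.
have [gam gamP] := choice exgam.
have gamL t : D t -> LimS t (gam t) by move=> [/gamP[]].
pose K := L + e0^-1; have e0V : 0 < e0^-1 by rewrite invr_gt0.
have K0 : 0 < K by rewrite addr_gt0.
have bilip : exists2 L : R, 0 < L & forall s t, D s -> D t ->
    L^-1 * `|s - t| <= d (gam s) (gam t) <= L * `|s - t|.
  exists K => // s t Ds Dt; apply/andP; split.
    rewrite ler_pdivrMl//; apply: (le_trans (LimS_upper (gamL _ Ds) (gamL _ Dt))).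
    by rewrite ler_wpM2r ?mdist_ge0// lerDl ltW.
  have := LimS_bound (gamL _ Ds) (gamL _ Dt); rewrite -ler_pdivlMl// => /le_trans; apply.
  by rewrite ler_wpM2r// lerDr ltW.
pose c := Fragment Dne cD bilip.
have infD : inf D = 0.
  have [_ h] := compact_infP Dne cD; have [Di _] := compact_infP Dne cD.
  by apply/eqP; rewrite eq_le h//=; case: Di => _; rewrite /= in_itv/= => /andP[].
have supD : sup D = b.
  have [Ds h] := compact_supP Dne cD.
  by apply/eqP; rewrite eq_le h// andbT; case: Ds => _; rewrite /= in_itv/= => /andP[].
have mD : measurable (D : set R) by exact: compact_measurable.
(* Each gap is a limit of expensive jumps, so L times its size is at most its length in time. *)
have gapE : (L%:E * gap c <= leb (`[0%R, b]%classic `\` D))%E.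
  have : (gap c <= L^-1%:E * leb (`[0%R, b]%classic `\` D))%E.
    rewrite -infD -supD -esum_gaps_length// ?invr_ge0 ?(ltW L0)//.
    apply: le_esum => p /(gapsP _ Dne cD)[D1 D2 p12 noD].
    rewrite lee_fin ler_pdivlMl//=.
    have /andP[p10 _] : 0 <= p.1 <= b by case: D1 => _; rewrite /= in_itv.
    have /andP[_ p2b] : 0 <= p.2 <= b by case: D2 => _; rewrite /= in_itv.
    apply: (T_jump (gamL _ D1) (gamL _ D2) p10 p12) => t tp tT; apply: (noD t tp).
    split=> //; rewrite /= in_itv/=; move: tp => /andP[? ?]; apply/andP; split; lra.
  move=> h; have := lee_wpmul2l _ h; move=> /(_ L%:E); rewrite lee_fin (ltW L0) => /(_ isT).
  by rewrite muleA -EFinM divff ?mul1e// gt_eqF.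
have intE : (frag_integral c g <= leb D)%E.
  have [m cm] := ex_speed c; have [mm m0 _ mspeed] := cm.
  rewrite (frag_integralE _ cm) -[leb D]mul1e -integral_cst//.
  apply: ae_le_integral_any => //; first by move=> t; rewrite mule_ge0 ?lee_fin//; exact: fg.1.2.
  (* Time 0 is discarded because [gam 0] is x, which may lie outside C. *)
  have ne0 : {ae leb, forall t : R, t != 0}.
    exists [set 0 : R]; split; [exact: measurable_set1|exact: lebesgue_measure_set1|].
    by move=> t /negP; rewrite negbK => /eqP.
  apply: aeS (ae_and mspeed (ae_and ne0 (ae_right_accumulation mD))) => t [sp [t0 acc]] Dt.
  have tp : 0 < t by rewrite lt_neqAle eq_sym t0/=; case: Dt => _; rewrite /= in_itv/= => /andP[].
  have Ct : C (gam t) by case: Dt => /gamP[_ h] _; exact: h.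
  have [r r_gt0 rP] := slow (gamL _ Dt) Ct; set M := fine _ in rP.
  have M0 : 0 <= M by exact: fine_ge0 (fg.1.2 _).
  have gM : g (gam t) = M%:E.
    by rewrite fineK// ge0_fin_numE ?fg.1.2// (le_lt_trans (gL Ct))// ltry.
  rewrite /= gM -EFinM lee_fin; apply/ler_addgt0Pr => eps eps0.
  have M1 : 0 < M + 1 by rewrite ltr_wpDl.
  have em : 0 < eps / (M + 1) by rewrite divr_gt0.
  have [dl dl0 dlP] := sp Dt _ em.
  have rd0 : 0 < Num.min r dl by rewrite lt_min r_gt0.
  have [s Ds /andP[ts std]] := acc Dt _ rd0.
  have std1 : s - t < r by rewrite ltrBlDl (lt_le_trans std)// lerD2l ge_min lexx.
  have std2 : s - t < dl by rewrite ltrBlDl (lt_le_trans std)// lerD2l ge_min lexx orbT.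
  have st0 : 0 < s - t by rewrite subr_gt0.
  have := rP s _ (gamL _ Ds); rewrite (gtr0_norm st0) => /(_ std1) h1.
  have := dlP s Ds; rewrite (gtr0_norm st0) => /(_ std2); rewrite ler_norml => /andP[h2 _].
  rewrite -(ler_pM2r st0).
  have h3 : M * (m t * (s - t)) <= M * (d (gam s) (gam t) + eps / (M + 1) * (s - t)).
    by rewrite ler_wpM2l//; move: h2; rewrite /=; lra.
  have h4 : M * (eps / (M + 1)) <= eps.
    by rewrite mulrCA ger_pMr// ler_pdivrMr// mul1r lerDl.
  have h5 : M * (eps / (M + 1)) * (s - t) <= eps * (s - t) by rewrite ler_pM2r.
  by rewrite -mulrA (le_trans h3)// mulrDr mulrDl mul1r lerD// mulrA.
have LipL : (LIP setT f <= L%:E)%E by apply: ereal_inf_lbound; exists L.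
have gam0 : gam 0 = x by exact: LimS_uniq (gamL _ D0) T0.
have gamb : gam b = zb by exact: LimS_uniq (gamL _ Db) Lb.
have gap0 : (0 <= gap c)%E by apply: esum_ge0 => p _; rewrite lee_fin mdist_ge0.
have : ((b + e)%:E <= osc c f)%E.
  apply: (@le_trans _ _ `|f x - f zb|%:E); first by rewrite lee_fin ler_normr; apply/orP; left; lra.
  by apply: ereal_sup_ubound; exists x; [exists 0|exists zb => //; exists b].
(* The integral and the gap term together are at most the length b of the whole interval, while f
   drops by at least [b + e] along c. *)
apply/negP; rewrite -ltNge; apply: (le_lt_trans (fg.2 c)).
apply: (@le_lt_trans _ _ (leb D + leb (`[0%R, b]%classic `\` D))%E).
  by apply: leeD => //; apply: (le_trans _ gapE); exact: lee_wpmul2r.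
rewrite -measureU//; last 2 first.
- by apply: measurableD.
- by rewrite setDE setICA setICr setI0.
have -> : D `|` (`[0%R, b]%classic `\` D) = `[0, b]%classic by rewrite setDUK// => t [].
have h := @leb_itv R 0 b true false b_ge0; rewrite subr0 in h.
apply: (@le_lt_trans _ _ b%:E); [by rewrite -h|by rewrite lte_fin ltrDl].
Qed.

End chain_limit.

(** * Convergence of the chain functions and their truncation *)

Section chain_approx.
Context {R : realType} {dd : measure_display} {X : completeMetricMeasurableType R dd}.
Variables (L : R) (w : X -> R) (C : set X) (e0 : R).
Hypotheses (e00 : 0 < e0) (e0L : e0 <= L) (w_ge : forall p, C p -> e0 <= w p).
Variables (g : X -> \bar R).
Hypotheses (cC : compact C) (gL : forall p, C p -> (g p <= L%:E)%E).
Hypothesis gw : forall p, C p -> exists2 r, 0 < r &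
  forall q, C q -> mdist p q < r -> (g p <= (w q)%:E)%E.
Implicit Types (f : X -> R) (x y z p : X).
Local Notation d := mdist.

(** The infimum is monotone in the radius, so a failure for arbitrarily large k is a failure for
    every k. It provides the near-optimal chains that [chain_limit_absurd] excludes. *)
Lemma chain_approx f (b0 : R) x (e : R) : lipschitz_with L [set: X] f ->
  (forall x, b0 <= f x) -> star_upper_gradient f g -> 0 < e ->
  exists N, forall k, (N <= k)%N -> f x - e <= chain_inf L w C f k.+1%:R^-1 x.
Proof.
move=> fL fb fg e_gt0; apply: contrapT => nex.
have lt_fx k : chain_inf L w C f k.+1%:R^-1 x < f x - e.
  rewrite ltNge; apply/negP => h; apply: nex; exists k => k' kk'.
  apply: (le_trans h); apply: (chain_inf_mono e00 e0L w_ge fb).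
  by rewrite lef_pV2 ?posrE// ler_nat.
have pick k : exists s, [/\ chain_ok C k.+1%:R^-1 x s,
    chain_value L w f x s < f x - e & chain_value L w f x s < chain_inf L w C f k.+1%:R^-1 x +
      k.+1%:R^-1].
  have hi := has_inf_chain e00 e0L w_ge fb k.+1%:R^-1 x.
  have m0 : 0 < Num.min (f x - e - chain_inf L w C f k.+1%:R^-1 x) k.+1%:R^-1.
    by rewrite lt_min subr_gt0 lt_fx invr_gt0 ltr0n.
  have [_ [s so <-]] := inf_adherent m0 hi; rewrite -[inf _]/(chain_inf L w C f k.+1%:R^-1 x).
  by rewrite -ltrBlDl lt_min => /andP[h1 h2]; exists s; split => //; [move: h1;
    rewrite ltrD2r|move: h2; rewrite ltrBlDl].
have [s_ s_P] := choice pick.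
have [U [UU Uoo]] := ultraFilterLemma (eventually_filter).
apply: (@chain_limit_absurd R dd X L w C e0 e00 e0L w_ge f b0 g fL fb fg cC gL gw x e e_gt0 s_ _
  _ _ U UU Uoo).
- by move=> k; have [] := s_P k.
- move=> k s' so'; have [_ _ /ltW/le_trans] := s_P k; apply.
  by rewrite lerD2r; exact: (chain_inf_le e00 e0L w_ge fb).
- by move=> k; have [] := s_P k.
Qed.

Lemma LIP_opp (Y : metricType R) (A : set Y) (h : Y -> R) : LIP A (\- h) = LIP A h.
Proof.
rewrite /LIP; congr (ereal_inf (image _ _)); apply/seteqP.
by split=> M [M0 H]; split=> // y z Ay Az; have := H y z Ay Az; rewrite /= -opprD normrN.
Qed.

Lemma osc_opp (c : fragment X) f : osc c (\- f) = osc c f.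
Proof.
rewrite /osc; congr ereal_sup; apply/seteqP.
by split=> _ [y cy [z cz <-]]; exists y => //; exists z => //=; rewrite -opprD normrN.
Qed.

Lemma star_ug_opp f : star_upper_gradient f g -> star_upper_gradient (\- f) g.
Proof.
move=> [g0 H]; split => // c; have := H c.
by rewrite /upper_gradient_along osc_opp LIP_opp.
Qed.

Lemma chain_inf_lip f b0 r x y : (forall x, b0 <= f x) ->
  `|chain_inf L w C f r x - chain_inf L w C f r y| <= L * d x y.
Proof.
move=> fb; have h u v := @chain_inf_step R X L w C e0 e00 e0L w_ge f b0 fb r u (v, None) I.
rewrite ler_norml; apply/andP; split; have := h x y; have := h y x;
  rewrite /step_cost/= [d y x]metric_sym; lra.
Qed.

Lemma chain_inf_slope f b0 r p x y : (forall x, b0 <= f x) -> C p -> d p x < r -> d p y < r ->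
  `|chain_inf L w C f r x - chain_inf L w C f r y| <= w p * d x y.
Proof.
move=> fb Cp px py.
have h u v (pu : d p u < r) (pv : d p v < r) :
    chain_inf L w C f r u <= chain_inf L w C f r v + w p * d u v.
  have so : step_ok C r u (v, Some p) by split => //; rewrite metric_sym.
  exact: (@chain_inf_step R X L w C e0 e00 e0L w_ge f b0 fb r u (v, Some p) so).
rewrite ler_norml; apply/andP; split; have := h x y px py; have := h y x py px;
  rewrite [d y x]metric_sym; lra.
Qed.

Lemma dist_max_min (a b a' b' K : R) : `|a - a'| <= K -> `|b - b'| <= K ->
  `|Num.max a (Num.min b 0) - Num.max a' (Num.min b' 0)| <= K.
Proof.
rewrite !ler_norml => /andP[? ?] /andP[? ?].
have K0 : 0 <= K by lra.
case: (leP b 0) => ?; case: (leP b' 0) => ?.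
- case: (leP a b) => ?; case: (leP a' b') => ?; apply/andP; split; lra.
- case: (leP a b) => ?; case: (leP a' 0) => ?; apply/andP; split; lra.
- case: (leP a 0) => ?; case: (leP a' b') => ?; apply/andP; split; lra.
- case: (leP a 0) => ?; case: (leP a' 0) => ?; apply/andP; split; lra.
Qed.

Lemma chain_cutoff f (B : R) : lipschitz_with L [set: X] f ->
  (forall x, `|f x| <= B) -> star_upper_gradient f g ->
  exists F : nat -> X -> R, [/\ forall k x, `|F k x| <= `|f x|,
    forall k x y, `|F k x - F k y| <= L * d x y,
    forall k p x y, C p -> d p x < k.+1%:R^-1 -> d p y < k.+1%:R^-1 ->
      `|F k x - F k y| <= w p * d x y
    & forall x, F k x @[k --> \oo] --> f x].
Proof.
move=> fL fB fg.
have fb x : - B <= f x by have := fB x; rewrite ler_norml => /andP[].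
have fb' x : - B <= (\- f) x by have := fB x; rewrite /= ler_norml; lra.
pose u k := chain_inf L w C f k.+1%:R^-1; pose v k x := - chain_inf L w C (\- f) k.+1%:R^-1 x.
have uf k x : u k x <= f x by exact: (chain_inf_le_fun e00 e0L w_ge fb).
have fv k x : f x <= v k x.
  by rewrite lerNr; exact: (chain_inf_le_fun e00 e0L w_ge fb').
(* As u <= f <= v, this is the median of u, v and 0, that is the point of [u, v] nearest to 0; hence
   it is bounded by |f|. The median also inherits Lipschitz bounds common to u and v. *)
exists (fun k x => Num.max (u k x) (Num.min (v k x) 0)); split.
- move=> k x; have := uf k x; have := fv k x; move: (u k x) (v k x) (f x) => a b c ? ?.
  have [c0|c0] := leP 0 c; [rewrite (ger0_norm c0)|rewrite (ltr0_norm c0)]; rewrite ler_norml.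
    by case: (leP b 0) => ?; [case: (leP a b) => ?|case: (leP a 0) => ?]; apply/andP; split; lra.
  by case: (leP b 0) => ?; [case: (leP a b) => ?|case: (leP a 0) => ?]; apply/andP; split; lra.
- move=> k x y; apply: dist_max_min; first exact: chain_inf_lip fb.
  by rewrite -opprD normrN; exact: chain_inf_lip fb'.
- move=> k p x y Cp px py; apply: dist_max_min; first exact: chain_inf_slope fb Cp px py.
  by rewrite -opprD normrN; exact: chain_inf_slope fb' Cp px py.
move=> x; apply/cvgrPdist_le => e e_gt0.
have [N1 H1] := chain_approx x fL fb fg e_gt0.
have fL' : lipschitz_with L [set: X] (\- f).
  by split=> [|y z _ _ /=]; [exact: fL.1|rewrite -opprD normrN; exact: fL.2].
have [N2 H2] := chain_approx x fL' fb' (star_ug_opp fg) e_gt0.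
exists (maxn N1 N2) => // k; rewrite /= geq_max => /andP[/H1 h1 /H2 h2].
have := uf k x; have := fv k x; move: h1 h2; rewrite -/(u k x) /=.
rewrite -[chain_inf _ _ _ (\- f) _ x]opprK -/(v k x).
move: (u k x) (v k x) (f x) => a b c ? ? ? ?.
by rewrite ler_norml; case: (leP b 0) => ?; [case: (leP a b) => ?|case: (leP a 0) => ?];
  apply/andP; split; lra.
Qed.

End chain_approx.

(** * Minimizing sequences *)

Section minimizing_sequence.
Context {R : realType} {dd : measure_display} {T : measurableType dd}.
Variables (mu : {measure set T -> \bar R}) (S : set T).
Hypotheses (mS : measurable S) (muS : (mu S < +oo)%E).
Variables (Y : Type) (C : nat -> set Y) (mid : Y -> Y -> Y) (h : Y -> T -> R) (L : R).
Hypothesis C0 : forall n, C n !=set0.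
Hypothesis Cmono : forall n m, (n <= m)%N -> C m `<=` C n.
Hypothesis Cmid : forall n a b, C n a -> C n b -> C n (mid a b).
Hypothesis mh : forall a, measurable_fun [set: T] (h a).
Hypothesis h0L : forall a x, 0 <= h a x <= L.
Hypothesis hmid : forall a b, C 0%N a -> C 0%N b ->
  {ae mu, forall x, S x -> h (mid a b) x <= (h a x + h b x) / 2}.

Lemma bounded_measurable_integrable (q : T -> R) (K : R) :
  measurable_fun [set: T] q -> (forall x, `|q x| <= K) ->
  mu.-integrable S (EFin \o q).
Proof.
move=> mq qK; apply: (@le_integrable _ _ _ mu S mS _ (cst K%:E)).
- by apply/measurable_EFinP/measurable_funTS.
- by move=> x _ /=; rewrite lee_fin (le_trans (qK x))// ler_norm.
- apply/integrableP; split; first exact: measurable_cst.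
  have K0 : 0 <= K by apply: (le_trans (normr_ge0 _) (qK point)).
  rewrite (eq_integral (cst K%:E)); last by move=> x _ /=; rewrite ger0_norm.
  by rewrite integral_cst// lte_mul_pinfty.
Qed.

Let J a := \int[mu]_(x in S) (h a x ^+ 2).
Let D a b := \int[mu]_(x in S) ((h a x - h b x) ^+ 2).

Let intq (q : T -> R) : measurable_fun [set: T] q -> (forall x, `|q x| <= 4 * L ^+ 2) ->
  mu.-integrable S (EFin \o q).
Proof. exact: bounded_measurable_integrable. Qed.

Let h2 a x : 0 <= h a x ^+ 2 <= L ^+ 2.
Proof. by have /andP[h0 hL] := h0L a x; rewrite sqr_ge0 lerXn2r// nnegrE// (le_trans h0). Qed.

Let mh2 a : measurable_fun [set: T] (fun x => h a x ^+ 2).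
Proof. exact: measurable_funX. Qed.

Let ih2 a : mu.-integrable S (EFin \o (fun x => h a x ^+ 2)).
Proof. by apply: intq => // x; have /andP[? ?] := h2 a x; rewrite ger0_norm//; lra. Qed.

Let mD a b : measurable_fun [set: T] (fun x => (h a x - h b x) ^+ 2).
Proof. by apply: measurable_funX; exact: measurable_funB. Qed.

Let iD a b : mu.-integrable S (EFin \o (fun x => (h a x - h b x) ^+ 2)).
Proof.
apply: intq => // x; rewrite ger0_norm ?sqr_ge0//.
by have /andP[? ?] := h0L a x; have /andP[? ?] := h0L b x; nra.
Qed.

Let iA a b : mu.-integrable S (EFin \o (fun x => (h a x + h b x) ^+ 2)).
Proof.
apply: intq => [|x]; first by apply: measurable_funX; exact: measurable_funD.
rewrite ger0_norm ?sqr_ge0//.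
by have /andP[? ?] := h0L a x; have /andP[? ?] := h0L b x; nra.
Qed.

Let parallelogram a b : C 0%N a -> C 0%N b -> D a b <= 2 * J a + 2 * J b - 4 * J (mid a b).
Proof.
move=> Ca Cb; pose A := \int[mu]_(x in S) ((h a x + h b x) ^+ 2).
have E : D a b + A = 2 * J a + 2 * J b.
  rewrite /D /A /J -RintegralD// -!RintegralZl// -RintegralD//.
  - by apply: eq_Rintegral => x _; ring.
  - exact: (integrableZl mS 2 (ih2 a)).
  - exact: (integrableZl mS 2 (ih2 b)).
have : 4 * J (mid a b) <= A.
  rewrite /A /J -RintegralZl//; apply: fine_le.
  - exact: integrable_fin_num (integrableZl mS 4 (ih2 (mid a b))).
  - exact: integrable_fin_num (iA a b).
  apply: ae_le_integral_any => [x|x|];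
    [by rewrite lee_fin mulr_ge0 ?sqr_ge0|by rewrite lee_fin sqr_ge0|].
  apply: (@filterS _ _ (ae_filter_ringOfSetsType mu)) (hmid Ca Cb) => x H /H hm.
  rewrite lee_fin; have /andP[? ?] := h0L (mid a b) x.
  have /andP[? ?] := h0L a x; have /andP[? ?] := h0L b x; nra.
lra.
Qed.

Let J_bound a : 0 <= J a <= L ^+ 2 * fine (mu S).
Proof.
apply/andP; split; first by apply: Rintegral_ge0 => x _; exact: sqr_ge0.
rewrite -Rintegral_cst//; apply: le_Rintegral => //; last by move=> x _; have /andP[] := h2 a x.
by apply: (@bounded_measurable_integrable _ (L ^+ 2)) => // x; rewrite ger0_norm ?sqr_ge0.
Qed.

Let I n := inf [set J a | a in C n].
Let hasI n : has_inf [set J a | a in C n].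
Proof.
split; first by have [a Ca] := C0 n; exists (J a), a.
by exists 0 => _ [a _ <-]; have /andP[] := J_bound a.
Qed.

Let Imono n m : (n <= m)%N -> I n <= I m.
Proof.
move=> nm; apply: lb_le_inf; first by have [] := hasI m.
by move=> _ [a /(Cmono nm) Ca <-]; apply: ge_inf; [exact: (hasI n).2|exists a].
Qed.

Let Isup := sup (range I).
Let hasIsup : has_sup (range I).
Proof.
split; first by exists (I 0%N), 0%N.
exists (L ^+ 2 * fine (mu S)) => _ [n _ <-]; have [a Ca] := C0 n.
have /andP[_] := J_bound a; apply: le_trans; apply: ge_inf; [exact: (hasI n).2|by exists a].
Qed.

(** The infima over the decreasing classes increase to a finite limit. Near-minimizers taken where
    the infima are almost constant have midpoints that cannot do better, which forces their h to be
    close in L^2. *)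
Lemma minimizing_cauchy : exists y : nat -> Y, (forall k, C k (y k)) /\
  {ae mu, forall x, S x -> exists M, forall k,
     `|h (y k.+1) x - h (y k) x| <= M / 2 ^+ k}.
Proof.
(* The factor 6 is the constant in [Dk]: 2 from the variation of the infima and 4 from the two
   near-minimizers. The factor 4^k is the weight in u, and 2^(k+1) makes the weighted integrals
   summable. *)
pose dl (k : nat) : R := (6 * 4 ^+ k * (2 ^ k.+1)%:R)^-1.
have dl0 k : 0 < dl k by rewrite invr_gt0 !mulr_gt0// ?exprn_gt0// ltr0n expn_gt0.
have Ile n : I n <= Isup by apply: ub_le_sup; [exact: hasIsup.2|exists n].
have /choice[N HN] (k : nat) : exists N, forall n, (N <= n)%N -> Isup - dl k <= I n.
  have [_ [N _ <-] /ltW NI] := sup_adherent (dl0 k) hasIsup.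
  by exists N => n /Imono; exact: le_trans.
(* A nondecreasing sequence of indices above both k and [N k]. *)
pose n_ k := (k + \sum_(j < k.+1) N j)%N.
have n_mono k : (n_ k <= n_ k.+1)%N by rewrite /n_ [in X in (_ <= X)%N]big_ord_recr/= leq_add//
  leq_addr.
have n_N k : Isup - dl k <= I (n_ k).
  by apply: HN; rewrite /n_ big_ord_recr/= addnA leq_addl.
have /choice[y Hy] (k : nat) : exists a, C (n_ k) a /\ J a < I (n_ k) + dl k.
  by have [_ [a Ca <-] H] := inf_adherent (dl0 k) (hasI (n_ k)); exists a.
have dlmono k : dl k.+1 <= dl k.
  rewrite /dl lef_pV2 ?posrE ?mulr_gt0 ?exprn_gt0 ?ltr0n ?expn_gt0//.
  apply: ler_pM; rewrite ?mulr_ge0 ?exprn_ge0//.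
    by rewrite ler_wpM2l// exprS ler_peMl ?exprn_ge0// ler1n.
  by rewrite ler_nat leq_exp2l.
have C_0 k : C 0%N (y k) by have [h' _] := Hy k; exact: (Cmono (leq0n _)) h'.
have Dk k : D (y k) (y k.+1) <= 6 * dl k.
  apply: (le_trans (parallelogram (C_0 k) (C_0 k.+1))).
  have [Ck J1] := Hy k; have [Ck1 J2] := Hy k.+1.
  have : I (n_ k) <= J (mid (y k) (y k.+1)).
    apply: ge_inf; first exact: (hasI _).2.
    by exists (mid (y k) (y k.+1)) => //; apply: Cmid => //; exact: (Cmono (n_mono k)).
  have := n_N k; have := Ile (n_ k.+1); have := dlmono k; lra.
exists y; split; first by move=> k; have [h' _] := Hy k; apply: Cmono h'; exact: leq_addr.
(* The series of these functions has integral at most 1. It is finite almost everywhere, and a bound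
   on each of its terms is a geometric bound on the increments. *)
pose u k x : \bar R := (4 ^+ k * (h (y k) x - h (y k.+1) x) ^+ 2)%:E.
have u0 k x : (0 <= u k x)%E by rewrite lee_fin; apply: mulr_ge0; [exact: exprn_ge0|exact: sqr_ge0].
have mu_ k : measurable_fun S (u k).
  by apply/measurable_EFinP/measurable_funTS; exact: measurable_funM.
have int_u k : (\int[mu]_(x in S) u k x <= (1 / (2 ^ k.+1)%:R)%:E)%E.
  have iu := integrableZl mS (4 ^+ k) (iD (y k) (y k.+1)).
  rewrite -[leLHS]fineK; last exact: integrable_fin_num iu.
  rewrite lee_fin -[leLHS]/(\int[mu]_(x in S) (4 ^+ k * (h (y k) x - h (y k.+1) x) ^+ 2)).
  rewrite RintegralZl//; apply: (@le_trans _ _ (4 ^+ k * (6 * dl k))).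
    by rewrite ler_wpM2l// ?exprn_ge0//; exact: Dk.
  by rewrite /dl le_eqVlt; apply/orP; left; apply/eqP; field; rewrite pnatr_eq0 expn_eq0 expf_neq0.
have iu : mu.-integrable S (fun x => \sum_(0 <= k <oo) u k x)%E.
  apply/integrableP; split; first exact: ge0_emeasurable_sum.
  rewrite (eq_integral (fun x => \sum_(0 <= k <oo) u k x)%E); last first.
    by move=> x _; rewrite gee0_abs//; exact: nneseries_ge0.
  rewrite integral_nneseries//; apply: (@le_lt_trans _ _ 1%E); last exact: ltry.
  apply: (le_trans _ (@epsilon_trick0 R 1 xpredT ler01)).
  by apply: lee_nneseries => [n _ _|n _]; [exact: integral_ge0|exact: int_u].
apply: (@filterS _ _ (ae_filter_ringOfSetsType mu)) (integrable_ae mS iu) => x H Sx.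
have fin := H Sx; pose M := fine (\sum_(0 <= k <oo) u k x)%E.
(* [1 + M] bounds every z with [z ^+ 2 <= M] and avoids the square root. *)
exists (1 + M) => k; set a := _ - _.
have uM : 4 ^+ k * a ^+ 2 <= M.
  rewrite -lee_fin fineK//; have -> : (4 ^+ k * a ^+ 2)%:E = u k x.
    by rewrite /u /a; congr (_ * _)%:E; ring.
  rewrite (nneseriesD1 (n := k))//.
  by rewrite leeDl//; apply: nneseries_ge0.
rewrite ler_pdivlMr ?exprn_gt0//.
have : (`|a| * 2 ^+ k) ^+ 2 <= M.
  by apply: le_trans uM;
    rewrite exprMn real_normK ?num_real// -exprM mulnC exprM [2 ^+ 2]expr2 mulrC (_ : 2 * 2 = 4
    :> R)//; ring.
move: (`|a| * 2 ^+ k) => z; nra.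
Qed.

End minimizing_sequence.

(** * Upper gradients of limits and of midpoints *)

Section upper_gradient_limits.
Context {R : realType} {dd : measure_display} {X : completeMetricMeasurableType R dd}.
Hypothesis borelX : borel_sigma_algebra X.
Implicit Types (f F G : X -> R) (g v : X -> \bar R) (c : fragment X).
Local Notation leb := (@lebesgue_measure R).

Lemma le_frag_integral c v g : (forall x, 0 <= v x)%E -> (forall x, v x <= g x)%E ->
  (frag_integral c v <= frag_integral c g)%E.
Proof.
move=> v0 vg; have [m cm] := ex_speed c; have [_ m0 _ _] := cm.
rewrite !(frag_integralE _ cm); apply: ae_le_integral_any => [t|t|].
- by rewrite mule_ge0 ?lee_fin.
- by apply: mule_ge0; [exact: le_trans (v0 _) (vg _)|rewrite lee_fin].
- by apply: aeW => t _; apply: lee_wpmul2r => //; rewrite lee_fin.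
Qed.

Lemma star_ug_le f v g : star_upper_gradient f v -> measurable_fun [set: X] g ->
  (forall x, v x <= g x)%E -> star_upper_gradient f g.
Proof.
move=> [[_ v0] fv] mg vg; split; first by split => // x; exact: le_trans (v0 x) (vg x).
by move=> c; apply: (le_trans (fv c)); apply: leeD => //; exact: le_frag_integral.
Qed.

(** All terms of the tail obey the inequality with the same right-hand side, which passes to the
    limit for each pair of points of the curve. The bound on the Lipschitz constants keeps the gap
    term under control. *)
Lemma star_ug_esups f (F : nat -> X -> R) (v : nat -> X -> \bar R) n :
  (forall m, LIP [set: X] (F m) <= LIP [set: X] f)%E ->
  (forall x, F m x @[m --> \oo] --> f x) ->
  (forall m, star_upper_gradient (F m) (v m)) ->
  star_upper_gradient f (fun x => esups (v^~ x) n).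
Proof.
move=> Ff Fcv Fv; have v0 m x : (0 <= v m x)%E := (Fv m).1.2 x.
have vs m x : (n <= m)%N -> (v m x <= esups (v^~ x) n)%E.
  by move=> nm; apply: ereal_sup_ubound; exists m.
split.
  split; first by apply: measurable_fun_esups => m; have [[]] := Fv m.
  by move=> x; apply: (le_trans (v0 n x)); exact: vs.
move=> c; apply: ge_ereal_sup => _ [x cx [y cy <-]].
have gap0 : (0 <= gap c)%E by apply: esum_ge0 => p _; rewrite lee_fin mdist_ge0.
have bd m : (n <= m)%N -> (`|F m x - F m y|%:E <=
    frag_integral c (fun x => esups (v^~ x) n) + LIP setT f * gap c)%E.
  move=> nm; apply: (@le_trans _ _ (osc c (F m))).
    by apply: ereal_sup_ubound; exists x => //; exists y.
  apply: (le_trans ((Fv m).2 c)); apply: leeD; last exact: lee_wpmul2r.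
  by apply: le_frag_integral => // z; exact: vs.
have cv : `|F m x - F m y| @[m --> \oo] --> `|f x - f y|.
  by apply: cvg_norm; apply: cvgB; exact: Fcv.
move: (frag_integral _ _ + _)%E bd => B bd.
case: B bd => [b bd'|_|bd']; last 2 first.
- exact: leey.
- by have := bd' n (leqnn _); rewrite leeNy_eq.
rewrite lee_fin; rewrite -(cvg_lim _ cv)//; apply: limr_le; first by apply/cvg_ex;
  exists `|f x - f y|.
by exists n => // m /= /bd'; rewrite lee_fin.
Qed.

(** Averaging the two integral inequalities would leave the mean of the two Lipschitz constants
    before the gap, possibly larger than that of the midpoint. The argument therefore goes through
    slopes. *)
Lemma star_ug_midpoint F G v g : lipschitz_fun F -> lipschitz_fun G ->
  star_upper_gradient F v -> star_upper_gradient G g ->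
  star_upper_gradient (fun x => (F x + G x) / 2) (fun x => ((2^-1)%:E * (v x + g x))%E).
Proof.
move=> lF lG Fv Gg; have [[mv v0] _] := Fv; have [[mg g0] _] := Gg.
have vg0 x : (0 <= v x + g x)%E by exact: adde_ge0.
apply: star_ug_of_slopes => //.
- have [LF [LF0 HF]] := lF; have [LG [LG0 HG]] := lG.
  exists ((LF + LG) / 2); split; first by rewrite divr_ge0// addr_ge0.
  move=> x y _ _; have ->
    : (F x + G x) / 2 - (F y + G y) / 2 = ((F x - F y) + (G x - G y)) / 2 by ring.
  rewrite normrM [`|2^-1|]gtr0_norm ?invr_gt0// [_ / 2 * _]mulrAC ler_pM2r ?invr_gt0//.
  by apply: (le_trans (ler_normD _ _)); rewrite mulrDl lerD ?HF ?HG.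
- split; last by move=> x; rewrite mule_ge0// lee_fin.
  by apply: measurable_funeM; exact: emeasurable_funD.
move=> c m h cm hs; have [L FL _] := LIP_attained lF; have [L' GL _] := LIP_attained lG.
have [hF [_ hsF _]] := ex_slope c FL.
(* The slope of G is read off from those of the midpoint and of F, since h is prescribed. *)
have hsG : {ae leb, forall t, frag_dom c t -> has_slope (frag_dom c) (G \o c) t (2 * h t - hF t)}.
  apply: (@filterS2 _ _ (ae_filter_ringOfSetsType leb)) hs hsF => t ht hFt Dt e e0.
  have e4 : 0 < e / 4 by rewrite divr_gt0.
  have [d1 d10 d1P] := ht Dt _ e4; have [d2 d20 d2P] := hFt Dt _ e4.
  exists (Num.min d1 d2) => [|s Ds]; first by rewrite lt_min d10.
  rewrite lt_min => /andP[/(d1P s Ds) h1 /(d2P s Ds) h2].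
  have -> : (G \o c) s - (G \o c) t - (2 * h t - hF t) * (s - t) =
     2 * ((F (c s) + G (c s)) / 2 - (F (c t) + G (c t)) / 2 - h t * (s - t)) -
     (F (c s) - F (c t) - hF t * (s - t)) by rewrite /=; field.
  apply: (le_trans (ler_normB _ _)); rewrite normrM ger0_norm//.
  move: h1 h2; rewrite /=; have := mulr_ge0 (ltW e0) (normr_ge0 (s - t)); lra.
have sF := slope_of_ug borelX FL Fv cm hsF; have sG := slope_of_ug borelX GL Gg cm hsG.
apply: (@filterS2 _ _ (ae_filter_ringOfSetsType leb)) sF sG => t sF sG Dt.
have := leeD (sF Dt) (sG Dt); rewrite -ge0_muleDl// => /(lee_wpmul2l _) H.
rewrite -muleA; apply: le_trans (H (2^-1)%:E _); last by rewrite lee_fin.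
rewrite -EFinD -EFinM lee_fin.
have E : h t = 2^-1 * (hF t + (2 * h t - hF t)) by field.
rewrite {1}E {E}.
by rewrite normrM [`|2^-1|]gtr0_norm ?invr_gt0// ler_wpM2l ?invr_ge0// ler_normD.
Qed.

End upper_gradient_limits.

(** The common Lipschitz constant extends closeness at a point to a ball of radius
    [e / (4 * L + 1)], at a cost of e/4 for each of the two functions; finitely many balls
    suffice. *)
Lemma equilipschitz_cvg_compact {R : realType} {X : metricType R}
    (F : nat -> X -> R) (f : X -> R) (L : R) (K : set X) : 0 <= L ->
  (forall n x y, `|F n x - F n y| <= L * mdist x y) ->
  (forall x y, `|f x - f y| <= L * mdist x y) ->
  (forall x, F n x @[n --> \oo] --> f x) -> compact K -> {uniform K, F @ \oo --> f}.
Proof.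
move=> L0 FL fL Fcv /compact_near_coveringP cK P /uniform_nbhs[E [entE EP]].
move: entE; rewrite -entourage_ballE => -[e /= e0 eE].
have L1 : 0 < 4 * L + 1 by rewrite ltr_wpDl// mulr_ge0.
have H x : K x -> \forall x' \near x & n \near \oo, `|f x' - F n x'| < e.
  move=> _; have r0 : 0 < e / (4 * L + 1) by rewrite divr_gt0.
  have e2 : 0 < e / 2 by rewrite divr_gt0.
  have [N _ HN] := (@cvgrPdist_lt _ _ _ _ _ _ _).1 (Fcv x) _ e2.
  exists (ball x (e / (4 * L + 1)), [set n | (N <= n)%N]).
    by split; [exact: nbhsx_ballx|exists N].
  move=> [x' n] [/= xx' Nn]; have := HN n Nn; rewrite /= => h1.
  have h2 := FL n x x'; have h3 := fL x' x; rewrite metric_sym in h3.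
  have h4 : L * mdist x x' <= e / 4.
    apply: (@le_trans _ _ (L * (e / (4 * L + 1)))).
      by rewrite ler_wpM2l//; move: xx'; rewrite ballEmdist => /ltW.
    by rewrite mulrCA ler_wpM2l ?(ltW e0)// ler_pdivrMr//; lra.
  have -> : f x' - F n x' = (f x' - f x) + (f x - F n x) + (F n x - F n x') by ring.
  apply: (le_lt_trans (ler_normD _ _));
    apply: (@le_lt_trans _ _ (`|f x' - f x| + `|f x - F n x| + `|F n x - F n x'|)).
    by rewrite lerD2r ler_normD.
  lra.
have := cK _ \oo (fun n x => `|f x - F n x| < e) eventually_filter H.
apply: filterS => n Kn; apply: EP => y Ky; apply: eE; exact: Kn.
Qed.

(** * The approximating sequence *)

Section approximation.
Context {R : realType} {dd : measure_display} {X : completeMetricMeasurableType R dd}.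
Variable mu : {measure set X -> \bar R}.
Hypothesis hX : metric_measure_space mu.
Variable f : X -> R.
Hypothesis hf : lipschitz_bs f.
Variable L : R.
Hypotheses (fL : lipschitz_with L [set: X] f) (LIPf : LIP [set: X] f = L%:E).
Local Notation d := mdist.
Local Notation D F := (minimal_star_upper_gradient mu F).
Local Notation aeS := (@filterS _ _ (ae_filter_ringOfSetsType mu)).
Implicit Types (F G : X -> R) (x y p : X).

Let borelX : borel_sigma_algebra X. Proof. by case: hX. Qed.
Let sepX : separable X. Proof. by case: hX. Qed.
Let L0 : 0 <= L. Proof. exact: fL.1. Qed.
Let S := closure [set y | f y != 0].
Let g := D f.

Let mS : measurable S.
Proof.
rewrite -[S]setCK; apply: measurableC; apply: open_measurable_borel => //.
by apply: closed_openC; exact: closed_closure.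
Qed.

Let muS : (mu S < +oo)%E.
Proof. by case: hX => _ _; apply => //; have [_ [x [r H]]] := hf; exists x, r. Qed.

Let f_bounded : exists B, forall x, `|f x| <= B.
Proof.
have [_ [x0 [r H]]] := hf; exists (`|f x0| + L * `|r|) => x.
have [->|fx] := eqVneq (f x) 0; first by rewrite normr0 addr_ge0// mulr_ge0.
have xr : d x0 x < r by have := H x (@subset_closure _ [set y | f y != 0] x fx); rewrite ballEmdist.
have := fL.2 x x0 I I; rewrite metric_sym => h.
have h2 : L * d x0 x <= L * `|r| by rewrite ler_wpM2l// (le_trans (ltW xr))// ler_norm.
by have := lerB_dist (f x) (f x0); lra.
Qed.

Let D_borel F : borel_nonneg (D F).
Proof.
rewrite /minimal_star_upper_gradient; case: xgetP => [v _ [[]]//|_].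
by split => //; exact: measurable_cst.
Qed.

(** A real-valued version of [D F] with values in [0, L], as the minimization requires; for the
    admissible F it is still an upper gradient and agrees with [D F] almost everywhere. *)
Let cutoff F x : R := fine (mine (D F x) L%:E).

Let cutoffE F x : ((cutoff F x)%:E = mine (D F x) L%:E)%E.
Proof.
rewrite fineK// ge0_fin_numE; last by rewrite le_min lee_fin L0 (D_borel F).2.
by rewrite (le_lt_trans _ (ltry L))// ge_min lexx orbT.
Qed.

Let cutoff0L F x : 0 <= cutoff F x <= L.
Proof. by rewrite -!lee_fin cutoffE le_min lee_fin L0 (D_borel F).2/= ge_min lexx orbT. Qed.

Let mcutoff F : measurable_fun [set: X] (cutoff F).
Proof.
apply: (measurableT_comp (fine_measurable measurableT)).
by apply: measurable_mine => //; exact: (D_borel F).1.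
Qed.

Let is_bs F : lipschitz_with L [set: X] F -> (forall x, `|F x| <= `|f x|) -> lipschitz_bs F.
Proof.
move=> FL Ff; split; first by exists L.
have [_ [x [r H]]] := hf; exists x, r; apply: subset_trans H; apply: closure_subset => y /=.
by apply: contra_neq => fy; apply/eqP; rewrite -normr_le0 (le_trans (Ff y))// fy normr0.
Qed.

Let cst_ug F : lipschitz_with L [set: X] F -> star_upper_gradient F (cst L%:E).
Proof.
move=> FL; have FLip : star_upper_gradient F (Lip F) by apply: Lip_ug => //; exists L.
by apply: star_ug_le FLip _ _ => // x; exact: Lip_le_LIP.
Qed.

Let cutoff_ug F : lipschitz_with L [set: X] F -> (forall x, `|F x| <= `|f x|) ->
  star_upper_gradient F (fun x => (cutoff F x)%:E).
Proof.
move=> FL Ff; rewrite (_ : (fun x => _) = fun x => mine (D F x) (cst L%:E x)); last first.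
  by apply/funext => x; exact: cutoffE.
apply: ug_min => //; [by exists L| |exact: cst_ug].
by have [] := minimal_ugP borelX hX (is_bs FL Ff).
Qed.

Let cutoff_ae F : lipschitz_with L [set: X] F -> (forall x, `|F x| <= `|f x|) ->
  {ae mu, forall x, D F x = (cutoff F x)%:E}.
Proof.
move=> FL Ff; apply: aeS (minimal_ug_le_Lip borelX hX (is_bs FL Ff)) => x h.
by rewrite cutoffE; apply/esym/min_idPl; apply: (le_trans h); exact: Lip_le_LIP.
Qed.

Let cutoff_le F (rho : X -> \bar R) : lipschitz_with L [set: X] F -> (forall x, `|F x| <= `|f x|) ->
  star_upper_gradient F rho -> {ae mu, forall x, (cutoff F x)%:E <= rho x}%E.
Proof.
move=> FL Ff Frho; have bs := is_bs FL Ff.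
have ug : star_upper_gradient F (fun x => mine (rho x) (cst L%:E x)).
  by apply: ug_min => //; [exists L|exact: cst_ug].
have bd x : (mine (rho x) (cst L%:E x) <= L%:E)%E by rewrite ge_min lexx orbT.
apply: aeS (minimal_ug_le borelX hX bs ug bd) => x h.
by rewrite cutoffE (le_trans _ (le_trans h _))// ge_min lexx.
Qed.

Let gL_ae : {ae mu, forall x, g x <= L%:E}%E.
Proof.
by apply: aeS (minimal_ug_le_Lip borelX hX hf) => x h; apply: (le_trans h); exact: Lip_le_LIP.
Qed.

Let A := S `&` [set x | (g x <= L%:E)%E].

Let mA : measurable A.
Proof.
apply: measurableI => //; rewrite -[X in measurable X]setTI.
rewrite (_ : [set x | _] = g @^-1` `]-oo, L%:E]%classic).
  by apply: (D_borel f).1 => //; exact: emeasurable_itv.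
by apply/seteqP; split => x; rewrite /= in_itv.
Qed.

Let K_ex (n : nat) : exists K, [/\ compact K, K `<=` A,
  (mu (A `\` K) <= (1 / (2 ^ n.+1)%:R)%:E)%E
  & forall p, K p -> exists2 r, 0 < r &
      forall q, K q -> d p q < r -> (g p <= g q + (n.+1%:R^-1)%:E)%E].
Proof.
(* Enough levels of height 1/(n+1) to exceed L, so that the sublevel set contains all of A. *)
pose N := (Num.Def.trunc (L * n.+1%:R)).+1.
have e0 : 0 < 1 / (2 ^ n.+1)%:R :> R by rewrite divr_gt0// ltr0n expn_gt0.
have n0 : 0 < n.+1%:R^-1 :> R by rewrite invr_gt0.
have [K [cK KA muK KP]] := @compact_slow_drop _ _ X mu borelX sepX S mS muS g A n.+1%:R^-1 _ N
  (D_borel f).1 (D_borel f).2 mA n0 e0.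
exists K; split => //; first by move=> x /KA[].
rewrite (_ : A `\` K = S `&` (A `&` [set x | (g x < (N%:R * n.+1%:R^-1)%:E)%E]) `\` K)//.
congr (_ `\` _); apply/seteqP; split => [x Ax|x [_ []]//].
split; first by case: Ax.
split => //=; case: Ax => _ /= /le_lt_trans; apply.
by rewrite lte_fin ltr_pdivlMr// truncnS_gt.
Qed.

Let K_ n := sval (cid (K_ex n)).
Let K_P n := svalP (cid (K_ex n)).

(* The conditions defining [cls n] are imposed on the increasing sets [A_ n],
   so that the classes decrease with [n]. *)
Let A_ n : set X := [set x | forall m, (n <= m)%N -> K_ m x].

(** Borel-Cantelli: the measures of [A \ K_ n] are summable, so almost every point of A belongs to
    [K_ n] for all large n. *)
Let A_ae : {ae mu, forall x, S x -> exists n, A_ n x}.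
Proof.
pose B n := A `\` K_ n.
have mK n : measurable (K_ n).
  rewrite -[K_ n]setCK; apply: measurableC; apply: open_measurable_borel => //.
  apply: closed_openC; apply: compact_closed; first exact: metric_hausdorff.
  by have [] := K_P n.
have B0 : mu (lim_sup_set B) = 0%E.
  apply: lim_sup_set_cvg0 => [n|]; first exact: measurableD.
  apply: (@le_lt_trans _ _ 1%E); last exact: ltry.
  apply: (le_trans _ (@epsilon_trick0 R 1 xpredT ler01)).
  by apply: lee_nneseries => // n _; have [] := K_P n.
have Bae : {ae mu, forall x, ~ lim_sup_set B x}.
  exists (lim_sup_set B); split => //; last by move=> x; apply: contrapT.
  by apply: bigcap_measurable => [|k _]; [exists 0%N|apply: bigcup_measurable => n _;
    exact: measurableD].
apply: (@filterS2 _ _ (ae_filter_ringOfSetsType mu)) Bae gL_ae => x nB gx Sx.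
apply: contrapT => nA; apply: nB => n _; apply: contrapT => nU; apply: nA.
exists n => m nm; apply: contrapT => nK; apply: nU; exists m => //.
Qed.

Variable xs : nat -> X.
Hypothesis xsP : forall x r, 0 < r -> exists i, d (xs i) x < r.

(** Closeness to f is required only at the first points of a dense sequence: finitely many
    constraints can be met by one cutoff, and the common Lipschitz constant turns them into
    convergence everywhere. All conditions are stable under midpoints. *)
Let cls n : set (X -> R) := [set F | [/\ forall x, `|F x| <= `|f x|,
  forall x y, `|F x - F y| <= L * d x y,
  forall i, (i <= n)%N -> `|F (xs i) - f (xs i)| <= n.+1%:R^-1
  & forall p, A_ n p -> exists2 r, 0 < r & forall y z, d p y < r -> d p z < r ->
      `|F y - F z| <= (fine (g p) + n.+1%:R^-1) * d y z]].

Let invS_le n m : (n <= m)%N -> m.+1%:R^-1 <= n.+1%:R^-1 :> R.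
Proof. by move=> nm; rewrite lef_pV2 ?posrE// ler_nat. Qed.

Let cls_mono n m : (n <= m)%N -> cls m `<=` cls n.
Proof.
move=> nm F [h1 h2 h3 h4]; split => //.
  by move=> i ni; apply: le_trans (h3 i (leq_trans ni nm)) (invS_le nm).
move=> p Ap; have [|r r0 rP] := h4 p; first by move=> k mk; apply: Ap; exact: leq_trans mk.
exists r => // y z py pz; apply: (le_trans (rP y z py pz)).
by rewrite ler_wpM2r ?mdist_ge0// lerD2l; exact: invS_le.
Qed.

Let mid F G : X -> R := fun x => (F x + G x) / 2.

Let dist_mid (a b c e K : R) : `|a - c| <= K -> `|b - e| <= K ->
  `|(a + b) / 2 - (c + e) / 2| <= K.
Proof. by rewrite !ler_norml => /andP[? ?] /andP[? ?]; apply/andP; split; lra. Qed.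

Let cls_mid n F G : cls n F -> cls n G -> cls n (mid F G).
Proof.
move=> [F1 F2 F3 F4] [G1 G2 G3 G4]; split.
- move=> x; have := F1 x; have := G1 x; rewrite /mid !ler_norml.
  by move: (`|f x|) => B /andP[? ?] /andP[? ?]; apply/andP; split; lra.
- by move=> x y; exact: dist_mid.
- move=> i ni; rewrite [f (xs i)](_ : _ = (f (xs i) + f (xs i)) / 2); last by field.
  by apply: dist_mid; [exact: F3|exact: G3].
- move=> p Ap; have [r1 r10 P1] := F4 p Ap; have [r2 r20 P2] := G4 p Ap.
  exists (Num.min r1 r2) => [|y z]; first by rewrite lt_min r10.
  rewrite !lt_min => /andP[? ?] /andP[? ?].
  by apply: dist_mid; [exact: P1|exact: P2].
Qed.

Let g_fin p : A p -> (fine (g p))%:E = g p.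
Proof.
by move=> [_ gp]; rewrite fineK// ge0_fin_numE ?(D_borel f).2// (le_lt_trans gp)// ltry.
Qed.

Let cls_nonempty n : cls n !=set0.
Proof.
have n0 : 0 < n.+1%:R^-1 :> R by rewrite invr_gt0.
have g0 x : 0 <= fine (g x) by exact: fine_ge0 ((D_borel f).2 x).
(* The chains require a positive jump cost; for L = 0 the function f itself qualifies. *)
have [L_0|Lgt] := eqVneq L 0.
  exists f; split => // [x y|i _|p _]; first exact: fL.2.
    by rewrite subrr normr0 ltW.
  exists 1 => // y z _ _; apply: (le_trans (fL.2 y z I I)).
  by rewrite L_0 mul0r mulr_ge0 ?mdist_ge0// addr_ge0// ltW.
have Lp : 0 < L by rewrite lt_neqAle eq_sym Lgt.
(* The floor must lie below both the weights, which are at least 1/(n+1), and the jump cost L. *)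
pose e0 := Num.min n.+1%:R^-1 L.
have e00 : 0 < e0 by rewrite lt_min n0.
have e0L : e0 <= L by rewrite ge_min lexx orbT.
pose w p := fine (g p) + n.+1%:R^-1.
have w_ge p : K_ n p -> e0 <= w p.
  by move=> _; rewrite /w (@le_trans _ _ n.+1%:R^-1)// ?ge_min ?lexx// lerDr.
have [cK KA _ KP] := K_P n.
have gL p : K_ n p -> (g p <= L%:E)%E by move=> /KA[].
have gw p : K_ n p -> exists2 r, 0 < r & forall q, K_ n q -> d p q < r -> (g p <= (w q)%:E)%E.
  move=> Kp; have [r r0 rP] := KP p Kp; exists r => // q Kq pq.
  by rewrite /w EFinD g_fin; [exact: rP|exact: KA].
have [B fB] := f_bounded.
have fg : star_upper_gradient f g by have [] := minimal_ugP borelX hX hf.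
have [F [F1 F2 F3 F4]] := chain_cutoff e00 e0L w_ge cK gL gw fL fB fg.
(* Induction on the number of points to be approximated, with the tolerance 1/(n+1) kept fixed. *)
have /(_ n)[N HN] m : exists N, forall k, (N <= k)%N -> forall i, (i <= m)%N ->
    `|F k (xs i) - f (xs i)| <= n.+1%:R^-1.
  elim: m => [|m [N HN]].
    have [N _ HN] := (@cvgrPdist_le _ _ _ _ _ _ _).1 (F4 (xs 0%N)) _ n0.
    by exists N => k Nk i; rewrite leqn0 => /eqP ->; rewrite distrC; exact: HN.
  have [N' _ HN'] := (@cvgrPdist_le _ _ _ _ _ _ _).1 (F4 (xs m.+1)) _ n0.
  exists (maxn N N') => k; rewrite geq_max => /andP[Nk N'k] i.
  rewrite leq_eqVlt => /orP[/eqP ->|]; first by rewrite distrC; exact: HN'.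
  by rewrite ltnS; exact: HN.
exists (F N); split => //; first exact: HN.
move=> p Ap; exists N.+1%:R^-1; first by rewrite invr_gt0.
by move=> y z; apply: F3; exact: Ap.
Qed.

Let cls_lip n F : cls n F -> lipschitz_with L [set: X] F.
Proof. by move=> [_ h _ _]; split => // x y _ _; exact: h. Qed.

Let cls_le n F : cls n F -> forall x, `|F x| <= `|f x|.
Proof. by case. Qed.

Let cutoff_mid F G : cls 0 F -> cls 0 G ->
  {ae mu, forall x, S x -> cutoff (mid F G) x <= (cutoff F x + cutoff G x) / 2}.
Proof.
move=> CF CG; have CM := cls_mid CF CG.
have lipF : lipschitz_fun F by exists L; exact: cls_lip CF.
have lipG : lipschitz_fun G by exists L; exact: cls_lip CG.
have ug := star_ug_midpoint borelX lipF lipG (cutoff_ug (cls_lip CF) (cls_le CF))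
  (cutoff_ug (cls_lip CG) (cls_le CG)).
apply: aeS (cutoff_le (cls_lip CM) (cls_le CM) ug) => x + _.
by rewrite -EFinD -EFinM lee_fin [2^-1 * _]mulrC.
Qed.

(** One pair of bounds lo, hi per point squeezes all three quantities at once, thanks to the chain
    of inequalities D <= Lip <= Lip_a. *)
Lemma approximating_sequence : exists f_ : nat -> X -> R,
    (forall j, [/\ lipschitz_with L [set: X] (f_ j) & forall x, `|f_ j x| <= `|f x|]) /\
    (forall x, f_ j x @[j --> \oo] --> f x) /\
    {ae mu, forall x, exists lo hi : nat -> \bar R,
      [/\ lo j @[j --> \oo] --> D f x, hi j @[j --> \oo] --> D f x
        & \forall j \near \oo, [/\ lo j <= D (f_ j) x, D (f_ j) x <= Lip (f_ j) x,
           Lip (f_ j) x <= Lip_a (f_ j) x & Lip_a (f_ j) x <= hi j]%E]}.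
Proof.
have [y [Cy yae]] := @minimizing_cauchy _ _ _ mu S mS muS _ cls mid cutoff L
  cls_nonempty cls_mono cls_mid mcutoff cutoff0L cutoff_mid.
have yL j := cls_lip (Cy j); have yf j := cls_le (Cy j).
have ycv x : y j x @[j --> \oo] --> f x.
  apply/cvgrPdist_le => e e0.
  have L1 : 0 < 4 * L + 1 by rewrite ltr_wpDl// mulr_ge0.
  have r0 : 0 < e / (4 * L + 1) by rewrite divr_gt0.
  have e2 : 0 < e / 2 by rewrite divr_gt0.
  have [i xi] := xsP x r0; have [N _ HN] := @near_infty_natSinv_lt R (PosNum e2).
  exists (maxn i N) => // j; rewrite /= geq_max => /andP[ij Nj].
  have h1 : j.+1%:R^-1 < e / 2 by exact: (HN j Nj).
  have [_ _ /(_ i ij) h2 _] := Cy j.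
  have h3 := (yL j).2 (xs i) x I I; have h4 := fL.2 (xs i) x I I.
  have h5 : L * d (xs i) x <= e / 4.
    apply: (@le_trans _ _ (L * (e / (4 * L + 1)))); first by rewrite ler_wpM2l// ltW.
    by rewrite mulrCA ler_wpM2l ?(ltW e0)// ler_pdivrMr//; lra.
  have -> : f x - y j x = (y j (xs i) - y j x) - (f (xs i) - f x) - (y j (xs i) - f (xs i)) by ring.
  apply: (le_trans (ler_normB _ _)).
  apply: (@le_trans _ _ (`|y j (xs i) - y j x| + `|f (xs i) - f x| + `|y j (xs i) - f (xs i)|)).
    by rewrite lerD2r ler_normB.
  move: h2; move: (j.+1%:R^-1) h1 => t ? ?; lra.
exists y; split => //; split => //.
have H1 : {ae mu, forall x j, (D (y j) x <= Lip (y j) x)%E}.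
  apply/ae_foralln => j; exact: (minimal_ug_le_Lip borelX hX (is_bs (yL j) (yf j))).
have H2 : {ae mu, forall x j, D (y j) x = (cutoff (y j) x)%:E}.
  by apply/ae_foralln => j; exact: cutoff_ae.
have H3 : {ae mu, forall x n, (g x <= esups (fun j => (cutoff (y j) x)%:E) n)%E}.
  apply/ae_foralln => n.
  have ug : star_upper_gradient f (fun x => esups (fun j => (cutoff (y j) x)%:E) n).
    apply: (@star_ug_esups _ _ _ f y (fun j x => (cutoff (y j) x)%:E) n) => // [m|m].
      by rewrite LIPf; apply: ereal_inf_lbound; exists L => //; exact: yL.
    exact: cutoff_ug.
  apply: (minimal_ug_le (M := L) borelX hX hf ug) => x.
  apply: ge_ereal_sup => _ [j _ <-]; rewrite lee_fin.
  by have /andP[] := cutoff0L (y j) x.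
have H4 := minimal_ug_le_Lip borelX hX hf.
apply: aeS (ae_and (ae_and H1 H2) (ae_and (ae_and H3 H4) (ae_and yae A_ae))).
move=> x [[h1 h2] [[h3 h4] [h5 h6]]].
(* Off the closed support of f every term vanishes near x, and all the quantities are 0. *)
have [Sx|nSx] := pselect (S x); last first.
  have La j : Lip_a (y j) x = 0%E.
    apply: Lip_a_closed_support => cl; apply: nSx; apply: closure_subset cl => z /=.
    by apply: contra_neq => fz; apply/eqP; rewrite -normr_le0 (le_trans (yf j z))// fz normr0.
  have gx : D f x = 0%E.
    apply/eqP; rewrite eq_le (D_borel f).2 andbT (le_trans h4)// (le_trans (Lip_le_Lip_a _ _))//.
    by rewrite Lip_a_closed_support.
  exists (cst 0%E), (cst 0%E); rewrite gx; split; [exact: cvg_cst|exact: cvg_cst|].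
  apply: nearW => j; split; [exact: (D_borel _).2|exact: h1|exact: Lip_le_Lip_a|by rewrite La].
have [M HM] := h5 Sx; have [n An] := h6 Sx.
have Ax : A x by have [_ KA _ _] := K_P n; apply: KA; exact: An.
have gE := g_fin Ax; set gam := fine (g x) in gE.
have M0 : 0 <= M by have := HM 0%N; rewrite expr0 divr1; apply: le_trans.
(* The geometric bounds on the increments, summed from k to m. *)
have tail k m : (k <= m)%N -> `|cutoff (y m) x - cutoff (y k) x| <= 2 * M / 2 ^+ k - 2 * M / 2 ^+ m.
  move=> /subnK <-; elim: (m - k)%N => [|j IH]; first by rewrite add0n !subrr normr0.
  rewrite addSn; set i := (j + k)%N in IH *.
  have -> : cutoff (y i.+1) x - cutoff (y k) x =
    (cutoff (y i.+1) x - cutoff (y i) x) + (cutoff (y i) x - cutoff (y k) x) by ring.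
  apply: (le_trans (ler_normD _ _)); apply: (le_trans (lerD (HM i) IH)).
  rewrite le_eqVlt; apply/orP; left; apply/eqP; rewrite exprS; field.
  by rewrite !expf_neq0.
(* The supremum over the tail from k on dominates g at x, and by the summed increments it exceeds
   its term of index k by at most [2 * M / 2 ^+ k]. *)
have low k : gam - 2 * M / 2 ^+ k <= cutoff (y k) x.
  apply/ler_addgt0Pr => e e0; rewrite lerBlDr -lee_fin gE; apply: (le_trans (h3 k)).
  apply: ge_ereal_sup => _ [m /= km <-]; rewrite lee_fin.
  have := tail k m km; rewrite ler_norml => /andP[_].
  have : 0 <= 2 * M / 2 ^+ m by rewrite divr_ge0 ?exprn_ge0// mulr_ge0.
  move: (2 * M / 2 ^+ m) (2 * M / 2 ^+ k) => a b; lra.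
exists (fun k => (gam - 2 * M / 2 ^+ k)%:E), (fun k => (gam + k.+1%:R^-1)%:E); split.
- rewrite -/g -gE; apply: cvg_EFin; first exact: nearW.
  rewrite -[X in _ --> X]subr0; apply: cvgB; first exact: cvg_cst.
  have h : `|2^-1| < 1 :> R by rewrite gtr0_norm ?invr_gt0// invf_lt1// ltr1n.
  have := cvg_geometric (2 * M) h.
  by apply: cvg_trans; apply: near_eq_cvg; apply: nearW => k; rewrite /geometric/= exprVn.
- rewrite -/g -gE; apply: cvg_EFin; first exact: nearW.
  rewrite -[X in _ --> X]addr0; apply: cvgD; first exact: cvg_cst.
  exact: cvg_harmonic.
- exists n => // j /= nj; split; [by rewrite h2 lee_fin|exact: h1|exact: Lip_le_Lip_a|].
  have [_ _ _ HA] := Cy j; have [|r r0 rP] := HA x; first by move=> m jm; apply: An;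
    exact: leq_trans jm.
  apply: (Lip_a_le _ r0); first by rewrite addr_ge0// fine_ge0// (D_borel f).2.
  by move=> a b; rewrite !ballEmdist => xa xb; exact: rP.
Qed.

End approximation.

Theorem theorem1p6 (R : realType) (d : measure_display)
    (X : completeMetricMeasurableType R d) (mu : {measure set X -> \bar R})
    (hX : metric_measure_space mu) (f : X -> R) (hf : lipschitz_bs f) :
  exists f_ : nat -> X -> R,
    (forall j, [/\ lipschitz_bs (f_ j),
                   (LIP [set: X] (f_ j) <= LIP [set: X] f)%E
                 & forall x, `|f_ j x| <= `|f x|]) /\
    (forall x, f_ j x @[j --> \oo] --> f x) /\
    (forall K : set X, compact K -> {uniform K, f_ @ \oo --> f}) /\
    {ae mu, forall x,
      Lip_a (f_ j) x @[j --> \oo] --> minimal_star_upper_gradient mu f x} /\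
    {ae mu, forall x,
      Lip (f_ j) x @[j --> \oo] --> minimal_star_upper_gradient mu f x} /\
    {ae mu, forall x,
      minimal_star_upper_gradient mu (f_ j) x @[j --> \oo]
        --> minimal_star_upper_gradient mu f x}.
Proof.
have [L fL LE] := LIP_attained hf.1; have [sepX _ _] := hX.
have [xs xsP] := ex_dense_seq sepX.
have [y [yP [ycv yae]]] := approximating_sequence hX hf fL LE xsP.
exists y; split.
  move=> j; have [yL yf] := yP j; split => //; last by rewrite LE; apply: ereal_inf_lbound;
    exists L.
  split; first by exists L.
  have [_ [x [r H]]] := hf; exists x, r; apply: subset_trans H; apply: closure_subset => z /=.
  by apply: contra_neq => fz; apply/eqP; rewrite -normr_le0 (le_trans (yf z))// fz normr0.
split => //; split.
  move=> K; apply: (equilipschitz_cvg_compact fL.1) => // [j|] a b; last exact: fL.2.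
  by have [yL _] := yP j; exact: yL.2.
split; [|split]; apply: (@filterS _ _ (ae_filter_ringOfSetsType mu)) yae => x [lo [hi [loP hiP H]]];
  apply: squeeze_cvge loP hiP; apply: filterS H => j [h1 h2 h3 h4]; apply/andP; split => //.
- by rewrite (le_trans h1)// (le_trans h2).
- by rewrite (le_trans h1).
- by rewrite (le_trans h3).
- by rewrite (le_trans h2)// (le_trans h3).
Qed.
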